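(* Let $\mathbf k=\mathbb F_q$ be a finite field, let $\mathcal A$ be a linear stack over $\mathbf k$ equipped with a class map $\operatorname{cl}$ to a lattice $\Gamma$ satisfying the assumptions (1)–(3) of the context, and let $Z\subset\mathbb A^1_{\mathbf k}$ be an algebraic subvariety. Then $$H^Z_{\mathcal A}(t)=\operatorname{Exp}\left(\frac{[Z]}{q-1}\,A_{\mathcal A}(t)\right).$$
   Context: All field extensions are finite. Linear stacks: let $\operatorname{Spec}(\mathbf k)_{et}$ be the small étale site with structure sheaf $\mathcal O$ ($\mathcal O(\operatorname{Spec}K)=K$). A linear stack over $\mathbf k$ is a stack $\mathcal A$ over this site such that each category $\mathcal A(U)$ is $\mathcal O(U)$-linear, each restriction functor $\mathcal A(V)\to\mathcal A(U)$ is $\mathcal O(V)$-linear, and the categories $\mathcal A(K)=\mathcal A(\operatorname{Spec}K)$, for extensions $K/\mathbf k$, are additive, Karoubian (idempotents split), with finite-dimensional Hom-spaces over $K$. For $L/K/\mathbf k$ and $X\in\mathcal A(K)$, $X_L\in\mathcal A(L)$ denotes the restriction of $X$. $X\in\mathcal A(K)$ is absolutely indecomposable if $X_L$ is indecomposable for every extension $L/K$. Class map: there is a lattice $\Gamma\cong\mathbb Z^m$ and, for every $K/\mathbf k$, a group homomorphism $\operatorname{cl}:K_0(\mathcal A(K))\to\Gamma$ (in particular additive on direct sums) such that (1) $\operatorname{cl}(X_L)=\operatorname{cl}(X)$ for $L/K/\mathbf k$, $X\in\mathcal A(K)$; (2) for every $\mathbf d\in\Gamma$ there are finitely many isomorphism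 classes of $X\in\mathcal A(K)$ with $\operatorname{cl}(X)=\mathbf d$; (3) there is a closed convex cone $C\subset\Gamma\otimes_{\mathbb Z}\mathbb R$ with $C\cap(-C)=\{0\}$ and $\operatorname{cl}(X)\in C$ for all $X\in\mathcal A(K)$ and all $K$. Volume ring: $\mathcal V=\prod_{n\ge1}\mathbb Q$ with $\psi_m((a_n)_n)=(a_{mn})_n$. For a family of finite sets or rational numbers $c(K)$ ($K/\mathbf k$), its volume is $[c]=(\#c(\mathbb F_{q^n}))_n$, resp. $(c(\mathbb F_{q^n}))_n$; for a variety $Z$ over $\mathbf k$, $[Z]=(\#Z(\mathbb F_{q^n}))_n$. In formulas in $\mathcal V$, $q$ denotes $(q^n)_{n\ge1}$. Series: all series are formal sums $\sum_{\mathbf d\in C\cap\Gamma}a_{\mathbf d}t^{\mathbf d}$, $a_{\mathbf d}\in\mathcal V$, with $\psi_n(\sum a_{\mathbf d}t^{\mathbf d})=\sum\psi_n(a_{\mathbf d})t^{n\mathbf d}$. For $f$ with zero coefficient at $\mathbf d=0$, $\operatorname{Exp}(f)=\exp(\sum_{n\ge1}\psi_n(f)/n)$. For a finite-dimensional $K$-algebra $B$, $B^Z$ is the set of $x\in B$ whose minimal polynomial over $K$ has all its roots in $Z(\bar{\mathbf k})$. Define $H^Z_{\mathcal A}(t)=\sum_{\mathbf d}[H^Z_{\mathbf d}]t^{\mathbf d}$ with $$H^Z_{\mathbf d}(K)=\sum_{X\in\mathcal A(K)/\sim,\ \operatorname{cl}X=\mathbf d}\frac{\#\operatorname{End}(X)^Z}{\#\operatorname{Aut}(X)},$$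 where $\mathcal A(K)/\sim$ is the set of isomorphism classes of objects, and $A_{\mathcal A}(t)=\sum_{\mathbf d}[A_{\mathbf d}]t^{\mathbf d}$, where $A_{\mathbf d}(K)$ is the number of isomorphism classes of absolutely indecomposable $X\in\mathcal A(K)$ with $\operatorname{cl}(X)=\mathbf d$. *)

(* Defs.v *)
From HB Require Import structures.
From mathcomp Require Import all_boot all_order all_algebra all_field.
From mathcomp Require Import finmap.
From mathcomp Require Import all_classical all_reals all_analysis.

Set Implicit Arguments.
Unset Strict Implicit.
Unset Printing Implicit Defensive.

Import Order.TTheory GRing.Theory Num.Theory.
Import numFieldNormedType.Exports.
Local Open Scope classical_set_scope.
Local Open Scope ring_scope.

Record lincat (R : comPzRingType) := LinCat {
  obj :> Type;
  hom : obj -> obj -> lmodType R;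
  idm : forall X, hom X X;
  cmp : forall X Y Z, hom Y Z -> hom X Y -> hom X Z;
  cmpA : forall X Y Z T (h : hom Z T) (g : hom Y Z) (f : hom X Y),
    cmp h (cmp g f) = cmp (cmp h g) f;
  cmp1f : forall X Y (f : hom X Y), cmp (idm Y) f = f;
  cmpf1 : forall X Y (f : hom X Y), cmp f (idm X) = f;
  cmpDl : forall X Y Z (g g' : hom Y Z) (f : hom X Y),
    cmp (g + g') f = cmp g f + cmp g' f;
  cmpDr : forall X Y Z (g : hom Y Z) (f f' : hom X Y),
    cmp g (f + f') = cmp g f + cmp g f';
  cmpZl : forall X Y Z a (g : hom Y Z) (f : hom X Y),
    cmp (a *: g) f = a *: cmp g f;
  cmpZr : forall X Y Z a (g : hom Y Z) (f : hom X Y),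
    cmp g (a *: f) = a *: cmp g f }.

Arguments hom {R l} X Y : rename.
Arguments idm {R l} X : rename.
Arguments cmp {R l X Y Z} g f : rename.

Notation "g \c f" := (cmp g f) (at level 40, left associativity).

Section LinCatTheory.
Variables (R : comPzRingType) (A : lincat R).
Implicit Types X Y Z : A.

Definition is_iso X Y (f : hom X Y) :=
  exists2 g : hom Y X, g \c f = idm X & f \c g = idm Y.

Definition isomorphic X Y := exists f : hom X Y, is_iso f.

Definition iso_class X : set A := [set Y | isomorphic X Y].

Definition is_zero X := idm X = 0.

Definition is_sum X Y Z := exists (i : hom X Z) (j : hom Y Z) (p : hom Z X)
    (r : hom Z Y),
  [/\ p \c i = idm X, r \c j = idm Y, p \c j = 0, r \c i = 0
    & i \c p + j \c r = idm Z].

Definition indecomposable X :=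
  ~ is_zero X /\ forall Y Z, is_sum Y Z X -> is_zero Y \/ is_zero Z.

Definition additive_cat :=
  (exists X, is_zero X) /\ forall X Y, exists Z, is_sum X Y Z.

Definition karoubian := forall X (e : hom X X), e \c e = e ->
  exists (Y : A) (r : hom X Y) (s : hom Y X), r \c s = idm Y /\ s \c r = e.

Definition fin_dim_homs := forall X Y, exists (n : nat) (b : 'I_n -> hom X Y),
  forall f, exists c : 'I_n -> R, f = \sum_(i < n) c i *: b i.

End LinCatTheory.

(** An étale scheme over a field is a disjoint union of spectra of finite
   separable extensions; over a finite field every finite extension is
   separable.  [Etsch K] is the disjoint union of the [Spec (K i)]. *)

Record etsch (k : finFieldType) := Etsch {
  pts : Type;
  fld : pts -> fieldExtType k }.

Record etmor (k : finFieldType) (V U : etsch k) := Etmor {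
  onpts : pts V -> pts U;
  onfld : forall j : pts V, 'AHom(fld (onpts j), fld j) }.

Definition etid (k : finFieldType) (U : etsch k) : etmor U U :=
  @Etmor k U U id (fun i => id_ahom (fld i)).

Definition etcomp (k : finFieldType) (W V U : etsch k)
    (f : etmor V U) (g : etmor W V) : etmor W U :=
  @Etmor k W U (fun i => onpts f (onpts g i))
    (fun i => comp_ahom (onfld g i) (onfld f (onpts g i))).

Definition Spec (k : finFieldType) (K : fieldExtType k) : etsch k :=
  @Etsch k unit (fun=> K).

Definition Spec_map (k : finFieldType) (K L : fieldExtType k)
    (s : 'AHom(K, L)) : etmor (Spec L) (Spec K) :=
  @Etmor k (Spec L) (Spec K) id (fun=> s).

Definition Osch (k : finFieldType) (U : etsch k) : Type :=
  forall i : pts U, fld i.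

Section OschRing.
Variables (k : finFieldType) (U : etsch k).
Implicit Types a b c : Osch U.

HB.instance Definition _ := gen_eqMixin (Osch U).
HB.instance Definition _ := gen_choiceMixin (Osch U).

Let zero : Osch U := fun=> 0.
Let opp a : Osch U := fun i => - a i.
Let add a b : Osch U := fun i => a i + b i.
Let one : Osch U := fun=> 1.
Let mul a b : Osch U := fun i => a i * b i.

Let addA : associative add.
Proof. by move=> a b c; apply: functional_extensionality_dep => i; exact: addrA. Qed.
Let addC : commutative add.
Proof. by move=> a b; apply: functional_extensionality_dep => i; exact: addrC. Qed.
Let add0 : left_id zero add.
Proof. by move=> a; apply: functional_extensionality_dep => i; exact: add0r. Qed.
Let addN : left_inverse zero opp add.
Proof. by move=> a; apply: functional_extensionality_dep => i; exact: addNr. Qed.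

HB.instance Definition _ := GRing.isZmodule.Build (Osch U) addA addC add0 addN.

Let mulA : associative mul.
Proof. by move=> a b c; apply: functional_extensionality_dep => i; exact: mulrA. Qed.
Let mulC : commutative mul.
Proof. by move=> a b; apply: functional_extensionality_dep => i; exact: mulrC. Qed.
Let mul1 : left_id one mul.
Proof. by move=> a; apply: functional_extensionality_dep => i; exact: mul1r. Qed.
Let mulDl : left_distributive mul add.
Proof. by move=> a b c; apply: functional_extensionality_dep => i; exact: mulrDl. Qed.

HB.instance Definition _ :=
  GRing.Zmodule_isComPzRing.Build (Osch U) mulA mulC mul1 mulDl.

End OschRing.

Definition Opull (k : finFieldType) (V U : etsch k) (f : etmor V U)
    (a : Osch U) : Osch V := fun j => onfld f j (a (onpts f j)).

(** The identification [K = O(Spec K)]. *)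
Definition Oconst (k : finFieldType) (K : fieldExtType k) (a : K) :
  Osch (Spec K) := fun=> a.

Record covering (k : finFieldType) (U : etsch k) := Covering {
  cidx : Type;
  csrc : cidx -> etsch k;
  cmap : forall a, etmor (csrc a) U;
  csurj : forall i : pts U, exists a, exists j, onpts (cmap a) j = i }.

Arguments csrc {k U} S a : rename.
Arguments cmap {k U} S a : rename.

(** A pseudofunctor from étale schemes to linear categories.  The structural
   isomorphisms [resI : id^* X -> X] and [resC : g^* f^* X -> (f g)^* X] are
   indexed by a morphism [h] together with a proof that [h] is the identity,
   resp. the composite; this replaces transports along associativity and unit
   equalities in the coherence laws. *)

Record linpfun (k : finFieldType) := LinPfun {
  fib :> forall U : etsch k, lincat (Osch U);
  res : forall (V U : etsch k) (f : etmor V U), fib U -> fib V;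
  resm : forall (V U : etsch k) (f : etmor V U) (X Y : fib U),
    hom X Y -> hom (res f X) (res f Y);
  resm1 : forall V U (f : etmor V U) (X : fib U),
    resm f (idm X) = idm (res f X);
  resmM : forall V U (f : etmor V U) (X Y Z : fib U)
    (v : hom Y Z) (u : hom X Y), resm f (v \c u) = resm f v \c resm f u;
  resmD : forall V U (f : etmor V U) (X Y : fib U) (u v : hom X Y),
    resm f (u + v) = resm f u + resm f v;
  resmZ : forall V U (f : etmor V U) (X Y : fib U) (a : Osch U) (u : hom X Y),
    resm f (a *: u) = Opull f a *: resm f u;
  resI : forall U (h : etmor U U), h = etid U ->
    forall X : fib U, hom (res h X) X;
  resI_iso : forall U h (e : h = etid U) X, is_iso (resI e X);
  resI_nat : forall U h (e : h = etid U) (X Y : fib U) (u : hom X Y),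
    u \c resI e X = resI e Y \c resm h u;
  resC : forall W V U (g : etmor W V) (f : etmor V U) (h : etmor W U),
    h = etcomp f g -> forall X : fib U, hom (res g (res f X)) (res h X);
  resC_iso : forall W V U g f h (e : h = @etcomp k W V U f g) X,
    is_iso (resC e X);
  resC_nat : forall W V U g f h (e : h = @etcomp k W V U f g) (X Y : fib U)
    (u : hom X Y), resm h u \c resC e X = resC e Y \c resm g (resm f u);
  resCI : forall V U (f : etmor V U) (i : etmor V V) (ei : i = etid V)
    (e : f = etcomp f i) (X : fib U), resC e X = resI ei (res f X);
  resIC : forall V U (f : etmor V U) (i : etmor U U) (ei : i = etid U)
    (e : f = etcomp i f) (X : fib U), resC e X = resm f (resI ei X);
  resCA : forall T W V U (l : etmor T W) (g : etmor W V) (f : etmor V U)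
    (fg : etmor W U) (gl : etmor T V) (h : etmor T U)
    (efg : fg = etcomp f g) (egl : gl = etcomp g l)
    (eh : h = etcomp fg l) (eh' : h = etcomp f gl) (X : fib U),
    resC eh X \c resm l (resC efg X) = resC eh' X \c resC egl (res f X) }.

Arguments res {k l V U} f X : rename.
Arguments resm {k l V U} f {X Y} u : rename.
Arguments resI {k l U h} e X : rename.
Arguments resC {k l W V U g f h} e X : rename.

Section Descent.
Variables (k : finFieldType) (A : linpfun k) (U : etsch k) (S : covering U).

(** The overlap [U_a x_U U_b] of two members of a covering enters through its
   generalized points, i.e. pairs [p : V -> U_a], [p' : V -> U_b] with equal
   composites to [U].  The morphism [w] below is [h^* X -> h^* Y] induced both
   by [u a] and by [u b]. *)
Definition compatible (X Y : A U)
    (u : forall a, hom (res (cmap S a) X) (res (cmap S a) Y)) :=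
  forall (a b : cidx S) (V : etsch k) (p : etmor V (csrc S a))
    (p' : etmor V (csrc S b)) (h : etmor V U)
    (e : h = etcomp (cmap S a) p) (e' : h = etcomp (cmap S b) p'),
  exists w : hom (res h X) (res h Y),
    w \c resC e X = resC e Y \c resm p (u a) /\
    w \c resC e' X = resC e' Y \c resm p' (u b).

Definition morphisms_glue := forall (X Y : A U)
    (u : forall a, hom (res (cmap S a) X) (res (cmap S a) Y)),
  compatible u -> exists! v : hom X Y, forall a, resm (cmap S a) v = u a.

Record descent_datum := DescentDatum {
  dobj : forall a, A (csrc S a);
  dphi : forall (a b : cidx S) (V : etsch k) (p : etmor V (csrc S a))
    (p' : etmor V (csrc S b)), etcomp (cmap S a) p = etcomp (cmap S b) p' ->
    hom (res p (dobj a)) (res p' (dobj b));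
  dphi_iso : forall a b V p p' (e : _ = _), is_iso (@dphi a b V p p' e);
  dphi_nat : forall a b W V (g : etmor W V) p p' (e : _ = _)
    (pg : etmor W (csrc S a)) (pg' : etmor W (csrc S b))
    (epg : pg = etcomp p g) (epg' : pg' = etcomp p' g) (eg : _ = _),
    @dphi a b W pg pg' eg \c resC epg (dobj a)
    = resC epg' (dobj b) \c resm g (@dphi a b V p p' e);
  dphi_cocycle : forall a b c V p p' p'' (e : _ = _) (e' : _ = _) (e'' : _ = _),
    @dphi b c V p' p'' e' \c @dphi a b V p p' e = @dphi a c V p p'' e'' }.

(** [t] is the canonical isomorphism [p^* U_a^* X -> h^* X -> p'^* U_b^* X]. *)
Definition effective (D : descent_datum) :=
  exists (X : A U) (psi : forall a, hom (res (cmap S a) X) (dobj D a)),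
    (forall a, is_iso (psi a)) /\
    forall a b V (p : etmor V (csrc S a)) (p' : etmor V (csrc S b)) (h : etmor V U)
      (ea : h = etcomp (cmap S a) p) (eb : h = etcomp (cmap S b) p')
      (e : etcomp (cmap S a) p = etcomp (cmap S b) p'),
    exists2 t : hom (res p (res (cmap S a) X)) (res p' (res (cmap S b) X)),
      resC eb X \c t = resC ea X &
      resm p' (psi b) \c t = dphi D e \c resm p (psi a).

End Descent.

Definition is_stack (k : finFieldType) (A : linpfun k) :=
  forall (U : etsch k) (S : covering U),
    morphisms_glue A S /\ forall D : descent_datum A S, effective D.

Record linear_stack (k : finFieldType) := LinearStack {
  stack_pfun :> linpfun k;
  stackP : is_stack stack_pfun;
  stack_additive : forall K : fieldExtType k,
    additive_cat (stack_pfun (Spec K));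
  stack_karoubian : forall K : fieldExtType k, karoubian (stack_pfun (Spec K));
  stack_fin_dim : forall K : fieldExtType k,
    fin_dim_homs (stack_pfun (Spec K)) }.

Definition abs_indecomposable (k : finFieldType) (A : linear_stack k)
    (K : fieldExtType k) (X : A (Spec K)) :=
  forall (L : fieldExtType k) (s : 'AHom(K, L)),
    indecomposable (res (Spec_map s) X).

(** A lattice [Gamma] is identified with [Z^m], and its extension of scalars
   to the reals with [R^m]. *)
Definition toreal (R : realType) (m : nat) (d : 'rV[int]_m) : 'rV[R]_m :=
  map_mx intr d.

Record closed_pointed_cone (R : realType) (m : nat) (C : set 'rV[R]_m) : Prop :=
  ClosedPointedCone {
  cone_closed : closed C;
  cone0 : C 0;
  coneD : forall x y, C x -> C y -> C (x + y);
  coneZ : forall (a : R) x, 0 <= a -> C x -> C (a *: x);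
  cone_pointed : forall x, C x -> C (- x) -> x = 0 }.

(** A homomorphism from the (split) Grothendieck group [K_0 (A K)] is the same
   as a function on objects that is additive on direct sums; invariance under
   isomorphism follows, since [is_sum X Y Z] only determines [Z] up to
   isomorphism. *)
Record class_map (k : finFieldType) (A : linear_stack k) (R : realType)
    (m : nat) (C : set 'rV[R]_m)
    (cl : forall K : fieldExtType k, A (Spec K) -> 'rV[int]_m) : Prop :=
  ClassMap {
  cl_sum : forall K (X Y Z : A (Spec K)), is_sum X Y Z ->
    cl K Z = cl K X + cl K Y;
  cl_res : forall (K L : fieldExtType k) (s : 'AHom(K, L)) (X : A (Spec K)),
    cl L (res (Spec_map s) X) = cl K X;
  cl_finite : forall (K : fieldExtType k) (d : 'rV[int]_m),
    finite_set [set iso_class X | X in [set X | cl K X = d]];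
  cl_coneP : closed_pointed_cone C;
  cl_cone : forall K (X : A (Spec K)), C (toreal R (cl K X)) }.

Definition posn := {n : nat | (0 < n)%N}.

Lemma posn_mul_subproof (m n : posn) : (0 < val m * val n)%N.
Proof. by rewrite muln_gt0 (valP m) (valP n). Qed.

Definition pmul (m n : posn) : posn :=
  exist _ (val m * val n)%N (posn_mul_subproof m n).

Definition vring := posn -> rat.

Definition vpsi (m : posn) (a : vring) : vring := fun n => a (pmul m n).

Section Series.
Variables (R : realType) (m : nat) (C : set 'rV[R]_m).

(** A family [f : series] stands for the sum of the [f d t^d], [d] in
   [C \cap Gamma].  All sums below have finitely many nonzero terms when [C] is
   a closed pointed cone and [f] is supported in [C] (with [f 0 = 0] in [sexp]
   and [Exp]). *)
Definition series := 'rV[int]_m -> vring.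

Definition sone : series := fun d => if d == 0 then 1 else 0.

Definition smul (f g : series) : series := fun d =>
  \sum_(e \in [set e | C (toreal R e) /\ C (toreal R (d - e))]) f e * g (d - e).

Definition spow (f : series) (n : nat) : series := iter n (smul f) sone.

Definition spsi (n : posn) (f : series) : series := fun d =>
  \sum_(e \in [set e : 'rV[int]_m | e *+ val n = d]) vpsi n (f e).

Definition sexp (f : series) : series := fun d =>
  \sum_(n \in [set: nat]) cst (n`!%:R)^-1 * spow f n d.

Definition Exp (f : series) : series :=
  sexp (fun d => \sum_(n \in [set: posn]) cst ((val n)%:R)^-1 * spsi n f d).

End Series.

(** [F n] plays the role of the extension of degree [n] of [k]. *)
Definition vol (k : finFieldType) (F : posn -> fieldExtType k)
    (c : fieldExtType k -> rat) : vring := fun n => c (F n).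

Definition qvol (k : finFieldType) : vring := fun n => (#|k| ^ val n)%:R.

(** A locally closed subset of the affine line over [k]: the common zeros of
   [zeros] at which at least one member of [nonzeros] does not vanish. *)
Record subvariety (k : fieldType) := Subvariety {
  zeros : seq {poly k};
  nonzeros : seq {poly k} }.

Definition Zpoints (k : fieldType) (Z : subvariety k) (L : fieldType)
    (i : {rmorphism k -> L}) : set L :=
  [set x | (forall p, p \in zeros Z -> root (map_poly i p) x) /\
    (exists2 p, p \in nonzeros Z & ~~ root (map_poly i p) x)].

Definition cardset (T : choiceType) (S : set T) : nat := (#|` fset_set S|)%fset.

Definition Zcount (k : finFieldType) (Z : subvariety k) (K : fieldExtType k) :
  rat := (cardset (Zpoints Z (GRing.in_alg K)))%:R.

Section Counting.
Variables (k : finFieldType) (kbar : closedFieldType).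
Variable iota : {rmorphism k -> kbar}.
Variable A : linear_stack k.
Variable K : fieldExtType k.
Implicit Type X : A (Spec K).

Definition heval X (p : {poly K}) (x : hom X X) : hom X X :=
  \sum_(i < size p) Oconst p`_i *: iter i (cmp x) (idm X).

Definition is_minpoly X (p : {poly K}) (x : hom X X) :=
  [/\ p \is monic, heval p x = 0 &
    forall r, r \is monic -> heval r x = 0 -> (size p <= size r)%N].

(** The condition does not depend on the [k]-embedding [j]. *)
Definition EndZ (Z : subvariety k) X : set (hom X X) :=
  [set x | exists2 p, is_minpoly p x &
    forall j : {rmorphism K -> kbar}, (forall a : k, j a%:A = iota a) ->
    forall z, root (map_poly j p) z -> Zpoints Z iota z].
Arguments EndZ : clear implicits.

Definition Aut X : set (hom X X) := [set f | is_iso f].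
Arguments Aut : clear implicits.

(** The ratio below is the same for all members [X] of the class [c]. *)
Definition class_weight (Z : subvariety k) (c : set (A (Spec K))) : rat :=
  xget 0 [set r | exists2 X, c X &
    r = (cardset (EndZ Z X))%:R / (cardset (Aut X))%:R].

Variables (m : nat) (cl : A (Spec K) -> 'rV[int]_m) (d : 'rV[int]_m).

Definition Hcoef (Z : subvariety k) : rat :=
  \sum_(c \in [set iso_class X | X in [set X | cl X = d]]) class_weight Z c.

Definition Acoef : rat :=
  (cardset [set iso_class X | X in
    [set X | abs_indecomposable X /\ cl X = d]])%:R.

End Counting.

Definition Hseries (k : finFieldType) (kbar : closedFieldType)
    (iota : {rmorphism k -> kbar}) (F : posn -> fieldExtType k)
    (A : linear_stack k) (m : nat)
    (cl : forall K : fieldExtType k, A (Spec K) -> 'rV[int]_m)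
    (Z : subvariety k) : series m :=
  fun d => vol F (fun K => Hcoef iota (cl K) d Z).

Definition Aseries (k : finFieldType) (F : posn -> fieldExtType k)
    (A : linear_stack k) (m : nat)
    (cl : forall K : fieldExtType k, A (Spec K) -> 'rV[int]_m) : series m :=
  fun d => vol F (fun K => Acoef (cl K) d).

(* Main.v *)
From Pilot Require Import Defs.
From HB Require Import structures.
From mathcomp Require Import all_boot all_order all_fingroup all_algebra all_solvable all_field.
From mathcomp Require Import finmap zify.
From mathcomp Require Import all_classical all_reals all_analysis.
Set Implicit Arguments.
Unset Strict Implicit.
Unset Printing Implicit Defensive.
Import Order.TTheory GRing.Theory Num.Theory.
Import numFieldNormedType.Exports.
Local Open Scope classical_set_scope.
Import Pilot.Defs.
Local Open Scope ring_scope.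

(** The formula is compared degree by degree, over [K = F n], by means of
   logarithmic derivatives. As [C] is a closed pointed cone, only finitely many
   lattice points [e] have [e] and [d - e] in [C]; a series [H] supported in [C]
   with constant term [1] therefore equals [exp h] as soon as
   [t_i dH/dt_i = (t_i dh/dt_i) H] for all [i] ([conv_exp_unique]). It remains to
   compute both sides of this equation for the series [H] of objects and the
   logarithm [h] of the right-hand side.

   The series of objects. Hom sets are finite, so every object of [A K] has a
   Krull-Schmidt decomposition, and an indecomposable [P] has a finite local
   endomorphism ring. Its residue field is a finite field, of some degree [e]
   over [K], which is realized in [kbar] by a ring homomorphism
   ([residue_character]). If [X] is the sum of [r_s] copies of [P_s], then
   [End X] is, up to nilpotents, the product of the rings of [r_s] by [r_s]
   matrices over the residue fields. An endomorphism is invertible, or has the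
   roots of its minimal polynomial in [Z], if and only if its blocks have this
   property ([block_iso], [EndZ_blocks]). So the weight of [X] is a product of
   ratios #(matrices with spectrum in [Z]) / #(invertible matrices)
   ([weight_formula]), and [H] is a product over the indecomposables. For a
   finite field with [Q] elements, count pairs of a matrix and a vector by the
   cyclic subspace that the vector generates: if [a] is the generating series of
   monic polynomials with roots in [Z], that is, the zeta function of [Z], the
   generating series [w] of the ratios satisfies [w(Q t) = a(t) w(t)]
   ([cyclic_recursion], [zeta_recursion]). Its logarithm is thus the sum of the
   terms [#Z_i / (Q^i - 1) t^i / i], where [Z_i] consists of the points of [Z]
   over the extension of degree [i] ([matrix_recursion]). This gives the
   logarithmic derivative of [H] as a sum over the indecomposables over [K]
   ([Hcoef_recursion_reps]).

   The logarithm of the right-hand side. It involves the absolutely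
   indecomposable objects over all extensions [L] of [K], which have to be
   expressed by the indecomposables over [K]. By descent in the stack, the
   morphisms between restricted objects are the [L]-linear combinations of
   morphisms over [K] ([descent_basis]), and every object over [L] is a summand
   of a restricted one, namely of its direct image ([direct_image]). Let [P] be
   indecomposable over [K], with residue field [l] of degree [e]. Up to
   nilpotents the endomorphism ring of the restriction [P_L] is the tensor
   product of [L] and [l]; its characters extend the [e] conjugates of the
   character of [P]. If [e] divides the degree of [L] over [K], this ring is a
   product of [e] copies of [L], and [P_L] is a sum of [e] pairwise
   non-isomorphic objects with residue field [L], which is the same as being
   absolutely indecomposable; they are Galois conjugates and have the same class.
   Otherwise no summand of [P_L] is absolutely indecomposable. Restrictions of
   non-isomorphic indecomposables have no common summand. Hence the number of
   absolutely indecomposable objects of class [d] over the extension of degree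
   [n] is the sum of the [e] over the indecomposables of class [d *+ e] whose
   residue degree [e] divides [n] ([Acoef_residue_degrees]). With this the terms
   of the two logarithmic derivatives match one by one
   ([Hcoef_log_derivative_reps]). *)

(** * Finite fields and their embeddings *)

Section FieldEmbedding.
Variables (k0 D M : fieldType).
Variables (a : {rmorphism k0 -> D}) (f : {rmorphism k0 -> M}).

Lemma poly_annihilator_min (t : D) (p0 : {poly k0}) :
  p0 != 0 -> (map_poly a p0).[t] = 0 ->
  exists P : {poly k0}, [/\ P != 0, (map_poly a P).[t] = 0 &
    forall p, (map_poly a p).[t] = 0 -> P %| p].
Proof.
move=> p0n hp0.
pose good n := `[< exists P : {poly k0}, [/\ P != 0, (map_poly a P).[t] = 0 & size P = n] >].
have ex : exists n, good n by exists (size p0); apply/asboolP; exists p0.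
case: (ex_minnP ex) => n /asboolP[P [Pn hP sP]] nmin.
exists P; split=> // p hp; apply/modp_eq0P/eqP/negPn/negP => rn.
have hr : (map_poly a (p %% P)).[t] = 0.
  have := hp; rewrite {1}(divp_eq p P) rmorphD rmorphM /= hornerD hornerM hP.
  by rewrite mulr0 add0r.
have : good (size (p %% P)) by apply/asboolP; exists (p %% P).
by move/nmin; rewrite leqNgt -sP ltn_modp Pn.
Qed.

(** [t] generates [D] and [P] generates the ideal of polynomials vanishing at
   [t], so that sending [t] to a root of [P] is well defined. *)
Lemma field_hom_of_root (t : D) (P : {poly k0}) (z : M) :
  (forall x : D, exists p, x = (map_poly a p).[t]) ->
  (forall p, (map_poly a p).[t] = 0 -> P %| p) ->
  root (map_poly f P) z ->
  exists g : {rmorphism D -> M}, forall c, g (a c) = f c.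
Proof.
move=> hsurj hP hz.
have [c hc] := choice hsurj.
have hwd p q : (map_poly a p).[t] = (map_poly a q).[t] ->
    (map_poly f p).[z] = (map_poly f q).[z].
  move=> e; apply/eqP; rewrite -subr_eq0 -hornerN -hornerD -rmorphB.
  have /hP/dvdpP[r ->] : (map_poly a (p - q)).[t] = 0.
    by rewrite rmorphB hornerD hornerN e subrr.
  by rewrite rmorphM /= hornerM (rootP hz) mulr0.
pose g x := (map_poly f (c x)).[z].
have gE p : g (map_poly a p).[t] = (map_poly f p).[z] by apply: hwd; rewrite -hc.
have gB : zmod_morphism g.
  move=> x y; rewrite {1}(hc x) {1}(hc y) -hornerN -hornerD -rmorphB gE.
  by rewrite rmorphB hornerD hornerN.
have gM : monoid_morphism g.
  split; first by have := gE 1; rewrite !rmorph1 !hornerC.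
  by move=> x y; rewrite {1}(hc x) {1}(hc y) -hornerM -rmorphM gE rmorphM hornerM.
pose gR := GRing.isZmodMorphism.Build _ _ g gB.
pose gR' := GRing.isMonoidMorphism.Build _ _ g gM.
pose G : {rmorphism D -> M} := HB.pack g gR gR'.
exists G => x; rewrite /G /=; have := gE x%:P.
by rewrite !map_polyC !hornerC.
Qed.

End FieldEmbedding.

Section FiniteExtensions.
Variable k : finFieldType.
Implicit Types K L : fieldExtType k.
Local Notation q := #|k|.

Definition fdim L := \dim {: L}.

Lemma fdim_gt0 L : (0 < fdim L)%N.
Proof. by rewrite /fdim adim_gt0. Qed.

Lemma card_gt1 : (1 < q)%N.
Proof. exact: finNzRing_gt1. Qed.

Lemma frobD (E : fieldType) (f : {rmorphism k -> E}) n (x y : E) :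
  (x + y) ^+ (q ^ n) = x ^+ (q ^ n) + y ^+ (q ^ n).
Proof.
have [p pp cp] := finPcharP k.
have cE : p \in [pchar E] by rewrite (fmorph_pchar f).
apply: exprDn_pchar; rewrite pnatX; apply/orP; left.
rewrite (eq_pnat _ (pcharf_eq cE)).
have := fin_ring_pchar_abelem cp; case/and3P => [h _ _].
by move: h; rewrite /pgroup cardsT.
Qed.

Lemma frobN (E : fieldType) (f : {rmorphism k -> E}) n (x : E) :
  (- x) ^+ (q ^ n) = - (x ^+ (q ^ n)).
Proof.
apply/eqP; rewrite -addr_eq0 -(frobD f) addNr expr0n.
by rewrite expn_eq0 -leqn0 leqNgt (ltnW card_gt1).
Qed.

Lemma card_fext L : #|finvect_type L| = (q ^ fdim L)%N.
Proof.
pose c := Vector.class (finvect_type L : vectType k).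
by rewrite -(@card_vspacef k (finvect_type L) c) (@card_vspace k (finvect_type L) c).
Qed.

Lemma expf_fdim L (x : L) : x ^+ (q ^ fdim L) = x.
Proof. by have := @expf_card (finvect_type L) x; rewrite card_fext. Qed.

Lemma frob_iter (E : fieldType) n m (x : E) :
  x ^+ (q ^ n) = x -> x ^+ (q ^ (n * m)) = x.
Proof.
move=> h; elim: m => [|m IH]; first by rewrite muln0 expr1.
by rewrite mulnS expnD exprM h IH.
Qed.

(** The image of [D] consists of [#|D|] roots of ['X^#|D| - 'X]. *)
Lemma finField_fixed_image (D : finFieldType) (M : fieldType) (f : {rmorphism D -> M})
    (z : M) : z ^+ #|D| = z -> exists x, z = f x.
Proof.
move=> hz; have q1 := finNzRing_gt1 D.
have szp : size ('X^#|D| - 'X : {poly M}) = #|D|.+1.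
  by rewrite size_polyDl size_polyXn // size_polyN size_polyX ltnS.
pose s := [seq f x | x <- enum D].
case: (boolP (z \in s)) => [/mapP[x _ ->]|zs]; first by exists x.
have : (size (z :: s) < size ('X^#|D| - 'X : {poly M})%R)%N.
  apply: max_poly_roots.
  - by rewrite -size_poly_eq0 szp.
  - apply/allP => y; rewrite inE => /orP[/eqP->|/mapP[x _ ->]].
      by rewrite rootE !hornerE hz subrr.
    by rewrite rootE !hornerE -rmorphXn /= expf_card subrr.
  - by rewrite /= zs (map_inj_uniq (fmorph_inj f)) enum_uniq.
by rewrite szp /= cardE size_map ltnn.
Qed.

Lemma fixed_frob_image L (M : fieldType) (f : {rmorphism L -> M}) (z : M) :
  z ^+ (q ^ fdim L) = z -> exists x, z = f x.
Proof.
by rewrite -card_fext; exact: (@finField_fixed_image (finvect_type L) M f z).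
Qed.

Lemma frob_rmorphism (E : fieldType) (f : {rmorphism k -> E}) n :
  exists g : {rmorphism E -> E}, forall x, g x = x ^+ (q ^ n).
Proof.
pose g (x : E) := x ^+ (q ^ n).
have gB : zmod_morphism g by move=> x y; rewrite /g (frobD f) (frobN f).
have gM : monoid_morphism g by split=> [|x y]; rewrite /g ?expr1n ?exprMn.
pose gR := GRing.isZmodMorphism.Build _ _ g gB.
pose gR' := GRing.isMonoidMorphism.Build _ _ g gM.
by exists (HB.pack_for {rmorphism E -> E} g gR gR').
Qed.

Lemma finField_primitive (F : finFieldType) :
  exists t : F, forall x : F, x = 0 \/ exists j, x = t ^+ j.
Proof.
have /cyclicP[u hu] :=
  field_unit_group_cyclic (setT_group {unit F}).
exists (val u : F) => x; case: (eqVneq x 0) => [|xn]; [by left|right].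
have xu : x \is a GRing.unit by rewrite unitfE.
have : FinRing.unit F xu \in cycle u.
  by rewrite -hu /= finset.inE.
move=> /cycleP[j /(congr1 val)] /= ->.
by exists j; rewrite FinRing.val_unitX.
Qed.

Lemma primitive_element L : exists t : L, forall x : L, x = 0 \/ exists j, x = t ^+ j.
Proof. exact: (finField_primitive (finvect_type L)). Qed.

Lemma frob_ahom L n : exists g : 'AHom(L, L), forall x, g x = x ^+ (q ^ n).
Proof.
pose g (x : L) := x ^+ (q ^ n).
have gB : zmod_morphism g.
  by move=> x y; rewrite /g (frobD (GRing.in_alg L)) (frobN (GRing.in_alg L)).
have gM : monoid_morphism g by split=> [|x y]; rewrite /g ?expr1n ?exprMn.
have gZ : scalable g.
  move=> c x; rewrite /g exprZn; congr (_ *: _).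
  have hc : c ^+ (q ^ 1) = c by rewrite expn1 expf_card.
  by have := frob_iter n hc; rewrite mul1n.
pose gR := GRing.isZmodMorphism.Build _ _ g gB.
pose gR' := GRing.isMonoidMorphism.Build _ _ g gM.
pose gR'' := GRing.isScalable.Build _ _ _ _ g gZ.
pose G : {lrmorphism L -> L} := HB.pack g gR gR' gR''.
by exists (linfun_ahom G) => x; exact: (lfunE G x).
Qed.

Lemma ahom_of_rmorphism K L (g : {rmorphism K -> L}) :
  (forall c : k, g c%:A = c%:A) -> exists h : 'AHom(K, L), forall x, h x = g x.
Proof.
move=> gc.
have gZ : scalable g by move=> c x; rewrite -mulr_algl rmorphM gc mulr_algl.
pose gR'' := GRing.isScalable.Build _ _ _ _ g gZ.
pose G : {lrmorphism K -> L} := HB.pack (g : K -> L) g gR''.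
by exists (linfun_ahom G) => x; exact: (lfunE G x).
Qed.

Lemma eval_primitive K (t : K) : (forall x : K, x = 0 \/ exists j, x = t ^+ j) ->
  forall x, exists p, x = (map_poly (GRing.in_alg K) p).[t].
Proof.
move=> ht x; case: (ht x) => [->|[j ->]].
  by exists 0; rewrite rmorph0 horner0.
by exists 'X^j; rewrite map_polyXn hornerXn.
Qed.

Lemma fext_annihilator K (t : K) :
  exists P : {poly k}, [/\ P != 0, (map_poly (GRing.in_alg K) P).[t] = 0,
    P %| 'X^(q ^ fdim K) - 'X & forall p, (map_poly (GRing.in_alg K) p).[t] = 0 -> P %| p].
Proof.
have q1 : (1 < q ^ fdim K)%N by rewrite -(exp1n (fdim K)) ltn_exp2r ?fdim_gt0 ?card_gt1.
have p0 : ('X^(q ^ fdim K) - 'X : {poly k}) != 0.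
  by rewrite -size_poly_eq0 size_polyDl size_polyXn // size_polyN size_polyX ltnS.
have pt : (map_poly (GRing.in_alg K) ('X^(q ^ fdim K) - 'X)).[t] = 0.
  by rewrite rmorphB /= map_polyXn map_polyX !hornerE expf_fdim subrr.
have [P [Pn Pt Pd]] := poly_annihilator_min p0 pt.
by exists P; split=> //; apply: Pd.
Qed.

Lemma annihilator_size_gt1 K (t : K) (P : {poly k}) :
  P != 0 -> (map_poly (GRing.in_alg K) P).[t] = 0 -> (1 < size P)%N.
Proof.
move=> Pn Pt; rewrite ltnNge; apply/negP => /size1_polyC e; move: Pt Pn.
by rewrite e map_polyC hornerC => /eqP; rewrite fmorph_eq0 polyC_eq0 => ->.
Qed.

Lemma embed_closed K (W : closedFieldType) (f : {rmorphism k -> W}) :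
  exists j : {rmorphism K -> W}, forall c : k, j c%:A = f c.
Proof.
have [t ht] := primitive_element K.
have [P [Pn Pt _ Pd]] := fext_annihilator t.
have /closed_rootP[z hz] : size (map_poly f P) != 1%N.
  by rewrite size_map_poly neq_ltn (annihilator_size_gt1 Pn Pt) orbT.
have [j hj] := field_hom_of_root (eval_primitive ht) Pd hz.
by exists j.
Qed.

(** The minimal polynomial of a generator of [K] divides ['X^(q^n) - 'X] for
   every multiple [n] of [fdim K], so that it splits in [L]. *)
Lemma embed_dvd K L : (fdim K %| fdim L)%N -> exists s : 'AHom(K, L), True.
Proof.
move=> /dvdnP[m dm].
have [t ht] := primitive_element K.
have [P [Pn Pt Pq Pd]] := fext_annihilator t.
pose iL := GRing.in_alg L.
have Pdiv : map_poly iL P %| \prod_(x : finvect_type L) ('X - x%:P).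
  rewrite -finField_genPoly card_fext.
  have -> : 'X^(q ^ fdim L) - 'X = map_poly iL ('X^(q ^ fdim L) - 'X : {poly k}).
    by rewrite rmorphB /= map_polyXn map_polyX.
  rewrite dvdp_map; apply: Pd.
  by rewrite rmorphB /= map_polyXn map_polyX !hornerE dm mulnC frob_iter ?subrr ?expf_fdim.
have [z hz] : exists z : L, root (map_poly iL P) z.
  have sP : (1 < size (map_poly iL P))%N.
    by rewrite size_map_poly; exact: annihilator_size_gt1 Pt.
  move: Pdiv; rewrite -big_enum /= => /dvdp_prod_XsubC[msk].
  move: (mask _ _) => s; case: s => [|z s] e; last first.
    by exists z; rewrite (eqp_root e) root_prod_XsubC mem_head.
  by move: sP; rewrite (eqp_size e) big_nil size_poly1.
have [j hj] := field_hom_of_root (eval_primitive ht) Pd hz.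
by have [h _] := ahom_of_rmorphism hj; exists h.
Qed.

(** A power of Frobenius of exponent [r] between [0] and [fdim L] is not the
   identity, since ['X^(q^r) - 'X] has fewer roots than [L] has elements. *)
Lemma frob_eq_mod L i i' : (forall x : L, x ^+ (q ^ i) = x ^+ (q ^ i')) ->
  i = i' %[mod fdim L].
Proof.
have q1 (n : nat) : (0 < n)%N -> (1 < q ^ n)%N.
  by move=> n0; rewrite -(exp1n n) ltn_exp2r ?card_gt1.
have ord n : (forall x : L, x ^+ (q ^ n) = x) -> (fdim L %| n)%N.
  move=> hn; rewrite /dvdn; have [//|r0] := posnP.
  set r := (n %% fdim L)%N in r0 *.
  have hr (x : L) : x ^+ (q ^ r) = x.
    rewrite -[in RHS](hn x) (divn_eq n (fdim L)) expnD exprM mulnC.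
    by rewrite (frob_iter _ (expf_fdim x)).
  have szp : size ('X^(q ^ r) - 'X : {poly L}) = (q ^ r).+1.
    by rewrite size_polyDl size_polyXn // size_polyN size_polyX ltnS q1.
  have : (size (enum (finvect_type L)) < size ('X^(q ^ r) - 'X : {poly L})%R)%N.
    apply: (@max_poly_roots (finvect_type L)).
    + by rewrite -size_poly_eq0 szp.
    + by apply/allP => x _; rewrite rootE !hornerE hr subrr.
    + exact: enum_uniq.
  rewrite szp -cardE card_fext ltnS leq_exp2l ?card_gt1 //.
  by rewrite leqNgt ltn_pmod ?fdim_gt0.
wlog le : i i' / (i <= i')%N.
  by move=> hw h; case: (leqP i i') => [|/ltnW] le; [|symmetry]; apply: hw.
move=> h; apply/eqP; rewrite eq_sym eqn_mod_dvd //; apply: ord => x.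
have [y ->] : exists y : L, x = y ^+ (q ^ i).
  exists (x ^+ (q ^ (fdim L * i - i))); rewrite -exprM -expnD subnK ?leq_pmull ?fdim_gt0 //.
  by rewrite (frob_iter _ (expf_fdim x)).
by rewrite -exprM -expnD subnKC // h.
Qed.

(** The polynomial whose roots are the conjugates of a generator [t] of
   [L^*] under [x |-> x^(q^n)] has coefficients fixed by that automorphism, so
   it is seen alike by both embeddings; hence [p' t] is conjugate to [p t]. *)
Lemma embeddings_conjugate L (M : fieldType) (p p' : {rmorphism L -> M}) n m :
  (0 < m)%N -> fdim L = (n * m)%N ->
  (forall x, x ^+ (q ^ n) = x -> p x = p' x) ->
  exists i : 'I_m, forall x, p' x = p (x ^+ (q ^ (n * i))).
Proof.
move=> m0 dL hp; have [t ht] := primitive_element L.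
pose fr i (x : L) := x ^+ (q ^ (n * i)).
pose P := \prod_(i < m) ('X - (fr i t)%:P).
have [g hg] := frob_ahom L n.
have Pfix : map_poly g P = P.
  rewrite /P rmorph_prod /=.
  have E i : map_poly g ('X - (fr i t)%:P) = 'X - (fr i.+1 t)%:P.
    rewrite rmorphB /= map_polyX map_polyC /= hg /fr -exprM -expnD.
    by rewrite addnC -mulnS.
  case: m m0 dL @P => // m _ dL P.
  rewrite (eq_bigr (fun i : 'I_m.+1 => 'X - (fr i.+1 t)%:P)) => [|i _]; last exact: E.
  rewrite big_ord_recr /= [RHS]big_ord_recl mulrC; congr (('X - _%:P) * _).
  by rewrite /fr -dL expf_fdim muln0 expr1.
have ePP : map_poly p P = map_poly p' P.
  apply/polyP => i; rewrite !coef_map; apply: hp.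
  by rewrite -hg -coef_map Pfix.
have : root (map_poly p' P) (p' t).
  rewrite /P rmorph_prod /= rootE horner_prod; apply/prodf_eq0 => /=.
  exists (Ordinal m0) => //.
  by rewrite rmorphB /= map_polyX map_polyC !hornerE /fr muln0 expr1 subrr.
rewrite -ePP /P rmorph_prod rootE horner_prod => /prodf_eq0[i _].
rewrite rmorphB /= map_polyX map_polyC !hornerE subr_eq0 => /eqP e.
exists i => x; case: (ht x) => [->|[j ->]].
  by rewrite expr0n expn_eq0 -leqn0 leqNgt (ltnW card_gt1) !rmorph0.
by rewrite rmorphXn /= e /fr -!rmorphXn -!exprM mulnC.
Qed.

End FiniteExtensions.

(** * Linear categories *)

Section LinCatBasics.
Variables (R : comPzRingType) (A : lincat R).
Implicit Types X Y Z : A.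

Lemma cmp0f X Y Z (f : hom X Y) : (0 : hom Y Z) \c f = 0.
Proof. by apply: (addrI (0 \c f)); rewrite -cmpDl !addr0. Qed.

Lemma cmpf0 X Y Z (g : hom Y Z) : g \c (0 : hom X Y) = 0.
Proof. by apply: (addrI (g \c 0)); rewrite -cmpDr !addr0. Qed.

Lemma cmpNf X Y Z (g : hom Y Z) (f : hom X Y) : (- g) \c f = - (g \c f).
Proof. by apply: (addrI (g \c f)); rewrite -cmpDl !subrr cmp0f. Qed.

Lemma cmpfN X Y Z (g : hom Y Z) (f : hom X Y) : g \c (- f) = - (g \c f).
Proof. by apply: (addrI (g \c f)); rewrite -cmpDr !subrr cmpf0. Qed.

Lemma cmpBl X Y Z (g g' : hom Y Z) (f : hom X Y) :
  (g - g') \c f = g \c f - g' \c f.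
Proof. by rewrite cmpDl cmpNf. Qed.

Lemma cmpBr X Y Z (g : hom Y Z) (f f' : hom X Y) :
  g \c (f - f') = g \c f - g \c f'.
Proof. by rewrite cmpDr cmpfN. Qed.

Lemma cmp_suml X Y Z I (r : seq I) (P : pred I) (g : I -> hom Y Z)
    (f : hom X Y) :
  (\sum_(i <- r | P i) g i) \c f = \sum_(i <- r | P i) (g i \c f).
Proof.
elim/big_rec2: _ => [|i y1 y2 _ <-]; first by rewrite cmp0f.
by rewrite cmpDl.
Qed.

Lemma cmp_sumr X Y Z I (r : seq I) (P : pred I) (g : hom Y Z)
    (f : I -> hom X Y) :
  g \c (\sum_(i <- r | P i) f i) = \sum_(i <- r | P i) (g \c f i).
Proof.
elim/big_rec2: _ => [|i y1 y2 _ <-]; first by rewrite cmpf0.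
by rewrite cmpDr.
Qed.

Lemma iso_inv_ex X Y (f : hom X Y) : is_iso f ->
  {g : hom Y X | g \c f = idm X & f \c g = idm Y}.
Proof. by move=> h; apply: cid2; case: h => g; exists g. Qed.

Definition inv X Y (f : hom X Y) (h : is_iso f) : hom Y X :=
  s2val (iso_inv_ex h).

Lemma invK X Y (f : hom X Y) (h : is_iso f) : inv h \c f = idm X.
Proof. by rewrite /inv; case: iso_inv_ex. Qed.

Lemma Kinv X Y (f : hom X Y) (h : is_iso f) : f \c inv h = idm Y.
Proof. by rewrite /inv; case: iso_inv_ex. Qed.

Lemma invKr X Y Z (f : hom X Y) (h : is_iso f) (g : hom X Z) :
  g \c inv h \c f = g.
Proof. by rewrite -cmpA invK cmpf1. Qed.

Lemma Kinvr X Y Z (f : hom X Y) (h : is_iso f) (g : hom Y Z) :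
  g \c f \c inv h = g.
Proof. by rewrite -cmpA Kinv cmpf1. Qed.

Lemma iso_epi X Y Z (f : hom X Y) (g g' : hom Y Z) :
  is_iso f -> g \c f = g' \c f -> g = g'.
Proof. by move=> h e; rewrite -(Kinvr h g) e Kinvr. Qed.

Lemma iso_mono X Y Z (f : hom Y Z) (g g' : hom X Y) :
  is_iso f -> f \c g = f \c g' -> g = g'.
Proof.
by move=> h e; rewrite -(cmp1f g) -(invK h) -cmpA e cmpA invK cmp1f.
Qed.

Lemma iso_idm X : is_iso (idm X).
Proof. by exists (idm X); rewrite cmp1f. Qed.

Lemma iso_inv X Y (f : hom X Y) (h : is_iso f) : is_iso (inv h).
Proof. by exists f; [exact: Kinv|exact: invK]. Qed.

Lemma iso_cmp X Y Z (g : hom Y Z) (f : hom X Y) :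
  is_iso g -> is_iso f -> is_iso (g \c f).
Proof.
move=> [g' g1 g2] [f' f1 f2]; exists (f' \c g').
  by rewrite cmpA -(cmpA f') g1 cmpf1.
by rewrite cmpA -(cmpA g) f2 cmpf1.
Qed.

Lemma isomorphic_refl X : isomorphic X X.
Proof. by exists (idm X); exact: iso_idm. Qed.

Lemma isomorphic_sym X Y : isomorphic X Y -> isomorphic Y X.
Proof. by move=> [f h]; exists (inv h); exact: iso_inv. Qed.

Lemma isomorphic_trans X Y Z :
  isomorphic X Y -> isomorphic Y Z -> isomorphic X Z.
Proof. by move=> [f h] [g h']; exists (g \c f); exact: iso_cmp. Qed.

Lemma iso_class_eq X Y : isomorphic X Y <-> iso_class X = iso_class Y.
Proof.
split=> [h|/seteqP[_ h]]; last exact/isomorphic_sym/isomorphic_sym/(h Y)/isomorphic_refl.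
apply/seteqP; split=> Z /=.
  exact/isomorphic_trans/isomorphic_sym.
exact/isomorphic_trans.
Qed.

End LinCatBasics.

(** * Descent along an extension of finite fields *)

Section EtaleMaps.
Variable k : finFieldType.

Lemma etmor_Spec_ext (V : etsch k) (L : fieldExtType k)
    (p p' : etmor V (Spec L)) :
  (forall j, onfld p j = onfld p' j :> 'AHom(L, fld j)) -> p = p'.
Proof.
case: p p' => [w f] [w' f'] /= h.
have e : w = w' by apply: funext => j; case: (w j) (w' j) => [] [].
subst w'; congr (Etmor _); exact: functional_extensionality_dep h.
Qed.

Definition pt (V : etsch k) (j : pts V) : etmor (Spec (fld j)) V :=
  @Etmor k (Spec (fld j)) V (fun=> j) (fun=> id_ahom (fld j)).

Definition pt_covering (V : etsch k) : covering V :=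
  @Covering k V (pts V) (fun j => Spec (fld j)) (@pt V)
    (fun j => ex_intro _ j (ex_intro _ tt erefl)).

Lemma ahom_compf1 (K L : fieldExtType k) (s : 'AHom(K, L)) :
  comp_ahom s (id_ahom K) = s.
Proof. by apply/val_inj; exact: comp_lfun1r. Qed.

Lemma ahom_comp1f (K L : fieldExtType k) (s : 'AHom(K, L)) :
  comp_ahom (id_ahom L) s = s.
Proof. by apply/val_inj; exact: comp_lfun1l. Qed.

Lemma ahom_compA (K L M N : fieldExtType k) (s : 'AHom(K, L)) (t : 'AHom(L, M))
    (u : 'AHom(M, N)) : comp_ahom u (comp_ahom t s) = comp_ahom (comp_ahom u t) s.
Proof. by apply/val_inj; exact: comp_lfunA. Qed.

Lemma ahom_eq (K L : fieldExtType k) (s t : 'AHom(K, L)) : s =1 t -> s = t.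
Proof. by move=> h; apply/val_inj/lfunP. Qed.

Lemma ahom_compE (K L M : fieldExtType k) (s : 'AHom(K, L)) (t : 'AHom(L, M)) x :
  comp_ahom t s x = t (s x).
Proof. by rewrite /= lfunE. Qed.

Lemma ahom_inj (K L : fieldExtType k) (s : 'AHom(K, L)) : injective s.
Proof. exact: fmorph_inj. Qed.

Lemma etcompA (T W V U : etsch k) (f : etmor V U) (g : etmor W V)
    (l : etmor T W) : etcomp f (etcomp g l) = etcomp (etcomp f g) l.
Proof.
rewrite /etcomp /=; congr (Etmor _); apply: functional_extensionality_dep => i.
by rewrite -ahom_compA.
Qed.

Lemma Spec_map_comp (K L M : fieldExtType k) (s : 'AHom(K, L)) (t : 'AHom(L, M)) :
  Spec_map (comp_ahom t s) = etcomp (Spec_map s) (Spec_map t).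
Proof. by []. Qed.

Lemma Spec_map_onfld (K L : fieldExtType k) (f : etmor (Spec L) (Spec K)) :
  f = Spec_map (onfld f tt : 'AHom(K, L)).
Proof. by apply: etmor_Spec_ext => -[]. Qed.

Definition spec_hom (K L : fieldExtType k) (f : etmor (Spec L) (Spec K)) :
  'AHom(K, L) := onfld f tt.

Lemma Spec_map_inj (K L : fieldExtType k) : injective (@Spec_map k K L).
Proof. by move=> a b /(congr1 (@spec_hom K L)). Qed.

Lemma pt_factor (M : fieldExtType k) (V : etsch k) (x : etmor (Spec M) V) :
  x = etcomp (pt (onpts x tt)) (Spec_map (onfld x tt : 'AHom(_, M))).
Proof.
case: x => w f; have e : w = fun=> w tt by apply: funext => -[].
rewrite /etcomp /=; move: f; rewrite e => f /=; congr (Etmor _).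
by apply: functional_extensionality_dep => -[]; rewrite ahom_compf1.
Qed.

End EtaleMaps.

Section Pullback.
Variables (k : finFieldType) (A : linpfun k).

Lemma hom_empty (V : etsch k) (X Y : A V) (f g : hom X Y) :
  (pts V -> False) -> f = g.
Proof.
move=> V0; rewrite -[f]scale1r -[g]scale1r.
have -> : (1 : Osch V) = 0 by apply: functional_extensionality_dep => j; case: (V0 j).
by rewrite !scale0r.
Qed.

Lemma resm0 (V U : etsch k) (f : etmor V U) (X Y : A U) :
  resm f (0 : hom X Y) = 0.
Proof. by apply: (addrI (resm f 0)); rewrite -resmD !addr0. Qed.

Lemma resm_sum (V U : etsch k) (f : etmor V U) (X Y : A U) I (r : seq I)
    (P : pred I) (u : I -> hom X Y) :
  resm f (\sum_(i <- r | P i) u i) = \sum_(i <- r | P i) resm f (u i).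
Proof.
elim/big_rec2: _ => [|i y1 y2 _ <-]; first exact: resm0.
exact: resmD.
Qed.

Lemma resm_iso (V U : etsch k) (f : etmor V U) (X Y : A U) (u : hom X Y) :
  is_iso u -> is_iso (resm f u).
Proof. by move=> [v a b]; exists (resm f v); rewrite -resmM ?a ?b resm1. Qed.

Lemma res_isomorphic (V U : etsch k) (f : etmor V U) (X Y : A U) :
  isomorphic X Y -> isomorphic (res f X) (res f Y).
Proof. by move=> [u /(resm_iso f)]; exists (resm f u). Qed.

(** Restriction along [x] of a morphism between two pullbacks [p^*D -> p'^*D'],
   read through the canonical isomorphisms as a morphism
   [(p x)^*D -> (p' x)^*D']. *)
Definition pull (W V U U' : etsch k) (p : etmor V U) (p' : etmor V U')
    (x : etmor W V) (px : etmor W U) (px' : etmor W U')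
    (e : px = etcomp p x) (e' : px' = etcomp p' x) (D : A U) (D' : A U')
    (f : hom (res p D) (res p' D')) : hom (res px D) (res px' D') :=
  resC e' D' \c resm x f \c inv (resC_iso e D).

Section PullTheory.
Variables (W V U U' : etsch k) (p : etmor V U) (p' : etmor V U').
Variables (x : etmor W V) (px : etmor W U) (px' : etmor W U').
Variables (e : px = etcomp p x) (e' : px' = etcomp p' x).
Variables (D : A U) (D' : A U').

Lemma pullE (f : hom (res p D) (res p' D')) :
  pull e e' f \c resC e D = resC e' D' \c resm x f.
Proof. by rewrite /pull invKr. Qed.

Lemma pull_unique (f : hom (res p D) (res p' D')) w :
  w \c resC e D = resC e' D' \c resm x f -> w = pull e e' f.
Proof. by rewrite -pullE; apply/iso_epi/resC_iso. Qed.

Lemma pull_inj (f g : hom (res p D) (res p' D')) :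
  pull e e' f = pull e e' g -> resm x f = resm x g.
Proof.
move=> h; apply: (iso_mono (resC_iso e' D')).
by rewrite -!pullE h.
Qed.

Lemma pullD (f g : hom (res p D) (res p' D')) :
  pull e e' (f + g) = pull e e' f + pull e e' g.
Proof. by rewrite /pull resmD cmpDr cmpDl. Qed.

Lemma pullZ a (f : hom (res p D) (res p' D')) :
  pull e e' (a *: f) = Opull x a *: pull e e' f.
Proof. by rewrite /pull resmZ cmpZr cmpZl. Qed.

End PullTheory.

Lemma pullM (W V U : etsch k) (U' U'' : etsch k) (p : etmor V U) (p' : etmor V U')
    (p'' : etmor V U'') (x : etmor W V) px px' px''
    (e : px = etcomp p x) (e' : px' = etcomp p' x) (e'' : px'' = etcomp p'' x)
    (D : A U) (D' : A U') (D'' : A U'')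
    (g : hom (res p' D') (res p'' D'')) (f : hom (res p D) (res p' D')) :
  pull e e'' (g \c f) = pull e' e'' g \c pull e e' f.
Proof.
symmetry; apply: pull_unique.
by rewrite -cmpA pullE cmpA pullE resmM cmpA.
Qed.

Lemma pull1 (W V U : etsch k) (p : etmor V U) (x : etmor W V) px
    (e : px = etcomp p x) (D : A U) :
  pull e e (idm (res p D)) = idm (res px D).
Proof. by symmetry; apply: pull_unique; rewrite resm1 cmpf1 cmp1f. Qed.

Lemma pull_res (W V U : etsch k) (p : etmor V U) (x : etmor W V) px
    (e : px = etcomp p x) (D D' : A U) (f : hom D D') :
  pull e e (resm p f) = resm px f.
Proof. by symmetry; apply: pull_unique; exact: resC_nat. Qed.

Lemma pull_id (V U U' : etsch k) (p : etmor V U) (p' : etmor V U')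
    (x : etmor V V) (ex : x = etid V) (e : p = etcomp p x) (e' : p' = etcomp p' x)
    (D : A U) (D' : A U') (f : hom (res p D) (res p' D')) :
  pull e e' f = f.
Proof. by symmetry; apply: pull_unique; rewrite !(resCI ex) resI_nat. Qed.

Lemma pull_pull (T W V U U' : etsch k) (p : etmor V U) (p' : etmor V U')
    (x : etmor W V) px px' (e : px = etcomp p x) (e' : px' = etcomp p' x)
    (y : etmor T W) xy (exy : xy = etcomp x y) pxy pxy'
    (e1 : pxy = etcomp px y) (e1' : pxy' = etcomp px' y)
    (e2 : pxy = etcomp p xy) (e2' : pxy' = etcomp p' xy)
    (D : A U) (D' : A U') (f : hom (res p D) (res p' D')) :
  pull e1 e1' (pull e e' f) = pull e2 e2' f.
Proof.
apply: pull_unique; apply: (iso_epi (resC_iso exy _)).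
rewrite -[in RHS]cmpA resC_nat cmpA -(resCA e' exy e1' e2').
rewrite -cmpA -(resCA e exy e1 e2) cmpA pullE -!cmpA; congr (_ \c _).
by rewrite -!resmM pullE.
Qed.

End Pullback.

Section Points.
Variables (k : finFieldType) (A : linpfun k) (A_stack : is_stack A).

(** The members of [pt_covering V] have empty overlaps off the diagonal, so
   any family of morphisms over the points of [V] is compatible. *)
Lemma pts_compatible (V : etsch k) (X Y : A V)
    (u : forall j : pts V, hom (res (pt j) X) (res (pt j) Y)) :
  @compatible k A V (pt_covering V) X Y u.
Proof.
move=> a b W p p' h e e' /=.
case: (pselect (inhabited (pts W))) => [[w0]|W0]; last first.
  have hW (Z Z' : A W) (f g : hom Z Z') : f = g.
    by apply: hom_empty => j; exact: W0.
  by exists 0; split; exact: hW.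
have eab : a = b.
  by move: e'; rewrite e => /(congr1 (fun f => onpts f w0)).
subst b.
have epp : p = p'.
  apply: etmor_Spec_ext => j.
  have hE : etcomp (pt a) p = etcomp (pt a) p' by rewrite -e -e'.
  pose G (f : etmor W V) : 'AHom(fld a, fld j) :=
    match pselect (onpts f j = a) with
    | left E => eq_rect _ (fun b => 'AHom(fld b, fld j)) (onfld f j) _ E
    | right _ => onfld p j
    end.
  have GE (q : etmor W (Spec (fld a))) : G (etcomp (pt a) q) = onfld q j.
    rewrite /G; case: pselect => //= E.
    by rewrite (Prop_irrelevance E erefl) /= ahom_compf1.
  by rewrite -GE hE GE.
subst p'; rewrite (Prop_irrelevance e' e).
by exists (pull e e (u a)); split; rewrite pullE.
Qed.

Lemma pts_glue (V : etsch k) (X Y : A V)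
    (u : forall j : pts V, hom (res (pt j) X) (res (pt j) Y)) :
  exists v : hom X Y, forall j, resm (pt j) v = u j.
Proof.
have [/(_ X Y u (@pts_compatible V X Y u)) [v [hv _]] _] :=
  A_stack (pt_covering V).
by exists v.
Qed.

Lemma pts_faithful (V : etsch k) (X Y : A V) (v v' : hom X Y) :
  (forall j, resm (pt j) v = resm (pt j) v') -> v = v'.
Proof.
move=> h; pose u (j : pts V) := resm (pt j) v.
have [/(_ X Y u (@pts_compatible V X Y u)) [w [_ hw]] _] :=
  A_stack (pt_covering V).
by rewrite -(hw v (fun=> erefl)); apply: hw => j; rewrite /u h.
Qed.

End Points.

Section GaloisDescent.
Variables (k : finFieldType) (A : linpfun k) (A_stack : is_stack A).
Variables (K L : fieldExtType k) (s : 'AHom(K, L)).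
Variables (m : nat) (g : 'I_m -> 'AHom(L, L)).
Hypothesis g_fix : forall i, comp_ahom (g i) s = s.
Hypothesis g_torsor : forall (M : fieldExtType k) (p p' : 'AHom(L, M)),
  comp_ahom p s = comp_ahom p' s -> exists i, p' = comp_ahom p (g i).
Hypothesis g_inj : injective g.

Let S : etmor (Spec L) (Spec K) := Spec_map s.
Let G i : etmor (Spec L) (Spec L) := Spec_map (g i).

Definition ext_covering : covering (Spec K) :=
  @Covering k (Spec K) unit (fun=> Spec L) (fun=> S)
    (fun i => match i with tt => ex_intro _ tt (ex_intro _ tt erefl) end).

Lemma S_G i : S = etcomp S (G i).
Proof. by rewrite /S /G -Spec_map_comp g_fix. Qed.

Lemma G_torsor (M : fieldExtType k) (p p' : etmor (Spec M) (Spec L)) :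
  etcomp S p = etcomp S p' -> exists i, p' = etcomp (G i) p.
Proof.
rewrite (Spec_map_onfld p) (Spec_map_onfld p').
move: (onfld p tt) (onfld p' tt) => /= {}p {}p' e.
have /g_torsor[i ->] : comp_ahom p s = comp_ahom p' s.
  by apply: Spec_map_inj; exact: e.
by exists i.
Qed.

Lemma G_cancel (M : fieldExtType k) (p : etmor (Spec M) (Spec L)) i i' :
  etcomp (G i) p = etcomp (G i') p -> i = i'.
Proof.
rewrite (Spec_map_onfld p); move: (onfld p tt) => /= {}p e.
have e' : comp_ahom p (g i) = comp_ahom p (g i').
  by apply: Spec_map_inj; exact: e.
apply: g_inj; apply: ahom_eq => x; apply: (@ahom_inj _ _ _ p).
by rewrite -!ahom_compE e'.
Qed.

Lemma Spec_cancel (M N : fieldExtType k) (a b : etmor (Spec M) (Spec L))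
    (y : etmor (Spec N) (Spec M)) : etcomp a y = etcomp b y -> a = b.
Proof.
rewrite (Spec_map_onfld a) (Spec_map_onfld b) (Spec_map_onfld y).
move: (onfld a tt) (onfld b tt) (onfld y tt) => /= {}a {}b {}y e.
have e' : comp_ahom y a = comp_ahom y b.
  by apply: Spec_map_inj; exact: e.
congr Spec_map; apply: ahom_eq => x; apply: (@ahom_inj _ _ _ y).
by rewrite -!ahom_compE e'.
Qed.

(** The action of the [i]-th automorphism on morphisms between objects that
   come from [K]. *)
Definition gact i (X Y : A (Spec K)) (u : hom (res S X) (res S Y)) :
  hom (res S X) (res S Y) := pull (S_G i) (S_G i) u.

(** Two points of [Spec L] over the same point of [Spec K] differ by one of
   the [g i], so an invariant morphism has the same pullback along both. *)
Lemma invariant_descends (X Y : A (Spec K)) (u : hom (res S X) (res S Y)) :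
  (forall i, gact i u = u) -> exists! v : hom X Y, resm S v = u.
Proof.
move=> hu.
have [/(_ X Y (fun=> u)) hglue _] := A_stack ext_covering.
have [|v [hv hv']] := hglue.
  move=> [] [] V p p' h e e' /=; exists (pull e e u); split; first exact: pullE.
  suff -> : pull e e u = pull e' e' u by exact: pullE.
  apply: (pts_faithful A_stack) => j; set M := fld j.
  pose px := etcomp p (pt j); pose px' := etcomp p' (pt j).
  pose hx := etcomp h (pt j).
  have E : hx = etcomp S px by rewrite /hx e etcompA.
  have E' : hx = etcomp S px' by rewrite /hx e' etcompA.
  apply: (@pull_inj _ _ _ _ _ _ _ _ (pt j) hx hx erefl erefl).
  rewrite (pull_pull e e (erefl px) _ _ E E) (pull_pull e' e' (erefl px') _ _ E' E').
  have [i hi] : exists i, px' = etcomp (G i) px by apply: G_torsor; rewrite -E -E'.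
  by rewrite -{1}(hu i) (pull_pull (S_G i) (S_G i) hi E E E' E').
exists v; split; first exact: (hv tt).
by move=> w hw; apply: hv' => -[].
Qed.

Lemma resm_inj (X Y : A (Spec K)) (v w : hom X Y) : resm S v = resm S w -> v = w.
Proof.
have gr (f : hom X Y) i : gact i (resm S f) = resm S f by rewrite /gact pull_res.
have [f [_ hf]] := invariant_descends (gr w).
by move=> e; rewrite -(hf v e) -(hf w).
Qed.

Section Direct.
Variables (Y D : A (Spec L)).
Variables (pr : forall i, hom D (res (G i) Y)) (inj : forall i, hom (res (G i) Y) D).
Hypothesis pr_inj : forall i, pr i \c inj i = idm _.
Hypothesis pr_inj0 : forall i j, i != j -> pr i \c inj j = 0.
Hypothesis sum_inj : \sum_i inj i \c pr i = idm D.

Let Q (M : fieldExtType k) (px t : etmor (Spec M) (Spec L)) i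
    (c : t = etcomp (G i) px) : hom (res px D) (res t Y) :=
  resC c Y \c resm px (pr i).
Let J (M : fieldExtType k) (px t : etmor (Spec M) (Spec L)) i
    (c : t = etcomp (G i) px) : hom (res t Y) (res px D) :=
  resm px (inj i) \c inv (resC_iso c Y).

Let QJ M px t i c : @Q M px t i c \c J c = idm _.
Proof.
by rewrite /Q /J cmpA -(cmpA (resC c Y)) -resmM pr_inj resm1 cmpf1 Kinv.
Qed.

Let QJ0 M px t t' i i' c c' : i != i' -> @Q M px t i c \c @J M px t' i' c' = 0.
Proof.
move=> h; rewrite /Q /J cmpA -(cmpA (resC c Y)) -resmM pr_inj0 //.
by rewrite resm0 cmpf0 cmp0f.
Qed.

Let JQ M px t i c : @J M px t i c \c Q c = resm px (inj i \c pr i).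
Proof.
by rewrite /Q /J cmpA -(cmpA (resm px (inj i))) invK cmpf1 resmM.
Qed.

(** [canon a b t]: [t] is the comparison of the pullbacks of [D] along two
   points [a], [b] of [Spec L] over the same point of [Spec K]; both are the
   direct sum of the pullbacks of [Y] along all points over that point. *)
Let canon (M : fieldExtType k) (a b : etmor (Spec M) (Spec L))
    (t : hom (res a D) (res b D)) :=
  forall x i i' (c : x = etcomp (G i) a) (c' : x = etcomp (G i') b),
    Q c' \c t = Q c.

Let S_etcomp M (a : etmor (Spec M) (Spec L)) i : etcomp S (etcomp (G i) a) = etcomp S a.
Proof. by rewrite etcompA -S_G. Qed.

Let canon_index M (a b : etmor (Spec M) (Spec L)) (e : etcomp S a = etcomp S b) i :
  exists i', etcomp (G i) a = etcomp (G i') b.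
Proof. by apply: G_torsor; rewrite S_etcomp -e. Qed.

Let canon_ex M (a b : etmor (Spec M) (Spec L)) :
  etcomp S a = etcomp S b -> exists t, canon (a := a) (b := b) t.
Proof.
move=> e; have [f hf] := choice (canon_index e).
exists (\sum_i J (hf i) \c Q (erefl (etcomp (G i) a))) => x i i' c c'.
rewrite cmp_sumr (bigD1 i) //= big1 ?addr0; last first.
  move=> l li; rewrite cmpA QJ0 ?cmp0f //; apply: contraNneq li => i'E.
  by apply/eqP/(@G_cancel M a); rewrite hf -i'E -c' c.
subst x; have i'E : i' = f i by apply: (@G_cancel M b); rewrite -c' hf.
subst i'; rewrite (Prop_irrelevance c' (hf i)).
by rewrite cmpA QJ cmp1f.
Qed.

Let canon_unique M (a b : etmor (Spec M) (Spec L)) t t' :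
  etcomp S a = etcomp S b ->
  canon (a := a) (b := b) t -> canon (a := a) (b := b) t' -> t = t'.
Proof.
move=> e ht ht'; rewrite -(cmp1f t) -(cmp1f t') -(resm1 b) -sum_inj resm_sum.
rewrite !cmp_suml; apply: eq_bigr => i _.
have [i' hi] := canon_index (esym e) i.
have E (u : hom (res a D) (res b D)) :
    resm b (inj i \c pr i) \c u = J (erefl (etcomp (G i) b)) \c (Q (erefl _) \c u).
  by rewrite cmpA JQ.
by rewrite !E (ht _ _ _ hi erefl) (ht' _ _ _ hi erefl).
Qed.

Let canon1 M (a : etmor (Spec M) (Spec L)) : canon (idm (res a D)).
Proof.
move=> x i i' c c'; have e : i = i' by apply: (@G_cancel M a); rewrite -c.
by subst i'; rewrite cmpf1 (Prop_irrelevance c c').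
Qed.

Let canonM M (a b c : etmor (Spec M) (Spec L)) t t' : etcomp S a = etcomp S b ->
  canon (a := a) (b := b) t -> canon (a := b) (b := c) t' -> canon (t' \c t).
Proof.
move=> e ht ht' x i i'' ca cc; have [i' hi] := canon_index e i.
have cb : x = etcomp (G i') b by rewrite ca.
by rewrite cmpA (ht' _ _ _ cb) (ht _ _ _ ca).
Qed.

Let Q_pull (M N : fieldExtType k) (y : etmor (Spec N) (Spec M))
    (a t : etmor (Spec M) (Spec L)) ay ty i (c : t = etcomp (G i) a)
    (ey : ay = etcomp a y) (ety : ty = etcomp t y) (c' : ty = etcomp (G i) ay) :
  Q c' \c resC ey D = resC ety Y \c resm y (Q c).
Proof.
rewrite /Q resmM cmpA (resCA c ey ety c') -!cmpA; congr (_ \c _).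
exact: resC_nat.
Qed.

Let canon_pull (M N : fieldExtType k) (y : etmor (Spec N) (Spec M))
    (a b : etmor (Spec M) (Spec L)) ay by_ (ea : ay = etcomp a y) (eb : by_ = etcomp b y) t :
  canon (a := a) (b := b) t -> canon (pull ea eb t).
Proof.
move=> ht x i i' c c'.
pose z := etcomp (G i) a.
have ez : x = etcomp z y by rewrite c ea etcompA.
have cb : z = etcomp (G i') b.
  by apply: (@Spec_cancel _ _ _ _ y); rewrite -ez c' eb etcompA.
apply: (iso_epi (resC_iso ea D)); rewrite -cmpA pullE cmpA.
rewrite (Q_pull cb eb ez) (Q_pull (erefl z) ea ez) -cmpA -resmM.
by rewrite (ht _ _ _ (erefl z)).
Qed.

(** Global version of [canon], over an arbitrary base. *)
Let gcanon (V : etsch k) (p p' : etmor V (Spec L)) (f : hom (res p D) (res p' D)) :=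
  forall (M : fieldExtType k) (x : etmor (Spec M) V) px px'
    (e : px = etcomp p x) (e' : px' = etcomp p' x), canon (pull e e' f).

Let gcanon_ex (V : etsch k) (p p' : etmor V (Spec L)) :
  etcomp S p = etcomp S p' -> exists f, gcanon (p := p) (p' := p') f.
Proof.
move=> e.
have ej j : etcomp S (etcomp p (pt j)) = etcomp S (etcomp p' (pt j)).
  by rewrite !etcompA e.
have ex (j : pts V) : exists u : hom (res (pt j) (res p D)) (res (pt j) (res p' D)),
    canon (resC (erefl (etcomp p' (pt j))) D \c u \c inv (resC_iso (erefl (etcomp p (pt j))) D)).
  have [t ht] := canon_ex (ej j).
  exists (inv (resC_iso (erefl (etcomp p' (pt j))) D) \c t \c resC (erefl (etcomp p (pt j))) D).
  by rewrite !cmpA Kinv cmp1f Kinvr.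
pose u j := sval (cid (ex j)).
have [f hf] := pts_glue A_stack u.
exists f => M x px px' ex1 ex1'.
pose j := onpts x tt; pose y : etmor (Spec M) (Spec (fld j)) := Spec_map (onfld x tt : 'AHom(_, M)).
have exy : x = etcomp (pt j) y := pt_factor x.
have e1 : px = etcomp (etcomp p (pt j)) y by rewrite ex1 exy etcompA.
have e1' : px' = etcomp (etcomp p' (pt j)) y by rewrite ex1' exy etcompA.
rewrite -(pull_pull (erefl (etcomp p (pt j))) (erefl (etcomp p' (pt j))) exy e1 e1' ex1 ex1').
apply: canon_pull; rewrite /pull hf; exact: (svalP (cid (ex j))).
Qed.

Let gcanon_unique (V : etsch k) (p p' : etmor V (Spec L)) f f' :
  etcomp S p = etcomp S p' ->
  gcanon (p := p) (p' := p') f -> gcanon (p := p) (p' := p') f' -> f = f'.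
Proof.
move=> e hf hf'; apply: (pts_faithful A_stack) => j.
apply: (@pull_inj _ _ _ _ _ _ _ _ (pt j) _ _ erefl erefl).
apply: canon_unique; [by rewrite !etcompA e|exact: hf|exact: hf'].
Qed.

Let gcanon1 (V : etsch k) (p : etmor V (Spec L)) : gcanon (idm (res p D)).
Proof.
move=> M x px px' e e'; have E : px = px' by rewrite e.
move: e'; rewrite -E => e'; rewrite (Prop_irrelevance e' e) pull1; exact: canon1.
Qed.

Let gcanonM (V : etsch k) (a b c : etmor V (Spec L)) f f' : etcomp S a = etcomp S b ->
  gcanon (p := a) (p' := b) f -> gcanon (p := b) (p' := c) f' -> gcanon (f' \c f).
Proof.
move=> e hf hf' M x px px'' ea ec.
rewrite (pullM ea (erefl (etcomp b x)) ec); apply: canonM; [|exact: hf|exact: hf'].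
by rewrite ea !etcompA e.
Qed.

Let gcanon_pull (V W : etsch k) (a b : etmor V (Spec L)) (y : etmor W V) ay by_
    (ea : ay = etcomp a y) (eb : by_ = etcomp b y) f :
  gcanon (p := a) (p' := b) f -> gcanon (pull ea eb f).
Proof.
move=> hf M x px px' e e'.
have e1 : px = etcomp a (etcomp y x) by rewrite e ea etcompA.
have e1' : px' = etcomp b (etcomp y x) by rewrite e' eb etcompA.
by rewrite (pull_pull ea eb (erefl (etcomp y x)) e e' e1 e1'); exact: hf.
Qed.

(** The object [D] is the sum of the conjugates of [Y]; the comparisons [gcanon]
   of its pullbacks are unique, so they satisfy the cocycle condition. *)
Lemma direct_image_descends : exists X : A (Spec K), isomorphic (res S X) D.
Proof.
pose phi (V : etsch k) (p p' : etmor V (Spec L)) (e : etcomp S p = etcomp S p') :=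
  sval (cid (gcanon_ex e)).
have phiP V p p' e : gcanon (@phi V p p' e) := svalP (cid (gcanon_ex e)).
have Dat : exists Da : descent_datum A ext_covering, dobj Da tt = D.
  unshelve eexists (@DescentDatum k A (Spec K) ext_covering (fun=> D)
    (fun _ _ V p p' e => @phi V p p' e) _ _ _) => //.
  - move=> [] [] V p p' e; exists (phi V p' p (esym e)).
      apply: (@gcanon_unique V p p _ _ erefl); last exact: gcanon1.
      exact: (gcanonM e).
    apply: (@gcanon_unique V p' p' _ _ erefl); last exact: gcanon1.
    exact: (gcanonM (esym e)).
  - move=> [] [] W V h p p' e ph ph' eph eph' eg; have -> : phi W ph ph' eg = pull eph eph' (phi V p p' e).
      by apply: (gcanon_unique eg); [exact: phiP|exact: gcanon_pull].
    exact: pullE.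
  - move=> [] [] [] V p p' p'' e e' e''; apply: (gcanon_unique e''); last exact: phiP.
    exact: (gcanonM e).
have [Da hDa] := Dat.
have [_ /(_ Da)[X [psi [hpsi _]]]] := A_stack ext_covering.
exists X; have := hpsi tt; move: (psi tt); rewrite /= hDa => f hf.
by exists f.
Qed.

End Direct.
End GaloisDescent.

(** * Finite local rings *)

Definition nilp (E : pzRingType) (x : E) := exists n, x ^+ n = 0.

Definition two_sided_unit (E : pzRingType) (x : E) := exists y, y * x = 1 /\ x * y = 1.

Section NilFacts.
Variable E : pzRingType.
Implicit Types x y : E.

Lemma nilp_opp x : nilp x -> nilp (- x).
Proof. by move=> [n h]; exists n; rewrite exprNn h mulr0. Qed.

Lemma unit_1sub_nilp x : nilp x -> two_sided_unit (1 - x).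
Proof.
move=> [n h]; exists (\sum_(i < n) x ^+ i).
have e : (1 - x) * (\sum_(i < n) x ^+ i) = 1.
  by rewrite -[1 - x]opprB mulNr -subrX1 h sub0r opprK.
split=> //; rewrite -[RHS]e mulr_suml mulr_sumr; apply: eq_bigr => i _.
by rewrite mulrBr mulrBl mulr1 mul1r -exprS -exprSr.
Qed.

Lemma left_inverse_exp (z x : E) n : z * x = 1 -> z ^+ n * x ^+ n = 1.
Proof.
move=> h; elim: n => [|n IH]; first by rewrite mulr1.
by rewrite exprSr exprS -mulrA (mulrA z) h mul1r.
Qed.

Lemma right_nilp_commute x y : nilp (x * y) -> nilp (y * x).
Proof.
move=> [n h]; exists n.+1.
have e m : (y * x) ^+ m.+1 = y * (x * y) ^+ m * x.
  elim: m => [|m IH]; first by rewrite mulr1.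
  by rewrite exprS IH exprS !mulrA.
by rewrite e h mulr0 mul0r.
Qed.

(** The powers of [x] are eventually periodic; the exponent is taken in the
   periodic range and divisible by the period. *)
Lemma finite_idempotent_power x : finite_set [set: E] ->
  exists2 n, (0 < n)%N & x ^+ n * x ^+ n = x ^+ n.
Proof.
move=> /finite_seqP[s hs].
have ms y : y \in s by have : [set: E] y by []; rewrite hs.
have [i [j [ij e]]] : exists i j, (i < j)%N /\ x ^+ i = x ^+ j.
  pose f (i : 'I_(size s).+1) := x ^+ i.
  have : ~~ injectiveb f.
    apply/negP => /injectiveP/(map_inj_uniq) hf.
    have := uniq_leq_size (s1 := map f (enum 'I_(size s).+1)) (s2 := s).
    by rewrite hf enum_uniq size_map size_enum_ord => /(_ isT (fun y _ => ms y)); rewrite ltnn.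
  move=> /injectivePn[i [j nij e]].
  case: (ltngtP i j) => [lt|gt|/val_inj/eqP]; last by rewrite (negbTE nij).
    by exists i, j.
  by exists j, i.
pose d := (j - i)%N; have d0 : (0 < d)%N by rewrite subn_gt0.
have per a b : (i <= a)%N -> x ^+ (a + d * b) = x ^+ a.
  move=> ia; elim: b => [|b IH]; first by rewrite muln0 addn0.
  rewrite mulnS [(d + _)%N]addnC addnA exprD IH -exprD.
  by rewrite -(subnK ia) -addnA (subnKC (ltnW ij)) !exprD e.
exists (d * i.+1)%N; first by rewrite muln_gt0 d0.
by rewrite -exprD per // (leq_trans (leqnSn i)) // leq_pmull.
Qed.

(** The left ideals generated by the tails of a nonzero product of elements of
   [I] would strictly increase, which bounds its length. *)
Lemma nil_products (I : E -> Prop) : finite_set [set: E] ->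
  (forall x y, I y -> I (x * y)) -> (forall x, I x -> nilp x) ->
  exists N, forall f : nat -> E, (forall i, I (f i)) -> \prod_(i < N) f i = 0.
Proof.
move=> /finite_seqP[s hs] hI hnil.
have ms y : y \in s by have : [set: E] y by []; rewrite hs.
pose idl (x : E) := [seq y <- undup s | `[< exists z, y = z * x >]].
have idlP x y : (y \in idl x) = `[< exists z, y = z * x >].
  by rewrite mem_filter mem_undup ms andbT.
have idl_uniq x : uniq (idl x) by rewrite filter_uniq ?undup_uniq.
exists (size (undup s)).+1 => f hf; apply/eqP/negPn/negP => hn.
have key n : forall (f : nat -> E), (forall i, I (f i)) -> forall x,
    \prod_(i < n) f i * x != 0 ->
    (size (idl (\prod_(i < n) f i * x)%R) + n <= size (idl x))%N.
  elim: n => [|n IH] {hf hn} h hh x; first by rewrite big_ord0 mul1r addn0.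
  rewrite big_ord_recr /= -mulrA => hn; rewrite addnS.
  apply: (@leq_ltn_trans (size (idl (h n * x)))); first exact: IH.
  have hx0 : x != 0 by apply: contraNneq hn => ->; rewrite !mulr0.
  have sub : {subset idl (h n * x) <= idl x}.
    move=> y; rewrite !idlP => /asboolP[z ->]; apply/asboolP.
    by exists (z * h n); rewrite mulrA.
  rewrite ltn_neqAle uniq_leq_size // andbT; apply/eqP => es.
  have : x \in idl x by rewrite idlP; apply/asboolP; exists 1; rewrite mul1r.
  have [_ <-] := uniq_min_size (idl_uniq (h n * x)) sub (eq_leq (esym es)).
  rewrite idlP => /asboolP[z hz].
  have [p hp] := hnil _ (hI z _ (hh n)).
  have hxp r : x = (z * h n) ^+ r * x.
    elim: r => [|r IHr]; first by rewrite mul1r.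
    by rewrite exprSr -mulrA -(mulrA z) -hz -IHr.
  by move/eqP: hx0; apply; rewrite (hxp p) hp mul0r.
have := key (size (undup s)).+1 f hf 1; rewrite mulr1 => /(_ hn).
have : (size (idl (1 : E)%R) <= size (undup s))%N by rewrite size_filter count_size.
move=> h1 /leq_trans/(_ h1); rewrite addnS ltnNge leq_addl //.
Qed.

End NilFacts.

(** A root in [W] of the minimal polynomial of a generator of [D] embeds [D]. *)
Lemma finField_embedding (K D : finFieldType) (a : {rmorphism K -> D})
    (W : closedFieldType) (j : {rmorphism K -> W}) :
  exists (g : {rmorphism D -> W}) (e : nat),
  [/\ (0 < e)%N, #|D| = (#|K| ^ e)%N & forall b, g (a b) = j b].
Proof.
have [t ht] := finField_primitive D.
have evs x : exists P, x = (map_poly a P).[t].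
  case: (ht x) => [->|[i ->]]; first by exists 0; rewrite rmorph0 horner0.
  by exists 'X^i; rewrite map_polyXn hornerXn.
have D1 : (1 < #|D|)%N := finNzRing_gt1 D.
have [P [Pn Pt Pd]] : exists P : {poly K}, [/\ P != 0, (map_poly a P).[t] = 0 &
    forall Q, (map_poly a Q).[t] = 0 -> P %| Q].
  apply: (@poly_annihilator_min _ _ a t ('X^#|D| - 'X)).
    by rewrite -size_poly_eq0 size_polyDl size_polyXn // size_polyN size_polyX ltnS.
  by rewrite rmorphB [X in X - _]map_polyXn [X in _ - X]map_polyX !hornerE expf_card subrr.
have sP : (1 < size P)%N.
  rewrite ltnNge; apply/negP => /size1_polyC e; move: Pt Pn.
  by rewrite e map_polyC hornerC => /eqP; rewrite fmorph_eq0 polyC_eq0 => ->.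
have /closed_rootP[z hz] : size (map_poly j P) != 1%N.
  by rewrite size_map_poly neq_ltn sP orbT.
have [g hg] := field_hom_of_root evs Pd hz.
(* [D] has basis [1, t, ..., t^(deg P - 1)] over [K] *)
pose d := (size P).-1.
have cardD : #|D| = (#|K| ^ d)%N.
  pose f (v : 'rV[K]_d) : D := (map_poly a (rVpoly v)).[t].
  have finj : injective f.
    move=> v w /eqP; rewrite -subr_eq0 /f -hornerN -hornerD -rmorphN -rmorphD -linearB /=.
    move=> /eqP/Pd; move: (v - w) (subr_eq0 v w) => u uE Pu.
    have u0 : rVpoly u = 0.
      apply/eqP/negPn/negP => un; have := dvdp_leq un Pu.
      rewrite leqNgt => /negP[]; rewrite (leq_ltn_trans (size_poly _ _)) //.
      by rewrite /d prednK // (ltnW sP).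
    apply/eqP; rewrite -uE; apply/eqP/rowP => i.
    by rewrite -(coef_rVpoly_ord u i) u0 coef0 mxE.
  have fsurj u : exists v, f v = u.
    have [Q ->] := evs u; exists (poly_rV (Q %% P)).
    rewrite /f poly_rV_K; last by rewrite -ltnS /d prednK ?ltn_modp // (ltnW sP).
    rewrite [in RHS](divp_eq Q P) rmorphD rmorphM /= hornerD hornerM Pt.
    by rewrite mulr0 add0r.
  have [h hh] := choice fsurj.
  rewrite -(mul1n d) -card_mx; apply/eqP; rewrite eqn_leq (leq_card f finj).
  by rewrite (leq_card h (can_inj hh)).
exists g, d; split=> //.
by rewrite /d -ltnS prednK // (ltnW sP).
Qed.

Section Residue.
Variables (E : pzRingType) (E_fin : finite_set [set: E]).
Hypothesis E_nz : (1 : E) != 0.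
Hypothesis E_local : forall x : E, nilp x \/ two_sided_unit x.
Variables (K : finFieldType) (c : {rmorphism K -> E}).
Variables (W : closedFieldType) (j : {rmorphism K -> W}).

Lemma nilp_not_unit (x z : E) : nilp x -> z * x <> 1.
Proof.
move=> [n h] /(left_inverse_exp n); rewrite h mulr0 => /esym/eqP.
by rewrite (negbTE E_nz).
Qed.

Lemma nilp_mull (y x : E) : nilp x -> nilp (y * x).
Proof.
move=> hx; case: (E_local (y * x)) => // -[u []]; rewrite mulrA.
by move/(nilp_not_unit hx).
Qed.

Lemma nilp_mulr (x y : E) : nilp x -> nilp (x * y).
Proof. by move=> hx; apply: right_nilp_commute; exact: nilp_mull. Qed.

Lemma nilp_add (x y : E) : nilp x -> nilp y -> nilp (x + y).
Proof.
move=> hx hy; case: (E_local (x + y)) => // -[u [hu _]].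
have e : u * y = 1 - u * x by rewrite -hu mulrDr addrAC subrr add0r.
have [v [hv _]] := unit_1sub_nilp (nilp_mull u hx).
by case: (@nilp_not_unit y (v * u) hy); rewrite -mulrA e.
Qed.

Lemma character_of_residue_field (D : finFieldType) (p : {rmorphism E -> D}) :
  (forall u, exists x, u = p x) -> (forall x, p x = 0 <-> nilp x) ->
  exists (rho : E -> W) (e : nat),
  [/\ (0 < e)%N,
      [/\ {morph rho : x y / x + y}, {morph rho : x y / x * y}, rho 1 = 1 &
          forall a, rho (c a) = j a],
      forall x, rho x = 0 <-> nilp x &
      forall z, (exists x, rho x = z) <-> z ^+ (#|K| ^ e) = z].
Proof.
move=> psurj pnil; pose a : {rmorphism K -> D} := p \o c.
have [g [e [e0 cardD hg]]] := finField_embedding a j.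
exists (g \o p), e; split=> //.
- split=> [x y|x y||b].
  + by rewrite /= (rmorphD p) rmorphD.
  + by rewrite /= (rmorphM p) rmorphM.
  + by rewrite /= (rmorph1 p) rmorph1.
  + exact: hg b.
- move=> x; rewrite -pnil /=; split=> [/eqP|->]; last exact: rmorph0.
  by rewrite fmorph_eq0 => /eqP.
- move=> y; split=> [[x <-]|hy].
    by rewrite /= -rmorphXn -cardD expf_card.
  suff [u ->] : exists u : D, y = g u by have [x ->] := psurj u; exists x.
  by apply: finField_fixed_image; rewrite cardD.
Qed.

Let eqn (x y : E) := nilp (x - y).

Let rep (x : E) : E := xget 0 (eqn x).

Let repP x : eqn x (rep x).
Proof.
apply: (@xgetPex _ 0 (eqn x)); exists x.
by rewrite /eqn subrr; exists 1; rewrite expr1.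
Qed.

Let eqn_sym x y : eqn x y -> eqn y x.
Proof. by move=> /nilp_opp; rewrite opprB. Qed.

Let eqn_trans y x z : eqn x y -> eqn y z -> eqn x z.
Proof. by move=> h1 h2; rewrite /eqn -(subrKA y); exact: nilp_add. Qed.

Let rep_eq x y : eqn x y -> rep x = rep y.
Proof.
move=> h; have e : eqn x = eqn y.
  by apply/funext => z; apply/propext; split; apply: eqn_trans => //; exact: eqn_sym.
by rewrite /rep e.
Qed.

Let sE : seq E := sval (cid ((finite_seqP _).1 E_fin)).

Let sE_mem x : x \in sE.
Proof.
have h : [set: E] = [set` sE] := svalP (cid ((finite_seqP _).1 E_fin)).
by have : [set: E] x by []; rewrite h.
Qed.

Let sD : seq E := [seq rep x | x <- sE].

Let pi_subproof x : rep x \in sD.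
Proof. by apply/mapP; exists x. Qed.

(** The quotient by the nilpotent elements, carried by canonical representatives
   in order to be a finite type. *)
Definition residue : Type := seq_sub sD.
HB.instance Definition _ := Finite.on residue.

Let pi (x : E) : residue := SeqSub (pi_subproof x).
Let rp (u : residue) : E := val u.

Let pi_eq x y : eqn x y -> pi x = pi y.
Proof. by move=> h; apply/val_inj; exact: rep_eq. Qed.

Let pi_eqn x y : pi x = pi y -> eqn x y.
Proof.
move=> /(congr1 val) /= h; apply: (eqn_trans (repP x)); rewrite h.
exact/eqn_sym/repP.
Qed.

Let piK x : eqn x (rp (pi x)).
Proof. exact: repP. Qed.

Let rpK u : pi (rp u) = u.
Proof.
have e y : y \in sD -> rep y = y by move=> /mapP[x _ ->]; rewrite -(rep_eq (repP x)).
by apply/val_inj; exact: e (valP u).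
Qed.

Let add u v := pi (rp u + rp v).
Let opp u := pi (- rp u).
Let mul u v := pi (rp u * rp v).

Let addE x y : add (pi x) (pi y) = pi (x + y).
Proof.
apply/esym/pi_eq; rewrite /eqn opprD addrACA.
by apply: nilp_add; exact: piK.
Qed.

Let oppE x : opp (pi x) = pi (- x).
Proof.
by apply/esym/pi_eq; rewrite /eqn opprK addrC -opprB; apply/nilp_opp; exact: piK.
Qed.

Let mulE x y : mul (pi x) (pi y) = pi (x * y).
Proof.
apply/esym/pi_eq; rewrite /eqn -(subrKA (x * rp (pi y))) -mulrBr -mulrBl.
by apply: nilp_add; [apply: nilp_mull|apply: nilp_mulr]; exact: piK.
Qed.

Let addA : associative add.
Proof. by move=> u v w; rewrite -(rpK u) -(rpK v) -(rpK w) !addE addrA. Qed.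
Let addC : commutative add.
Proof. by move=> u v; rewrite -(rpK u) -(rpK v) !addE addrC. Qed.
Let add0 : left_id (pi 0) add.
Proof. by move=> u; rewrite -(rpK u) !addE add0r. Qed.
Let addN : left_inverse (pi 0) opp add.
Proof. by move=> u; rewrite -(rpK u) oppE !addE addNr. Qed.

HB.instance Definition _ := GRing.isZmodule.Build residue addA addC add0 addN.

Let mulA : associative mul.
Proof. by move=> u v w; rewrite -(rpK u) -(rpK v) -(rpK w) !mulE mulrA. Qed.
Let mul1 : left_id (pi 1) mul.
Proof. by move=> u; rewrite -(rpK u) !mulE mul1r. Qed.
Let mulr1' : right_id (pi 1) mul.
Proof. by move=> u; rewrite -(rpK u) !mulE mulr1. Qed.
Let mulDl : left_distributive mul add.
Proof. by move=> u v w; rewrite -(rpK u) -(rpK v) -(rpK w) (addE (rp u) (rp v)) !mulE addE mulrDl. Qed.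
Let mulDr : right_distributive mul add.
Proof. by move=> u v w; rewrite -(rpK u) -(rpK v) -(rpK w) (addE (rp v) (rp w)) !mulE addE mulrDr. Qed.
Let one_nz : pi 1 != 0.
Proof.
apply/eqP => /pi_eqn; rewrite /eqn subr0 => -[n].
by rewrite expr1n => /eqP; rewrite (negbTE E_nz).
Qed.

HB.instance Definition _ :=
  GRing.Zmodule_isNzRing.Build residue mulA mul1 mulr1' mulDl mulDr one_nz.

Let inv_ex (u : residue) : exists v, u != 0 -> v * u = 1 /\ u * v = 1.
Proof.
rewrite -(rpK u); case: (E_local (rp u)) => [h|[y [h1 h2]]].
  by exists 0 => /eqP; case; apply: pi_eq; rewrite /eqn subr0.
by exists (pi y) => _; split; [rewrite [LHS]mulE h1|rewrite [LHS]mulE h2].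
Qed.

Let vinv (u : residue) : residue := if u == 0 then 0 else sval (cid (inv_ex u)).
Let vinvP u : u != 0 -> vinv u * u = 1 /\ u * vinv u = 1.
Proof. by move=> h; rewrite /vinv ifN //; exact: (svalP (cid (inv_ex u))). Qed.

Let unitD : pred residue := fun u => u != 0.
Let mulVr : {in unitD, left_inverse 1 vinv *%R}.
Proof. by move=> u /vinvP[]. Qed.
Let mulrV : {in unitD, right_inverse 1 vinv *%R}.
Proof. by move=> u /vinvP[]. Qed.
Let unitP (u v : residue) : v * u = 1 /\ u * v = 1 -> unitD u.
Proof.
move=> [h _]; apply/eqP => u0; move: h; rewrite u0 mulr0 => /esym/eqP.
by rewrite oner_eq0.
Qed.
Let inv0 : {in [predC unitD], vinv =1 id}.
Proof. by move=> u; rewrite inE negbK => /eqP ->; rewrite /vinv ifT ?eqxx. Qed.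

HB.instance Definition _ :=
  GRing.NzRing_hasMulInverse.Build residue mulVr mulrV unitP inv0.

Let domR (u v : residue) : u * v = 0 -> (u == 0) || (v == 0).
Proof.
move=> h; case: eqVneq => //= un; have [e _] := vinvP un.
by rewrite -(mul1r v) -e -mulrA h mulr0.
Qed.

(** The residue ring is a finite division ring, hence a field by Wedderburn's
   theorem. *)
Lemma residue_character : exists (rho : E -> W) (e : nat),
  [/\ (0 < e)%N,
      [/\ {morph rho : x y / x + y}, {morph rho : x y / x * y}, rho 1 = 1 &
          forall a, rho (c a) = j a],
      forall x, rho x = 0 <-> nilp x &
      forall z, (exists x, rho x = z) <-> z ^+ (#|K| ^ e) = z].
Proof.
pose D : finFieldType := FinDomainFieldType domR.
pose pD (x : E) : D := pi x.
have pB : zmod_morphism pD by move=> x y; rewrite /pD -addE -oppE.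
have pM : monoid_morphism pD by split=> // x y; rewrite /pD -mulE.
pose pR := GRing.isZmodMorphism.Build _ _ pD pB.
pose pR' := GRing.isMonoidMorphism.Build _ _ pD pM.
apply: (@character_of_residue_field D (HB.pack_for {rmorphism E -> D} pD pR pR')).
  by move=> u; exists (rp u); exact: esym (rpK u).
move=> x; split=> [/pi_eqn|h]; first by rewrite /eqn subr0.
by apply: pi_eq; rewrite /eqn subr0.
Qed.

End Residue.

(** * Endomorphism rings and direct sums *)

Section FiniteChoiceType.
Variables (T : choiceType) (T_fin : finite_set [set: T]).

(** An alias of [T] from which the proof of finiteness can be inferred. *)
Definition finT of finite_set [set: T] : predArgType := T.

Let sT : seq T := undup (sval (cid ((finite_seqP _).1 T_fin))).

Let sT_mem x : x \in sT.
Proof.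
rewrite mem_undup; case: (cid _) => s /= h.
by have : [set: T] x by []; rewrite h.
Qed.

HB.instance Definition _ := Choice.copy (finT T_fin) T.

Let pickleT (x : finT T_fin) : nat := index (x : T) sT.
Let unpickleT (n : nat) : option (finT T_fin) := onth sT n.

Let pickleTK : pcancel pickleT unpickleT.
Proof.
move=> x; rewrite /pickleT /unpickleT onthE (nth_map (x : T)) ?index_mem //.
by rewrite nth_index.
Qed.

HB.instance Definition _ := isCountable.Build (finT T_fin) pickleTK.

Let enumT : Finite.axiom (sT : seq (finT T_fin)).
Proof.
move=> x; rewrite count_uniq_mem; last exact: undup_uniq.
by rewrite [_ \in _]sT_mem.
Qed.

HB.instance Definition _ := fintype.isFinite.Build (finT T_fin) enumT.

Lemma cardsetE (B : set T) : cardset B = #|[pred x : finT T_fin | `[<B x>]]|.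
Proof.
have Bfin : finite_set B by apply: sub_finite_set T_fin.
rewrite /cardset cardE; apply: perm_size; apply: uniq_perm.
- exact: fset_uniq.
- exact: (@enum_uniq (finT T_fin)).
move=> x; rewrite (mem_enum [pred x : finT T_fin | `[<B x>]]) inE.
by rewrite in_fset_set // inE.
Qed.

End FiniteChoiceType.
Arguments finT {T}.

Section EndRing.
Variables (R : comPzRingType) (C : lincat R) (X : C).

Definition endr : Type := hom X X.

HB.instance Definition _ := GRing.Lmodule.copy endr (hom X X).

Let mulA : associative (fun g f : endr => g \c f : endr).
Proof. by move=> h g f; rewrite cmpA. Qed.
Let mul1l : left_id (idm X : endr) (fun g f : endr => g \c f : endr).
Proof. by move=> f; exact: cmp1f. Qed.
Let mul1r' : right_id (idm X : endr) (fun g f : endr => g \c f : endr).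
Proof. by move=> f; exact: cmpf1. Qed.
Let mulDl : left_distributive (fun g f : endr => g \c f : endr) +%R.
Proof. by move=> g g' f; exact: cmpDl. Qed.
Let mulDr : right_distributive (fun g f : endr => g \c f : endr) +%R.
Proof. by move=> g f f'; exact: cmpDr. Qed.

HB.instance Definition _ :=
  GRing.Zmodule_isPzRing.Build endr mulA mul1l mul1r' mulDl mulDr.

Lemma endrM (g f : endr) : g * f = g \c f. Proof. by []. Qed.
Lemma endr1 : (1 : endr) = idm X. Proof. by []. Qed.

Lemma endr_unit_iso (f : endr) : two_sided_unit f <-> is_iso (f : hom X X).
Proof.
split=> [[g [h1 h2]]|[g h1 h2]]; first by exists g; rewrite -?endrM ?h1 ?h2.
by exists (g : endr); rewrite !endrM h1 h2.
Qed.

End EndRing.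

Record dsum (R : comPzRingType) (C : lincat R) (I : finType) (P : I -> C) (X : C) := Dsum {
  dinj : forall a, hom (P a) X;
  dprj : forall a, hom X (P a);
  dprj_inj : forall a, dprj a \c dinj a = idm (P a);
  dprj_inj0 : forall a b, a != b -> dprj a \c dinj b = 0;
  dsumE : \sum_a dinj a \c dprj a = idm X }.

Section DirectSums.
Variables (R : comPzRingType) (C : lincat R).
Implicit Types (I J : finType) (X Y : C).

Lemma dsum_reindex I J (h : I -> J) (Q : J -> C) X :
  bijective h -> dsum Q X -> dsum (Q \o h) X.
Proof.
move=> hb [i p e1 e0 es].
refine (@Dsum R C I (Q \o h) X (fun a => i (h a)) (fun a => p (h a)) _ _ _) => /=.
- by move=> a; exact: e1.
- by move=> a b ab; apply: e0; rewrite (inj_eq (bij_inj hb)).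
- by rewrite -es [RHS](reindex h) //; exact: onW_bij.
Qed.

Lemma dsum_iso I (P Q : I -> C) X Y :
  (forall a, isomorphic (P a) (Q a)) -> dsum P X -> dsum Q Y -> isomorphic X Y.
Proof.
move=> hPQ D D'.
have hu a : {u : hom (P a) (Q a) & {v : hom (Q a) (P a) | v \c u = idm _ & u \c v = idm _}}.
  have [u hu] := cid (hPQ a); exists u; exists (inv hu); [exact: invK|exact: Kinv].
pose u a := projT1 (hu a); pose v a := s2val (projT2 (hu a)).
have vu a : v a \c u a = idm _ := s2valP (projT2 (hu a)).
have uv a : u a \c v a = idm _ := s2valP' (projT2 (hu a)).
have key (I' : finType) (P' Q' : I' -> C) X' Y' (D1 : dsum P' X') (D2 : dsum Q' Y')
    (f : forall a, hom (P' a) (Q' a)) (g : forall a, hom (Q' a) (P' a)) :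
    (forall a, g a \c f a = idm _) ->
    (\sum_a dinj D1 a \c g a \c dprj D2 a) \c (\sum_a dinj D2 a \c f a \c dprj D1 a)
    = idm X'.
  move=> gf; rewrite cmp_suml -(dsumE D1); apply: eq_bigr => a _.
  rewrite cmp_sumr (bigD1 a) //= big1 ?addr0 => [|b ba].
    rewrite -!cmpA (cmpA (dprj D2 a)) dprj_inj cmp1f (cmpA (g a)) gf cmp1f //.
  have ab : a != b by rewrite eq_sym.
  by rewrite -!cmpA (cmpA (dprj D2 a)) dprj_inj0 // cmp0f !cmpf0.
exists (\sum_a dinj D' a \c u a \c dprj D a).
by exists (\sum_a dinj D a \c v a \c dprj D' a); exact: key.
Qed.

Lemma dsum_transport I (P : I -> C) X Y : isomorphic X Y -> dsum P X -> inhabited (dsum P Y).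
Proof.
move=> [f hf] [i p e1 e0 es]; constructor.
refine (@Dsum R C I P Y (fun a => f \c i a) (fun a => p a \c inv hf) _ _ _).
- by move=> a; rewrite cmpA invKr.
- by move=> a b ab; rewrite cmpA invKr e0.
- transitivity (f \c (\sum_a i a \c p a) \c inv hf); last by rewrite es cmpf1 Kinv.
  by rewrite cmp_sumr cmp_suml; apply: eq_bigr => a _; rewrite !cmpA.
Qed.

Definition sum_fun I J (P : I -> C) (Q : J -> C) (x : I + J) : C :=
  match x with inl a => P a | inr b => Q b end.

Lemma dsum_sum I J (P : I -> C) (Q : J -> C) X Y Z :
  dsum P X -> dsum Q Y -> is_sum X Y Z -> inhabited (dsum (sum_fun P Q) Z).
Proof.
move=> [i p e1 e0 es] [i' p' e1' e0' es'] [ix [iy [px [py [h1 h2 h3 h4 h5]]]]].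
constructor.
refine (@Dsum R C _ (sum_fun P Q) Z
  (fun x => match x with inl a => ix \c i a | inr b => iy \c i' b end)
  (fun x => match x with inl a => p a \c px | inr b => p' b \c py end) _ _ _).
- by case=> a; rewrite cmpA; [rewrite -(cmpA (p a)) h1|rewrite -(cmpA (p' a)) h2]; rewrite cmpf1 ?e1 ?e1'.
- case=> a [] b ab; rewrite cmpA.
  + by rewrite -(cmpA (p a)) h1 cmpf1 e0.
  + by rewrite -(cmpA (p a)) h3 cmpf0 cmp0f.
  + by rewrite -(cmpA (p' a)) h4 cmpf0 cmp0f.
  + by rewrite -(cmpA (p' a)) h2 cmpf1 e0'.
- rewrite big_sumType /= -h5; congr (_ + _).
    rewrite -[in RHS](cmp1f px) -es cmp_suml cmp_sumr; apply: eq_bigr => a _.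
    by rewrite !cmpA.
  rewrite -[in RHS](cmp1f py) -es' cmp_suml cmp_sumr; apply: eq_bigr => a _.
  by rewrite !cmpA.
Qed.

Lemma dsum_single X : dsum (fun _ : unit => X) X.
Proof.
refine (@Dsum R C unit (fun=> X) X (fun=> idm X) (fun=> idm X) _ _ _).
- by move=> a; rewrite cmp1f.
- by case=> -[].
- by rewrite (big_pred1 tt) ?cmp1f // => -[].
Qed.

Lemma dsum_zero X (P : void -> C) : is_zero X -> dsum P X.
Proof.
move=> X0; refine (@Dsum R C void P X (fun a => match a with end) (fun a => match a with end) _ _ _).
- by case.
- by case.
- by rewrite big_pred0 ?X0 // => -[].
Qed.

Lemma dsum_nonzero I (P : I -> C) X : dsum P X -> ~ is_zero X -> exists a : I, True.
Proof.
move=> D X0; case: (pickP (fun _ : I => true)) => [a _|h]; first by exists a.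
by case: X0; rewrite /is_zero -(dsumE D) big1 // => a; move: (h a).
Qed.

Definition additive_on_sums (V : zmodType) (c : C -> V) :=
  forall X Y Z, is_sum X Y Z -> c Z = c X + c Y.

Lemma additive_zero (V : zmodType) (c : C -> V) Z :
  additive_on_sums c -> is_zero Z -> c Z = 0.
Proof.
move=> hc Z0; have h : is_sum Z Z Z.
  by exists 0, 0, 0, 0; rewrite !cmp0f addr0 (Z0 : idm Z = 0).
by apply: (addrI (c Z)); rewrite -(hc _ _ _ h) addr0.
Qed.

Lemma additive_iso (V : zmodType) (c : C -> V) X Y :
  additive_cat C -> additive_on_sums c -> isomorphic X Y -> c X = c Y.
Proof.
move=> [[Z Z0] _] hc [f [g gf fg]]; have h : is_sum X Z Y.
  by exists f, 0, g, 0; rewrite !cmp0f !cmpf0 addr0 gf fg (Z0 : idm Z = 0).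
by rewrite (hc _ _ _ h) (additive_zero hc Z0) addr0.
Qed.

Lemma dsum_exists n (P : 'I_n -> C) : additive_cat C -> exists X,
  inhabited (dsum P X) /\ forall (V : zmodType) (c : C -> V), additive_on_sums c ->
  c X = \sum_a c (P a).
Proof.
move=> [[Z Z0] hsum]; elim: n P => [|n IH] P.
  exists Z; split; last by move=> V c hc; rewrite big_ord0 (additive_zero hc).
  constructor; pose h (a : 'I_0) : void := False_rect _ (notF (ltn_ord a)).
  have hb : bijective h.
    by exists (fun a : void => match a with end) => [a|[]]; case: (notF (ltn_ord a)).
  have := dsum_reindex hb (dsum_zero (fun a : void => match a return C with end) Z0).
  by congr dsum; apply/funext => a; case: (notF (ltn_ord a)).
have [X [[D] hX]] := IH (P \o lift ord0).
have [Y hY] := hsum (P ord0) X.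
have [D'] := dsum_sum (dsum_single (P ord0)) D hY.
exists Y; split; last first.
  by move=> V c hc; rewrite big_ord_recl (hc _ _ _ hY) (hX _ _ hc).
constructor.
pose h (a : 'I_n.+1) : unit + 'I_n := if unlift ord0 a is Some b then inr b else inl tt.
have hb : bijective h.
  exists (fun x => match x with inl _ => ord0 | inr b => lift ord0 b end).
    by move=> a; rewrite /h; case: unliftP => [b|] ->.
  by case=> [[]|b]; rewrite /h ?liftK ?unlift_none.
have := dsum_reindex hb D'; congr dsum; apply/funext => a.
by rewrite /h /=; case: unliftP => [b|] ->.
Qed.

Lemma dsum_exists_fin I (P : I -> C) : additive_cat C -> exists X,
  inhabited (dsum P X) /\ forall (V : zmodType) (c : C -> V), additive_on_sums c ->
  c X = \sum_a c (P a).
Proof.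
move=> hC; have [X [[D] hX]] := dsum_exists (fun a : 'I_#|I| => P (enum_val a)) hC.
have hb : bijective (@enum_rank I) := Bijective (@enum_rankK I) (@enum_valK I).
exists X; split; last first.
  move=> V c hc; rewrite (hX _ _ hc) (reindex enum_rank) /=; last exact: onW_bij.
  by apply: eq_bigr => a _; rewrite enum_rankK.
constructor; have := dsum_reindex hb D; congr dsum; apply/funext => a /=.
by rewrite enum_rankK.
Qed.

Lemma additive_dsum I (P : I -> C) X (V : zmodType) (c : C -> V) :
  additive_cat C -> additive_on_sums c -> dsum P X -> c X = \sum_a c (P a).
Proof.
move=> hC hc D; have [Y [[D'] hY]] := dsum_exists_fin P hC.
rewrite -(hY _ _ hc); apply: additive_iso => //.
by apply: dsum_iso D D' => a; exact: isomorphic_refl.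
Qed.

End DirectSums.

(** * Morphisms after extension of scalars *)

Section ScalarExtension.
Variables (k : finFieldType) (A : linpfun k) (A_stack : is_stack A).

(** The powers of the Frobenius automorphism of [L] over [K], as the family of
   automorphisms to which descent along [Spec L -> Spec K] refers. *)
Lemma galois_family (K L : fieldExtType k) (s : 'AHom(K, L)) :
  exists (m : nat) (g : 'I_m -> 'AHom(L, L)),
  [/\ fdim L = (fdim K * m)%N, (forall i, comp_ahom (g i) s = s),
    (forall (M : fieldExtType k) (p p' : 'AHom(L, M)),
       comp_ahom p s = comp_ahom p' s -> exists i, p' = comp_ahom p (g i)),
    injective g & forall i x, g i x = x ^+ (#|k| ^ (fdim K * i))].
Proof.
have [m dL] : exists m, fdim L = (fdim K * m)%N.
  have /dvdnP[m ->] : (fdim K %| fdim L)%N.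
    have -> : fdim K = \dim (s @: {: K})%VS.
      by rewrite limg_dim_eq // (eqP (AHom_lker0 s)) capv0.
    rewrite /fdim; apply: (@field_dimS k L (s @: {: K})%AS {: L}%AS).
    exact: subvf.
  by exists m; rewrite mulnC.
have m0 : (0 < m)%N by case: m dL (fdim_gt0 L) => //; rewrite muln0 => ->.
have [g hg] := choice (fun i : 'I_m => frob_ahom L (fdim K * i)).
exists m, g; split=> //.
- by move=> i; apply: ahom_eq => x; rewrite ahom_compE hg -rmorphXn /= frob_iter // expf_fdim.
- move=> M p p' e; have hp x : x ^+ (#|k| ^ fdim K) = x -> p x = p' x.
    by move=> /(fixed_frob_image s)[y ->]; rewrite -!ahom_compE e.
  have [i hi] := embeddings_conjugate m0 dL hp.
  by exists i; apply: ahom_eq => x; rewrite ahom_compE hg -hi.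
- move=> i i' e.
  have h (x : L) : x ^+ (#|k| ^ (fdim K * i)) = x ^+ (#|k| ^ (fdim K * i')) by rewrite -!hg e.
  have := frob_eq_mod h; rewrite dL -!muln_modr !modn_small // => /eqP.
  by rewrite eqn_pmul2l ?fdim_gt0 // => /eqP/val_inj.
Qed.

Lemma Opull_const (K L : fieldExtType k) (s : 'AHom(K, L)) (a : K) :
  Opull (Spec_map s) (Oconst a) = Oconst (s a).
Proof. by []. Qed.

Lemma OconstD (K : fieldExtType k) (a b : K) : Oconst (a + b) = Oconst a + Oconst b.
Proof. by []. Qed.

Lemma OconstM (K : fieldExtType k) (a b : K) : Oconst (a * b) = Oconst a * Oconst b.
Proof. by []. Qed.

Lemma Oconst0 (K : fieldExtType k) : Oconst (0 : K) = 0.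
Proof. by []. Qed.

Lemma Oconst1 (K : fieldExtType k) : Oconst (1 : K) = 1.
Proof. by []. Qed.

Lemma Oconst_sum (K : fieldExtType k) I (r : seq I) (P : pred I) (a : I -> K) :
  Oconst (\sum_(i <- r | P i) a i) = \sum_(i <- r | P i) Oconst (a i).
Proof. by elim/big_rec2: _ => [|i y1 y2 _ <-]; rewrite ?Oconst0 ?OconstD. Qed.

Lemma OconstE (K : fieldExtType k) (a : Osch (Spec K)) : a = Oconst (a tt).
Proof. by apply: functional_extensionality_dep => -[]. Qed.

(** Galois descent for morphisms: with [g] the Galois group, [t] a generator
   of [L] and [c] the coefficients of the Lagrange polynomial taking the value
   [1] at [t] and [0] at its other conjugates, every morphism is
   [\sum_a c_a Tr (t^a u)], and traces descend. *)
Lemma descent_basis (K L : fieldExtType k) (s : 'AHom(K, L)) :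
  exists (m N : nat) (c d : 'I_N -> L) (tr : 'I_N -> L -> K)
    (desc : forall X Y : A (Spec K), 'I_N ->
       hom (res (Spec_map s) X) (res (Spec_map s) Y) -> hom X Y),
  [/\ forall X Y u, u = \sum_a Oconst (c a) *: resm (Spec_map s) (desc X Y a u),
      forall X Y a u v, desc X Y a (u + v) = desc X Y a u + desc X Y a v,
      forall X Y a l f, desc X Y a (Oconst l *: resm (Spec_map s) f)
        = Oconst (tr a l) *: f,
      forall a l, s (tr a l) = \sum_(i < m) (d a * l) ^+ (#|k| ^ (fdim K * i)) &
      forall l, l = \sum_a c a * s (tr a l)].
Proof.
have [m [g [dL g_fix g_torsor g_inj hg]]] := galois_family s.
pose S := Spec_map s.
pose act := gact (A := A) g_fix.
have actD i X Y u v : act i X Y (u + v) = act i X Y u + act i X Y v by exact: pullD.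
have act0 i X Y : act i X Y 0 = 0 by apply: (addrI (act i X Y 0)); rewrite -actD !addr0.
have act_sum i X Y (F : 'I_m -> _) : act i X Y (\sum_j F j) = \sum_j act i X Y (F j).
  by elim/big_rec2: _ => [|j y1 y2 _ <-].
have actZ i X Y l u : act i X Y (Oconst l *: u) = Oconst (g i l) *: act i X Y u.
  by rewrite /act /gact pullZ.
have actR i X Y f : act i X Y (resm S f) = resm S f by rewrite /act /gact pull_res.
have [i0 hi0] : exists i0, id_ahom L = g i0.
  have [i ->] := g_torsor L (id_ahom L) (id_ahom L) erefl.
  by exists i; rewrite ahom_comp1f.
have act1 X Y u : act i0 X Y u = u.
  by rewrite /act /gact pull_id // -hi0.
have mulex i : exists f : 'I_m -> 'I_m, forall j, g (f j) = comp_ahom (g i) (g j).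
  suff H j : exists i', g i' = comp_ahom (g i) (g j) by have [f hf] := choice H; exists f.
  have e : comp_ahom (id_ahom L) s = comp_ahom (comp_ahom (g i) (g j)) s.
    by rewrite -ahom_compA !g_fix ahom_comp1f.
  have [i' e'] := g_torsor _ _ _ e.
  by exists i'; rewrite e' ahom_comp1f.
pose Tr X Y u := \sum_j act j X Y u.
have Tr_inv X Y u i : act i X Y (Tr X Y u) = Tr X Y u.
  rewrite /Tr act_sum; have [f hf] := mulex i.
  rewrite [RHS](reindex_inj (h := f)) /=; last first.
    move=> j j' e; apply: g_inj; apply: ahom_eq => x; apply: (@ahom_inj _ _ _ (g i)).
    by rewrite -!ahom_compE -!hf e.
  apply: eq_bigr => j _; rewrite /act /gact.
  have E : Spec_map (g (f j)) = etcomp (Spec_map (g j)) (Spec_map (g i)) by rewrite hf.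
  exact: (pull_pull (S_G g_fix j) (S_G g_fix j) E).
have desc_ex X Y u : exists v, resm S v = Tr X Y u.
  have [v [hv _]] := invariant_descends A_stack g_torsor (Tr_inv X Y u).
  by exists v.
have [t ht] := primitive_element L.
have g_t i : g i t = t -> i = i0.
  move=> e; apply: g_inj; rewrite -hi0; apply: ahom_eq => x.
  rewrite id_lfunE; case: (ht x) => [->|[j ->]]; first exact: rmorph0.
  by rewrite rmorphXn /= e.
pose P := \prod_(i < m | i != i0) ((t - g i t)^-1 *: ('X - (g i t)%:P)).
have PE i : P.[g i t] = (i == i0)%:R.
  rewrite /P horner_prod; case: eqVneq => [->|ii0].
    rewrite big1 // => j ji0; rewrite hornerZ !hornerE -hi0 id_lfunE mulVf //.
    by rewrite subr_eq0; apply: contra_neq ji0 => /esym/g_t.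
  by rewrite (bigD1 i) //= hornerZ !hornerE subrr mulr0 mul0r.
pose c (a : 'I_(size P)) := P`_a.
have cE i : \sum_(a < size P) c a * g i (t ^+ a) = (i == i0)%:R.
  by rewrite -PE horner_coef; apply: eq_bigr => a _; rewrite rmorphXn.
pose lg i : L := \sum_(a < size P) c a * g i (t ^+ a).
have lgE i : lg i = (i == i0)%:R by exact: cE.
have tr_ex (l : L) : exists x : K, s x = \sum_i g i l.
  suff [x ->] : exists x, \sum_i g i l = s x by exists x.
  apply: (@fixed_frob_image k K L s).
  (* If [m = 1] then [L = K], and there is no member [1] of the family [g]. *)
  have [m0|m1] := leqP m 1.
    have [y hy] : exists y, l = s y.
      apply: (@fixed_frob_image k K L s).
      have : fdim L = fdim K.
        case: m m0 dL {g g_fix g_torsor g_inj hg act actD act0 act_sum actZ actR i0 hi0 act1 mulex Tr Tr_inv desc_ex g_t P PE c cE lg lgE} => [|[|]] //= _.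
          by rewrite muln0 => e0; move: (fdim_gt0 L); rewrite e0.
        by rewrite muln1.
      by move=> <-; exact: expf_fdim.
    rewrite hy (eq_bigr (fun=> s y)) => [|i _]; last by rewrite -ahom_compE g_fix.
    by rewrite sumr_const -rmorphMn -rmorphXn /= expf_fdim.
  have gg : g (Ordinal m1) =1 (fun x => x ^+ (#|k| ^ fdim K)).
    by move=> x; rewrite hg muln1.
  rewrite -gg rmorph_sum /=; have [f hf] := mulex (Ordinal m1).
  rewrite [RHS](reindex_inj (h := f)) /=; last first.
    move=> j j' e; apply: g_inj; apply: ahom_eq => x; apply: (@ahom_inj _ _ _ (g (Ordinal m1))).
    by rewrite -!ahom_compE -!hf e.
  by apply: eq_bigr => j _; rewrite hf ahom_compE.
pose tr (a : 'I_(size P)) l := sval (cid (tr_ex (t ^+ a * l))).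
have trE a l : s (tr a l) = \sum_i g i (t ^+ a * l) := svalP (cid (tr_ex (t ^+ a * l))).
pose desc X Y (a : 'I_(size P)) u := sval (cid (desc_ex X Y (Oconst (t ^+ a) *: u))).
have descE X Y a u : resm S (desc X Y a u) = Tr X Y (Oconst (t ^+ a) *: u) :=
  svalP (cid (desc_ex X Y (Oconst (t ^+ a) *: u))).
have Sinj := resm_inj A_stack g_fix g_torsor.
exists m, (size P), c, (fun a : 'I_(size P) => t ^+ a), tr, desc; split.
- move=> X Y u; transitivity (\sum_i Oconst (lg i) *: act i X Y u).
    rewrite (bigD1 i0) // big1 => [|i ii0].
      by rewrite /= addr0 lgE eqxx mulr1n act1 Oconst1 scale1r.
    by rewrite lgE (negbTE ii0) mulr0n Oconst0 scale0r.
  under eq_bigr => i _ do rewrite /lg Oconst_sum scaler_suml.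
  rewrite exchange_big /=; apply: eq_bigr => a _.
  rewrite descE /Tr scaler_sumr; apply: eq_bigr => i _.
  by rewrite actZ OconstM scalerA.
- move=> X Y a u v; apply: Sinj; rewrite resmD !descE /Tr -big_split /=.
  by apply: eq_bigr => i _; rewrite scalerDr actD.
- move=> X Y a l f; apply: Sinj; rewrite resmZ Opull_const descE trE /Tr Oconst_sum.
  rewrite scaler_suml; apply: eq_bigr => i _.
  by rewrite scalerA -OconstM actZ actR.
- by move=> a l; rewrite trE; apply: eq_bigr => i _; exact: hg.
- have gl i l : \sum_(a < size P) c a * g i (t ^+ a * l) = (i == i0)%:R * g i l.
    rewrite -cE mulr_suml; apply: eq_bigr => a _.
    by rewrite -mulrA -(rmorphM (g i)).
  move=> l; under eq_bigr => a _ do rewrite trE mulr_sumr.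
  rewrite exchange_big; transitivity (\sum_i (i == i0)%:R * g i l); last first.
    by apply: eq_bigr => i _; rewrite -gl.
  rewrite (bigD1 i0) // big1 => [|i ii0]; last by rewrite (negbTE ii0) mul0r.
  by rewrite /= addr0 eqxx mul1r -hi0 id_lfunE.
Qed.

Lemma direct_image (K L : fieldExtType k) (s : 'AHom(K, L)) (Y : A (Spec L)) :
  additive_cat (A (Spec L)) ->
  exists (m : nat) (g : 'I_m -> 'AHom(L, L)) (X : A (Spec K)),
    inhabited (dsum (fun i => res (Spec_map (g i)) Y) (res (Spec_map s) X)) /\
    exists i, g i = id_ahom L.
Proof.
move=> hadd; have [m [g [_ g_fix g_torsor g_inj _]]] := galois_family s.
have [D [[DS] _]] := dsum_exists (fun i => res (Spec_map (g i)) Y) hadd.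
have [X hX] := direct_image_descends A_stack g_fix g_torsor g_inj
  (dprj_inj DS) (dprj_inj0 DS) (dsumE DS).
exists m, g, X; split; first exact: dsum_transport (isomorphic_sym hX) DS.
have [i hi] := g_torsor L (id_ahom L) (id_ahom L) erefl.
by exists i; rewrite hi ahom_comp1f.
Qed.

End ScalarExtension.

(** * Krull-Schmidt decompositions *)

Section KrullSchmidt.
Variables (R : comPzRingType) (C : lincat R).
Hypotheses (C_add : additive_cat C) (C_kar : karoubian C).
Hypothesis C_fin : forall X Y : C, finite_set [set: hom X Y].
Implicit Types X Y P Q : C.

(** Both [e] and [idm X - e] split. *)
Lemma idempotent_sum X (e : hom X X) : e \c e = e ->
  exists (Y Z : C) (i : hom Y X) (j : hom Z X) (p : hom X Y) (r : hom X Z),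
  [/\ p \c i = idm Y, r \c j = idm Z, p \c j = 0, r \c i = 0
    & i \c p + j \c r = idm X] /\ i \c p = e.
Proof.
move=> ee; have [Y [p [i [pi ip]]]] := C_kar ee.
pose e' := idm X - e.
have ee' : e' \c e' = e'.
  by rewrite /e' cmpBl cmp1f !cmpBr cmpf1 ee subrr subr0.
have [Z [r [j [rj jr]]]] := C_kar ee'.
exists Y, Z, i, j, p, r; split=> //; split=> //.
- rewrite -(cmp1f p) -pi -(cmpf1 j) -rj !cmpA -(cmpA p) ip -(cmpA _ j) jr.
  by rewrite -(cmpA p) /e' cmpBr cmpf1 ee subrr cmpf0 cmp0f.
- rewrite -(cmp1f r) -rj -(cmpf1 i) -pi !cmpA -(cmpA r) jr -(cmpA _ i) ip.
  by rewrite -(cmpA r) /e' cmpBl cmp1f ee subrr cmpf0 cmp0f.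
- by rewrite ip jr /e' addrC subrK.
Qed.

(** An idempotent power of [f] splits [P], so it is [0] or [1]. *)
Lemma indec_local P : indecomposable P ->
  forall f : endr P, nilp f \/ two_sided_unit f.
Proof.
move=> [P0 hP] f.
have [n n0 hn] := finite_idempotent_power f (C_fin P P).
have [Y [Z [i [j [p [r [[h1 h2 h3 h4 h5] hip]]]]]]] := idempotent_sum hn.
have hs : is_sum Y Z P by exists i, j, p, r; split.
case: (hP _ _ hs) => [Y0|Z0].
  by left; exists n; rewrite -hip -(cmp1f p) Y0 cmp0f cmpf0.
right; have e1 : f ^+ n = 1.
  by rewrite -hip endr1 -h5 -(cmp1f r) Z0 cmp0f cmpf0 addr0.
exists (f ^+ n.-1); rewrite -exprSr -exprS prednK //.
Qed.

Lemma indec_nz P : indecomposable P -> (1 : endr P) != 0.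
Proof. by move=> [P0 _]; apply/eqP. Qed.

(** Each proper summand has fewer endomorphisms than [X]. *)
Lemma decomposition X : exists (I : finType) (P : I -> C),
  (forall a, indecomposable (P a)) /\ inhabited (dsum P X).
Proof.
have [n] := ubnP #|finT (C_fin X X)|; elim: n X => // n IH X; rewrite ltnS => hX.
case: (pselect (is_zero X)) => [X0|X0].
  exists void, (fun a : void => match a return C with end); split; first by case.
  by constructor; exact: dsum_zero.
case: (pselect (indecomposable X)) => [Xi|Xi].
  by exists unit, (fun=> X); split=> //; constructor; exact: dsum_single.
have [Y [Z [hs Y0 Z0]]] : exists Y Z, [/\ is_sum Y Z X, ~ is_zero Y & ~ is_zero Z].
  apply: contrapT => hn; apply: Xi; split=> // Y Z hs.
  case: (pselect (is_zero Y)) => [|Y0]; first by left.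
  case: (pselect (is_zero Z)) => [|Z0]; first by right.
  by case: hn; exists Y, Z.
have small Y' Z' (i : hom Y' X) (j : hom Z' X) p r : ~ is_zero Z' ->
    p \c i = idm Y' -> r \c j = idm Z' -> r \c i = 0 ->
    (#|finT (C_fin Y' Y')| < n)%N.
  move=> Z'0 pi rj ri; apply: leq_trans hX.
  pose f (u : finT (C_fin Y' Y')) : finT (C_fin X X) := i \c u \c p.
  have finj : injective f.
    move=> u v /(congr1 (fun w : hom X X => p \c w \c i)).
    by rewrite /f !cmpA pi !cmp1f -!cmpA pi !cmpf1.
  rewrite ltn_neqAle (leq_card f finj) andbT; apply/eqP => ec.
  have /codomP[u eu] : (idm X : finT (C_fin X X)) \in codom f.
    by apply: inj_card_onto => //; rewrite ec.
  apply: Z'0; rewrite /is_zero -rj -(cmpf1 r) eu /f !cmpA.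
  by rewrite ri !cmp0f.
have [i [j [p [r [h1 h2 h3 h4 h5]]]]] := hs.
have [I [P [hP [D]]]] := IH Y (small _ _ i j p r Z0 h1 h2 h4).
have [J [Q [hQ [D']]]] := IH Z (small _ _ j i r p Y0 h2 h1 h3).
exists (I + J)%type, (sum_fun P Q); split; last exact: dsum_sum hs.
by case.
Qed.

(** The unit of the local ring of [Q] is the sum of its components, one of
   which is therefore a unit. *)
Lemma local_component (I : finType) (P : I -> C) X (D : dsum P X) Q
    (r : hom X Q) (s : hom Q X) :
  indecomposable Q -> r \c s = idm Q ->
  exists a, two_sided_unit ((r \c dinj D a) \c (dprj D a \c s) : endr Q).
Proof.
move=> hQ rs; have Qloc := indec_local hQ; have Qnz := indec_nz hQ.
pose t a : endr Q := (r \c dinj D a) \c (dprj D a \c s).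
have t1 : \sum_a t a = 1.
  transitivity (r \c (\sum_a dinj D a \c dprj D a) \c s : endr Q).
    rewrite cmp_sumr cmp_suml; apply: eq_bigr => a _.
    by rewrite /t !cmpA.
  by rewrite dsumE cmpf1 rs.
apply: contrapT => hn.
have tn a : nilp (t a) by case: (Qloc (t a)) => // h; case: hn; exists a.
have : nilp (\sum_a t a).
  elim/big_ind: _ => //; first by exists 1%N; rewrite expr1.
  by move=> x y; apply: nilp_add.
by rewrite t1 => -[n]; rewrite expr1n => /eqP; rewrite (negbTE Qnz).
Qed.

Definition retract Q X := exists (r : hom X Q) (s : hom Q X), r \c s = idm Q.

Lemma retract_iso X Y : isomorphic X Y -> retract X Y.
Proof. by move=> [f [g gf _]]; exists g, f. Qed.

Lemma retract_trans Y X Z : retract X Y -> retract Y Z -> retract X Z.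
Proof.
move=> [r [s rs]] [r' [s' rs']]; exists (r \c r'), (s' \c s).
by rewrite cmpA -(cmpA r) rs' cmpf1 rs.
Qed.

Lemma retract_dsum (I : finType) (P : I -> C) X (D : dsum P X) a : retract (P a) X.
Proof. by exists (dprj D a), (dinj D a); exact: dprj_inj. Qed.

Lemma retract_component (I : finType) (P : I -> C) X (D : dsum P X) Q :
  indecomposable Q -> retract Q X -> exists a, retract Q (P a).
Proof.
move=> hQ [r [s /(local_component D hQ)[a [w [hw _]]]]].
by exists a, ((w : hom Q Q) \c (r \c dinj D a)), (dprj D a \c s); rewrite -cmpA; exact: hw.
Qed.

(** The summand is one whose component of [idm Q] is invertible: through it [Q]
   becomes a retract of an indecomposable object. *)
Lemma local_summand (I : finType) (P : I -> C) X (D : dsum P X) Q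
    (r : hom X Q) (s : hom Q X) :
  (forall a, indecomposable (P a)) -> indecomposable Q -> r \c s = idm Q ->
  exists a, is_iso (dprj D a \c s) /\ is_iso (r \c dinj D a).
Proof.
move=> hP hQ rs; have Qnz := indec_nz hQ.
have [a ta] := local_component D hQ rs.
pose t a : endr Q := (r \c dinj D a) \c (dprj D a \c s).
have [w [hw _]] := ta.
pose u := dprj D a \c s; pose v := (w : hom Q Q) \c (r \c dinj D a).
have vu : v \c u = idm Q by rewrite /v -cmpA; exact: hw.
pose e : endr (P a) := u \c v.
have ee : e * e = e by rewrite /e endrM cmpA -(cmpA u) vu cmpf1.
have e1 : e = 1.
  case: (indec_local (hP a) e) => [[n hn]|[y [hy _]]].
    have en m : e ^+ m.+1 = e by elim: m => // m IHm; rewrite exprS IHm ee.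
    have e0 : e = 0 by rewrite -(en n) exprS hn mulr0.
    have h : (v \c u) \c (v \c u) = 0.
      by rewrite cmpA -(cmpA v u v) (e0 : u \c v = 0) cmpf0 cmp0f.
    by move/eqP: h; rewrite vu cmp1f (negbTE Qnz).
  by rewrite -[LHS]mul1r -hy -mulrA ee.
have iu : is_iso u by exists v.
exists a; split=> //.
have -> : r \c dinj D a = (t a : hom Q Q) \c v.
  by rewrite /t -/u -[RHS]cmpA -[u \c v]/e e1 endr1 cmpf1.
apply: iso_cmp; first exact/endr_unit_iso.
by exists u.
Qed.

Lemma indec_summand (I : finType) (P : I -> C) X (D : dsum P X) Q
    (r : hom X Q) (s : hom Q X) :
  (forall a, indecomposable (P a)) -> indecomposable Q -> r \c s = idm Q ->
  exists a, isomorphic Q (P a).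
Proof. by move=> hP hQ /(local_summand D hP hQ)[a [ha _]]; exists a, (dprj D a \c s). Qed.

Section Blocks.
Variables (W : fieldType) (N : nat) (E : 'I_N -> C).
Hypothesis E_indec : forall s, indecomposable (E s).
Hypothesis E_inj : forall s t, isomorphic (E s) (E t) -> s = t.
Variable rho : forall s, hom (E s) (E s) -> W.
Hypothesis rhoD : forall s f g, rho (f + g) = rho (s := s) f + rho g.
Hypothesis rhoM : forall s f g, rho (f \c g) = rho (s := s) f * rho g.
Hypothesis rho1 : forall s, rho (idm (E s)) = 1.
Hypothesis rho0 : forall s (f : endr (E s)), rho f = 0 <-> nilp f.

(** The residue of a morphism between two members of the family; it vanishes
   off the diagonal, where every composite is in the radical. *)
Definition resid s t (f : hom (E s) (E t)) : W :=
  match eqVneq s t with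
  | EqNotNeq e => rho (eq_rect s (fun u => hom (E u) (E t)) f t e)
  | NeqNotEq _ => 0
  end.

Lemma resid_diag s (f : hom (E s) (E s)) : resid f = rho f.
Proof.
rewrite /resid; case: eqVneq => [e|]; last by rewrite eqxx.
by rewrite (eq_irrelevance e erefl).
Qed.

Lemma resid_off s t (f : hom (E s) (E t)) : s != t -> resid f = 0.
Proof. by rewrite /resid; case: eqVneq. Qed.

Lemma residD s t (f g : hom (E s) (E t)) : resid (f + g) = resid f + resid g.
Proof.
case: (eqVneq s t) => [e|ne]; last by rewrite !resid_off // addr0.
by subst t; rewrite !resid_diag rhoD.
Qed.

Lemma resid0 s t : resid (0 : hom (E s) (E t)) = 0.
Proof. by apply: (addrI (resid (0 : hom (E s) (E t)))); rewrite -residD !addr0. Qed.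

Lemma resid_sum s t J (r : seq J) (A : pred J) (f : J -> hom (E s) (E t)) :
  resid (\sum_(x <- r | A x) f x) = \sum_(x <- r | A x) resid (f x).
Proof. by elim/big_rec2: _ => [|x y1 y2 _ <-]; rewrite ?resid0 ?residD. Qed.

Lemma residM s t u (g : hom (E t) (E u)) (f : hom (E s) (E t)) :
  resid (g \c f) = resid g * resid f.
Proof.
case: (eqVneq s u) => [e|su].
  subst u; case: (eqVneq s t) => [e|st]; first by subst t; rewrite !resid_diag rhoM.
  rewrite (resid_off f) // mulr0 resid_diag; apply/rho0.
  case: (indec_local (E_indec s) (g \c f)) => // -[h [h1 _]].
  have D := dsum_single (E t).
  have hgf : (h : hom _ _) \c g \c f = idm _ by rewrite -cmpA; exact: h1.
  have [_ hi] := indec_summand D (fun=> E_indec t) (E_indec s) hgf.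
  by move/eqP: st; case; apply: E_inj.
rewrite resid_off //; case: (eqVneq s t) => [e|st].
  by subst t; rewrite (resid_off g) ?mul0r.
by rewrite (resid_off f) ?mulr0.
Qed.

Lemma resid_surj s t z : s = t -> (exists f, rho (s := t) f = z) ->
  exists f : hom (E s) (E t), resid f = z.
Proof. by move=> e; subst t => -[f <-]; exists f; rewrite resid_diag. Qed.

Section Phi.
Variables (I J : finType) (lab : I -> 'I_N) (lab' : J -> 'I_N) (X Y : C).
Variables (D : dsum (E \o lab) X) (D' : dsum (E \o lab') Y).

Definition phi (f : hom X Y) (b : J) (a : I) : W :=
  resid (dprj D' b \c f \c dinj D a : hom (E (lab a)) (E (lab' b))).

Lemma phi_off f b a : lab a != lab' b -> phi f b a = 0.
Proof. exact: resid_off. Qed.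

Lemma phiD f g b a : phi (f + g) b a = phi f b a + phi g b a.
Proof. by rewrite /phi cmpDr cmpDl residD. Qed.

Definition block s (f : hom X Y) :
  'M[W]_(#|[pred b | lab' b == s]|, #|[pred a | lab a == s]|) :=
  \matrix_(y, x) phi f (enum_val y) (enum_val x).

Lemma blockD s f g : block s (f + g) = block s f + block s g.
Proof. by apply/matrixP => y x; rewrite !mxE phiD. Qed.
End Phi.

Lemma phiM (I J H : finType) (lab : I -> 'I_N) (lab' : J -> 'I_N) (lab'' : H -> 'I_N)
    X Y Z (D : dsum (E \o lab) X) (D' : dsum (E \o lab') Y) (D'' : dsum (E \o lab'') Z)
    (g : hom Y Z) (f : hom X Y) c a :
  phi D D'' (g \c f) c a = \sum_b phi D' D'' g c b * phi D D' f b a.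
Proof.
transitivity (resid (\sum_b (dprj D'' c \c g \c dinj D' b) \c (dprj D' b \c f \c dinj D a)
    : hom (E (lab a)) (E (lab'' c)))); last first.
  by rewrite resid_sum; apply: eq_bigr => b _; rewrite residM.
congr resid; rewrite -[in LHS](cmp1f f) -(dsumE D') cmp_suml !cmp_sumr cmp_suml.
by apply: eq_bigr => b _; rewrite !cmpA.
Qed.

Lemma phi1 (I : finType) (lab : I -> 'I_N) X (D : dsum (E \o lab) X) b a :
  phi D D (idm X) b a = (b == a)%:R.
Proof.
rewrite /phi cmpf1; case: eqVneq => [->|ba].
  by rewrite dprj_inj resid_diag rho1.
by rewrite dprj_inj0 // resid0.
Qed.

Lemma blockM (I J H : finType) (lab : I -> 'I_N) (lab' : J -> 'I_N) (lab'' : H -> 'I_N)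
    X Y Z (D : dsum (E \o lab) X) (D' : dsum (E \o lab') Y) (D'' : dsum (E \o lab'') Z)
    s (g : hom Y Z) (f : hom X Y) :
  block D D'' s (g \c f) = block D' D'' s g *m block D D' s f.
Proof.
apply/matrixP => z x; rewrite !mxE (phiM D D' D'').
rewrite (bigID (fun b => lab' b == s)) /= [X in _ + X]big1 ?addr0; last first.
  move=> b nb; rewrite (@phi_off _ _ _ _ _ _ D D') ?mulr0 //.
  have /eqP -> : lab (enum_val x) == s by have := enum_valP x.
  by rewrite eq_sym.
rewrite (eq_bigl (fun b => b \in [pred b | lab' b == s])) // big_enum_val /=.
by apply: eq_bigr => y _; rewrite !mxE.
Qed.

Lemma block1 (I : finType) (lab : I -> 'I_N) X (D : dsum (E \o lab) X) s :
  block D D s (idm X) = 1%:M.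
Proof. by apply/matrixP => y x; rewrite !mxE phi1 (inj_eq enum_val_inj). Qed.

(** An isomorphism has invertible blocks, which are therefore square. *)
Lemma multiplicity_eq (I J : finType) (lab : I -> 'I_N) (lab' : J -> 'I_N) X Y
    (D : dsum (E \o lab) X) (D' : dsum (E \o lab') Y) s :
  isomorphic X Y -> #|[pred a | lab a == s]| = #|[pred b | lab' b == s]|.
Proof.
move=> [f [g gf fg]]; apply/eqP; rewrite eqn_leq.
apply/andP; split.
  by apply: (@mulmx1_min W _ _ (block D' D s g) (block D D' s f)); rewrite -blockM gf block1.
by apply: (@mulmx1_min W _ _ (block D D' s f) (block D' D s g)); rewrite -blockM fg block1.
Qed.

Lemma dsum_iso_of_multiplicity (I J : finType) (lab : I -> 'I_N) (lab' : J -> 'I_N) X Y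
    (D : dsum (E \o lab) X) (D' : dsum (E \o lab') Y) :
  (forall s, #|[pred a | lab a == s]| = #|[pred b | lab' b == s]|) ->
  isomorphic X Y.
Proof.
move=> hc.
pose A s := enum [pred a | lab a == s]; pose B s := enum [pred b | lab' b == s].
have sAB s : size (A s) = size (B s) by rewrite -!cardE hc.
have memA a : a \in A (lab a) by rewrite mem_enum inE.
have [d _] : exists d : I -> J, forall a, lab' (d a) = lab a.
  suff h a : exists b, lab' b = lab a by have [d hd] := choice h; exists d.
  have : (0 < #|[pred b | lab' b == lab a]|)%N.
    by rewrite -hc; apply/card_gt0P; exists a; rewrite inE.
  by move=> /card_gt0P[b]; rewrite inE => /eqP; exists b.
pose h a := nth (d a) (B (lab a)) (index a (A (lab a))).
have idx a : (index a (A (lab a)) < size (B (lab a)))%N by rewrite -sAB index_mem.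
have labh a : lab' (h a) = lab a.
  by have := mem_nth (d a) (idx a); rewrite mem_enum inE => /eqP.
have hinj : injective h.
  move=> a a' e; have el : lab a' = lab a by rewrite -!labh e.
  have : index a (A (lab a)) = index a' (A (lab a)).
    apply/eqP; rewrite -(@nth_uniq _ (d a) (B (lab a))) ?enum_uniq //; last by rewrite -el.
    move: e; rewrite /h el => ->; rewrite (set_nth_default (d a')) //.
    by rewrite -el.
  have m' : a' \in A (lab a) by rewrite -el.
  by move=> ei; rewrite -(nth_index a (memA a)) ei nth_index.
have hb : bijective h.
  apply: (inj_card_bij hinj).
  rewrite -!sum1_card (partition_big lab' predT) //= (partition_big lab predT) //=.
  by apply: leq_sum => s _; rewrite !sum1_card hc.
have D'' := dsum_reindex hb D'.
apply: (dsum_iso _ D D'') => a; rewrite /= labh; exact: isomorphic_refl.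
Qed.

Section Kernel.
Variables (I : finType) (lab : I -> 'I_N) (X : C) (D : dsum (E \o lab) X).

(** Otherwise a power of [f] is a nonzero idempotent [e]. An indecomposable
   summand of the image of [e] is identified with one of the summands of [X],
   where [e] acts as the identity although its blocks vanish. *)
Lemma block_kernel_nilp (f : endr X) : (forall s, block D D s f = 0) -> nilp f.
Proof.
move=> hf.
have phi_f0 b a : phi D D f b a = 0.
  case: (eqVneq (lab a) (lab b)) => [e|ne]; last exact: phi_off.
  have ha : a \in [pred x | lab x == lab b] by rewrite inE e.
  have hb : b \in [pred x | lab x == lab b] by rewrite inE.
  have /matrixP/(_ (enum_rank_in hb b) (enum_rank_in ha a)) := hf (lab b).
  by rewrite !mxE !enum_rankK_in.
have [n n0 hn] := finite_idempotent_power f (C_fin X X).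
set e : hom X X := f ^+ n in hn.
have phi_e0 b a : phi D D e b a = 0.
  rewrite /e -(prednK n0) exprSr endrM (phiM D D D) big1 // => c _.
  by rewrite phi_f0 mulr0.
have [Y [Z [i [j [p [r [[pi _ _ _ _] hip]]]]]]] := idempotent_sum hn.
case: (pselect (is_zero Y)) => [Y0|Y0].
  by exists n; rewrite -[f ^+ n]/e -hip -(cmp1f p) Y0 cmp0f cmpf0.
exfalso.
have [I' [P' [hP' [D']]]] := decomposition Y.
have [a' _] := dsum_nonzero D' Y0.
pose Q := P' a'; pose rr := dprj D' a' \c p; pose ss := i \c dinj D' a'.
have hrs : rr \c ss = idm Q.
  by rewrite /rr /ss -cmpA (cmpA p) pi cmp1f dprj_inj.
have hes : e \c ss = ss by rewrite /ss -hip cmpA -(cmpA i) pi cmpf1.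
have [a [[w hw1 hw2] _]] := local_summand D (fun a => E_indec (lab a)) (hP' a') hrs.
have : (1 : W) = 0.
  rewrite -(rho1 (lab a)) -hw2 -hes -resid_diag.
  have -> : dprj D a \c (e \c ss) \c w =
      \sum_b (dprj D a \c e \c dinj D b) \c (dprj D b \c ss \c w).
    rewrite -[in LHS](cmp1f ss) -(dsumE D) cmp_suml !cmp_sumr cmp_suml.
    by apply: eq_bigr => b _; rewrite !cmpA.
  rewrite resid_sum big1 // => b _; rewrite residM.
  by rewrite -[resid (dprj D a \c e \c dinj D b)]/(phi D D e a b) phi_e0 mul0r.
by move/eqP; rewrite oner_eq0.
Qed.

(** A power of [f] has identity blocks, so it is the identity up to a nilpotent
   endomorphism. *)
Lemma block_iso (f : hom X X) : (forall s, block D D s f \in unitmx) <-> is_iso f.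
Proof.
split=> [hf|[g gf fg] s]; last first.
  rewrite -row_free_unit; apply/row_freeP; exists (block D D s g).
  by rewrite -(blockM D D D) fg block1.
apply/endr_unit_iso.
have [n n0 hn] := finite_idempotent_power (f : endr X) (C_fin X X).
have bX m s : block D D s ((f : endr X) ^+ m) \in unitmx.
  elim: m => [|m IH]; first by rewrite block1 unitmx1.
  by rewrite exprS endrM (blockM D D D) unitmx_mul hf.
have bn s : block D D s ((f : endr X) ^+ n) = 1%:M.
  have h : block D D s ((f : endr X) ^+ n) *m block D D s ((f : endr X) ^+ n)
      = block D D s ((f : endr X) ^+ n) by rewrite -(blockM D D D) -endrM hn.
  by rewrite -(mulKmx (bX n s) (block D D s _)) h mulVmx.
have hnil : nilp (1 - (f : endr X) ^+ n).
  apply: block_kernel_nilp => s.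
  by apply: (addIr (block D D s ((f : endr X) ^+ n))); rewrite -blockD subrK bn block1 add0r.
have := unit_1sub_nilp hnil; rewrite subKr => -[y []].
move=> h1 h2.
have l1 : y * (f : endr X) ^+ n.-1 * (f : endr X) = 1 by rewrite -mulrA -exprSr prednK.
have r1 : (f : endr X) * ((f : endr X) ^+ n.-1 * y) = 1 by rewrite mulrA -exprS prednK.
have e : y * (f : endr X) ^+ n.-1 = (f : endr X) ^+ n.-1 * y.
  by rewrite -[LHS]mulr1 -r1 (mulrA _ (f : endr X)) l1 mul1r.
by exists (y * (f : endr X) ^+ n.-1); split=> //; rewrite e.
Qed.
End Kernel.
End Blocks.
End KrullSchmidt.

(** * Counting matrices by cyclic vectors *)

Section CompanionRow.
Variable l : finFieldType.

(** The companion matrix with last row [u]. *)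
Definition crow r (u : 'rV[l]_r) : 'M[l]_r :=
  \matrix_(i, i') if i == r.-1 :> nat then u 0 i' else (i.+1 == i' :> nat)%:R.

Definition cpol r (u : 'rV[l]_r) : {poly l} := 'X^r - rVpoly u.

Lemma size_cpol r (u : 'rV[l]_r) : size (cpol u) = r.+1.
Proof.
by rewrite /cpol size_polyDl size_polyXn // size_polyN ltnS size_poly.
Qed.

Lemma cpol_monic r (u : 'rV[l]_r) : cpol u \is monic.
Proof.
rewrite monicE lead_coefDl ?lead_coefXn //.
by rewrite size_polyN size_polyXn ltnS size_poly.
Qed.

Lemma char_poly_castmx m n (e : m = n) (M : 'M[l]_m) :
  char_poly (castmx (e, e) M) = char_poly M.
Proof. by case: n / e; rewrite castmx_id. Qed.

Lemma char_poly_crow r (u : 'rV[l]_r) : char_poly (crow u) = cpol u.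
Proof.
have e : (size (cpol u)).-1 = r by rewrite size_cpol.
rewrite -[RHS](companionmxK (cpol_monic u)).
have -> : crow u = castmx (e, e) (companionmx (cpol u)).
  apply/matrixP => i i'; rewrite castmxE !mxE /=; case: ifP => hi.
    rewrite size_cpol /= hi /cpol coefB coefXn coef_rVpoly_ord ltn_eqF ?ltn_ord //.
    by rewrite sub0r opprK.
  by rewrite size_cpol /= hi.
exact: char_poly_castmx.
Qed.

Lemma crow_inj r : injective (@crow r).
Proof.
move=> u v e; apply/rowP => i'; have r0 : (r.-1 < r)%N by case: r i' {u v e} => // -[].
by have /matrixP/(_ (Ordinal r0) i') := e; rewrite !mxE eqxx.
Qed.

Lemma crow_mul r n (u : 'rV[l]_r) (U : 'M[l]_(r, n)) (i : 'I_r) :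
  row i (crow u *m U) =
  if insub i.+1 : option 'I_r is Some i' then row i' U else u *m U.
Proof.
rewrite row_mul; case: insubP => [i' _ ei|].
  have -> : row i (crow u) = delta_mx 0 i'.
    apply/rowP => x; rewrite !mxE eqxx /=.
    have -> : (i == r.-1 :> nat) = false.
      apply/negbTE; rewrite neq_ltn -ltnS prednK; first by rewrite -ei ltn_ord.
      by rewrite (leq_trans _ (ltn_ord i)).
    by rewrite -ei eq_sym.
  by rewrite -rowE.
rewrite -leqNgt => hi; congr (_ *m _); apply/rowP => x; rewrite !mxE.
have e : r = i.+1 :> nat by apply/eqP; rewrite eqn_leq hi ltn_ord.
have er : r.-1 = i by rewrite [in LHS]e.
by rewrite er eqxx.
Qed.

End CompanionRow.

Section CyclicCount.
Variables (l : finFieldType) (G : pred {poly l}).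
Hypothesis G1 : G 1.
Hypothesis GM : forall p q, G (p * q) = G p && G q.

Definition gmat r := #|[pred M : 'M[l]_r | G (char_poly M)]|.
Definition gpol r := #|[pred u : 'rV[l]_r | G (cpol u)]|.
Definition glin r := #|[pred M : 'M[l]_r | M \in unitmx]|.

Lemma char_poly_conj r (g M : 'M[l]_r) : g \in unitmx ->
  char_poly (invmx g *m M *m g) = char_poly M.
Proof.
move=> gu; rewrite /char_poly.
pose G' := map_mx (@polyC l) g.
have Gu : map_mx (@polyC l) (invmx g) *m G' = 1%:M.
  by rewrite -map_mxM mulVmx // map_mx1.
have -> : char_poly_mx (invmx g *m M *m g) = map_mx (@polyC l) (invmx g) *m char_poly_mx M *m G'.
  rewrite /char_poly_mx !map_mxM mulmxBr mulmxBl -/G'.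
  by rewrite scalar_mxC -(mulmxA 'X%:M) Gu mulmx1.
by rewrite !det_mulmx mulrAC -det_mulmx Gu det1 mul1r.
Qed.

Lemma char_poly_lblock j s (A : 'M[l]_j) (B : 'M[l]_(s, j)) (D : 'M[l]_s) :
  char_poly (block_mx A 0 B D) = char_poly A * char_poly D.
Proof.
rewrite /char_poly.
have -> : char_poly_mx (block_mx A 0 B D) =
    block_mx (char_poly_mx A) 0 (- map_mx (@polyC l) B) (char_poly_mx D).
  rewrite /char_poly_mx map_block_mx map_mx0 scalar_mx_block opp_block_mx.
  by rewrite add_block_mx subr0 add0r.
exact: det_lblock.
Qed.

Section Fixed.
Variables (j s : nat).
Local Notation r := (j + s)%N.

(** The first [j] rows of [g] span an [M]-stable subspace, on which [M] acts as
   the companion matrix of [u]. *)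
Let frame (g M : 'M[l]_r) (u : 'rV[l]_j) := usubmx g *m M == crow u *m usubmx g.

Let frame1_count :
  (\sum_(M : 'M[l]_r | G (char_poly M)) \sum_(u | frame 1%:M M u) 1
   = gpol j * (#|l| ^ (s * j) * gmat s))%N.
Proof.
have e1 : usubmx (1%:M : 'M[l]_r) = row_mx 1%:M 0.
  by rewrite scalar_mx_block /block_mx col_mxKu.
have frE M u : frame 1%:M M u = (usubmx M == row_mx (crow u) 0).
  rewrite /frame e1 mul_mx_row mulmx1 mulmx0; congr (_ == _).
  by rewrite -[M in LHS]vsubmxK mul_row_col mul1mx mul0mx addr0.
pose f (x : 'rV[l]_j * ('M[l]_(s, j) * 'M[l]_s)) : 'M[l]_r * 'rV[l]_j :=
  (block_mx (crow x.1) 0 x.2.1 x.2.2, x.1).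
pose f' (y : 'M[l]_r * 'rV[l]_j) : 'rV[l]_j * ('M[l]_(s, j) * 'M[l]_s) :=
  (y.2, (dlsubmx y.1, drsubmx y.1)).
rewrite pair_big_dep /= (reindex_onto f f') /=; last first.
  case=> M u /andP[_]; rewrite frE => /eqP e; rewrite /f /f' /=; congr (_, _).
  by rewrite -[RHS]submxK /ulsubmx /ursubmx e row_mxKl row_mxKr.
rewrite (eq_bigl (fun x : 'rV[l]_j * ('M[l]_(s, j) * 'M[l]_s) => G (cpol x.1) && G (char_poly x.2.2))); last first.
  case=> u [B D]; rewrite /f /f' /= frE block_mxKdl block_mxKdr eqxx andbT.
  by rewrite /block_mx col_mxKu eqxx andbT char_poly_lblock GM char_poly_crow.
rewrite -(pair_big (fun u => G (cpol u)) (fun x : 'M[l]_(s, j) * 'M[l]_s => G (char_poly x.2)) (fun _ _ => 1%N)) /=.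
rewrite sum_nat_const; congr (_ * _)%N.
transitivity (\sum_(B : 'M[l]_(s, j)) \sum_(D : 'M[l]_s | G (char_poly D)) 1)%N.
  by rewrite pair_big /=; apply: eq_bigl => -[].
by rewrite sum_nat_const card_mx sum1_card.
Qed.

Let frame_count (g : 'M[l]_r) : g \in unitmx ->
  (\sum_(M : 'M[l]_r | G (char_poly M)) \sum_(u | frame g M u) 1
   = gpol j * (#|l| ^ (s * j) * gmat s))%N.
Proof.
move=> gu; rewrite -frame1_count.
pose c (M : 'M[l]_r) := invmx g *m M *m g; pose c' (M : 'M[l]_r) := g *m M *m invmx g.
have cK : cancel c c' by move=> M; rewrite /c /c' !mulmxA mulmxV // mul1mx mulmxK.
have c'K : cancel c' c by move=> M; rewrite /c /c' !mulmxA mulVmx // mul1mx mulmxKV.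
rewrite (reindex c) /=; last by apply: onW_bij; exists c'.
apply: eq_big => M; first by rewrite char_poly_conj.
move=> _; apply: eq_bigl => u; rewrite /frame /c.
have eg : usubmx g = usubmx (1%:M : 'M[l]_r) *m g by rewrite mul_usub_mx mul1mx.
rewrite eg !mulmxA mulmxK //.
apply/eqP/eqP => [e|->//]; apply: (can_inj (mulmxK gu)).
by rewrite e.
Qed.

Lemma row_free_complete (U : 'M[l]_(j, r)) : row_free U ->
  exists2 g : 'M[l]_r, g \in unitmx & usubmx g = U.
Proof.
move=> /eqP hU; exists (block_mx (col_ebase U) 0 0 1%:M *m row_ebase U).
  rewrite unitmx_mul row_ebase_unit andbT unitmxE det_ublock det1 mulr1.
  by rewrite -unitmxE col_ebase_unit.
rewrite -mul_usub_mx /block_mx col_mxKu -[RHS]mulmx_ebase hU; congr (_ *m _).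
by rewrite pid_mx_row mul_mx_row mulmx1 mulmx0.
Qed.

Lemma complement_count (U : 'M[l]_(j, r)) : row_free U ->
  #|[pred g : 'M[l]_r | (g \in unitmx) && (usubmx g == U)]| = (#|l| ^ (s * j) * glin s)%N.
Proof.
move=> /row_free_complete[g0 gu e0].
pose f (x : 'M[l]_(s, j) * 'M[l]_s) : 'M[l]_r := block_mx 1%:M 0 x.1 x.2 *m g0.
pose f' (g : 'M[l]_r) : 'M[l]_(s, j) * 'M[l]_s :=
  (dlsubmx (g *m invmx g0), drsubmx (g *m invmx g0)).
rewrite -sum1_card (eq_bigl (fun g => (g \in unitmx) && (usubmx g == U))) //.
rewrite (reindex_onto f f') /=; last first.
  move=> g /andP[_ /eqP eg]; rewrite /f /f' /=.
  have : usubmx (g *m invmx g0) = row_mx 1%:M 0.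
    rewrite -mul_usub_mx eg -e0 mul_usub_mx mulmxV //.
    by rewrite scalar_mx_block /block_mx col_mxKu.
  move=> e; rewrite -[LHS]/(_ *m _) -{3}(mulmxKV gu g); congr (_ *m _).
  by rewrite -[RHS]submxK /ulsubmx /ursubmx e row_mxKl row_mxKr.
rewrite (eq_bigl (fun x : 'M[l]_(s, j) * 'M[l]_s => x.2 \in unitmx)); last first.
  case=> B H; rewrite /f /f' /= mulmxK // block_mxKdl block_mxKdr eqxx andbT.
  rewrite unitmx_mul gu andbT unitmxE det_lblock det1 mul1r -unitmxE.
  suff -> : usubmx (block_mx 1%:M 0 B H *m g0) = U by rewrite eqxx andbT.
  rewrite -mul_usub_mx /block_mx col_mxKu -e0 -{2}[g0]mul1mx -mul_usub_mx.
  by rewrite scalar_mx_block /block_mx col_mxKu.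
transitivity (\sum_(B : 'M[l]_(s, j)) \sum_(H : 'M[l]_s | H \in unitmx) 1)%N.
  by rewrite pair_big /=; apply: eq_bigl => -[].
by rewrite sum_nat_const card_mx sum1_card.
Qed.

(** Double count of the triples [(g, M, u)] with [frame g M u]: conjugation by
   [g] reduces to the standard frame, and each frame [U] of rank [j] extends to
   the same number of invertible matrices. *)
Lemma frames_count :
  (\sum_(M : 'M[l]_r | G (char_poly M))
     #|[pred U : 'M[l]_(j, r) | row_free U && [exists u, U *m M == crow u *m U]]|
     * (#|l| ^ (s * j) * glin s)
   = glin r * (gpol j * (#|l| ^ (s * j) * gmat s)))%N.
Proof.
transitivity (\sum_(g : 'M[l]_r | g \in unitmx)
    \sum_(M : 'M[l]_r | G (char_poly M)) \sum_(u | frame g M u) 1)%N; last first.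
  rewrite (eq_bigr _ frame_count) sum_nat_const; congr (_ * _)%N.
rewrite exchange_big /=; apply: eq_bigr => M _.
transitivity (\sum_(U : 'M[l]_(j, r) | row_free U && [exists u, U *m M == crow u *m U])
   #|[pred g : 'M[l]_r | (g \in unitmx) && (usubmx g == U)]|)%N.
  rewrite (eq_bigr (fun=> (#|l| ^ (s * j) * glin s)%N)) => [|U /andP[hU _]]; last first.
    exact: complement_count.
  by rewrite sum_nat_const.
rewrite (eq_bigr (fun U => \sum_(g : 'M[l]_r | (g \in unitmx) && (usubmx g == U)) 1)%N);
  last by move=> U _; rewrite sum1_card.
rewrite (exchange_big_dep (fun g => g \in unitmx)) /=; last by move=> U g _ /andP[].
apply: eq_bigr => g gu.
have gU : row_free (usubmx g).
  move: gu; rewrite -row_free_unit => /row_freeP[h hh].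
  apply/row_freeP; exists (lsubmx h).
  have : ulsubmx (g *m h) = 1%:M by rewrite hh scalar_mx_block block_mxKul.
  by rewrite -{1}[g]vsubmxK -{1}[h]hsubmxK mul_col_row block_mxKul.
rewrite (eq_bigl (fun U => (U == usubmx g) && [exists u, frame g M u])); last first.
  move=> U; rewrite gu /= [usubmx g == U]eq_sym; case: eqVneq => [->|]; last by rewrite andbF.
  by rewrite gU andbT.
case: existsP => [[u hu]|hn]; last first.
  rewrite big_pred0 => [|U]; last by rewrite andbF.
  by rewrite big_pred0 // => u; apply/negP => hu; apply: hn; exists u.
rewrite (eq_bigl (pred1 (usubmx g))) => [|U]; last by rewrite andbT.
rewrite big_pred1_eq (big_pred1 u) // => v /=; apply/idP/eqP => [hv|->//].
apply: crow_inj; apply: (row_free_inj gU).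
by rewrite -(eqP hv) (eqP hu).
Qed.

End Fixed.

Section Krylov.
Variables (r : nat) (M : 'M[l]_r).

Definition kvec (v : 'rV[l]_r) i := iter i (fun x => x *m M) v.

Definition kry j v : 'M[l]_(j, r) := \matrix_(i < j) kvec v i.

Let krow j v i : row i (kry j v) = kvec v i.
Proof. by rewrite rowK. Qed.

Lemma kry_free_step j v :
  row_free (kry j.+1 v) = row_free (kry j v) && ~~ (kvec v j <= kry j v)%MS.
Proof.
have e : (kry j.+1 v :=: kry j v + kvec v j)%MS.
  apply/eqmxP/andP; split.
    apply/row_subP => i; rewrite krow; case: (unliftP ord_max i) => [i' ->|->].
      apply: submx_trans (addsmxSl _ _).
      have -> : kvec v (lift ord_max i') = row i' (kry j v) by rewrite krow lift_max.
      exact: row_sub.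
    exact: addsmxSr.
  rewrite addsmx_sub; apply/andP; split.
    apply/row_subP => i; rewrite krow -(krow v (widen_ord (leqnSn j) i)).
    exact: row_sub.
  by rewrite -(krow v (@ord_max j)) row_sub.
rewrite /row_free e -[RHS]andbC.
case: (boolP (kvec v j <= kry j v)%MS) => h /=.
  rewrite (addsmx_idPl h).
  by apply/negbTE; rewrite neq_ltn ltnS rank_leq_row.
have lt : (\rank (kry j v) < \rank (kry j v + kvec v j)%MS)%N.
  have : (kry j v < kry j v + kvec v j)%MS by rewrite /ltmx addsmxSl addsmx_sub submx_refl h.
  by rewrite ltmxErank => /andP[].
have le : (\rank (kry j v + kvec v j)%MS <= (\rank (kry j v)).+1)%N.
  apply: leq_trans (mxrank_adds_leqif _ _) _; rewrite -[X in (_ <= X)%N]addn1 leq_add2l.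
  exact: rank_leq_row.
have -> : \rank (kry j v + kvec v j)%MS = (\rank (kry j v)).+1.
  by apply/eqP; rewrite eqn_leq le lt.
by rewrite eqSS.
Qed.

Lemma kry_index_unique v :
  (\sum_(j < r.+1) (row_free (kry j v) && (kvec v j <= kry j v)%MS) = 1)%N.
Proof.
pose P j := row_free (kry j v).
have P0 : P 0%N by rewrite /P /row_free -leqn0 rank_leq_row.
have Pr : P r.+1 = false.
  by apply/negbTE; rewrite /P /row_free neq_ltn ltnS rank_leq_col.
have key n : (\sum_(j < n) (P j && (kvec v j <= kry j v)%MS) + P n = 1)%N.
  elim: n => [|n IH]; first by rewrite big_ord0 P0.
  rewrite big_ord_recr /= -addnA -[RHS]IH; congr (_ + _)%N.
  by rewrite {2}/P kry_free_step -/(P n); case: (P n) (_ <= _)%MS => [] [].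
by have := key r.+1; rewrite Pr addn0.
Qed.

(** The frames on which [M] acts as a companion matrix are the Krylov families
   [v, v M, ..., v M^(j-1)] of the vectors [v] that generate a cyclic subspace
   of dimension [j]. *)
Lemma kry_frame j :
  #|[pred U : 'M[l]_(j, r) | row_free U && [exists u, U *m M == crow u *m U]]| =
  #|[pred v : 'rV[l]_r | row_free (kry j v) && (kvec v j <= kry j v)%MS]|.
Proof.
rewrite -!sum1_card.
case: j => [|j].
  rewrite (big_pred1 (0 : 'M[l]_(0, r))) => [|U]; last first.
    rewrite !inE [U]flatmx0 eqxx /row_free -leqn0 rank_leq_row /=.
    by apply/existsP; exists 0; rewrite [_ *m _]flatmx0 [crow _ *m _]flatmx0.
  rewrite (big_pred1 (0 : 'rV[l]_r)) // => v; rewrite !inE.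
  have -> : row_free (kry 0 v) by rewrite /row_free -leqn0 rank_leq_row.
  apply/idP/eqP => [/submxP[x e]|->]; last exact: sub0mx.
  by rewrite (e : v = _) [x]thinmx0 mul0mx.
rewrite (reindex_onto (kry j.+1) (fun U : 'M[l]_(j.+1, r) => row ord0 U)) /=; last first.
  move=> U /andP[_ /existsP[u /eqP hu]].
  suff h i (hi : (i < j.+1)%N) : kvec (row ord0 U) i = row (Ordinal hi) U.
    by apply/row_matrixP => -[i hi]; rewrite krow h.
  elim: i hi => [|i IH] hi; first by congr row; apply/val_inj.
  rewrite /= (IH (ltnW hi)) -row_mul hu crow_mul.
  by case: insubP => [i' _ ei|]; [congr row; apply/val_inj; rewrite /= ei|rewrite hi].
apply: eq_bigl => v; rewrite !inE krow eqxx andbT; congr (_ && _).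
apply/existsP/idP => [[u /eqP hu]|/submxP[u hu]].
  have := congr1 (row ord_max) hu; rewrite row_mul krow crow_mul.
  case: insubP => [i' /=|_ /= ->]; first by rewrite ltnn.
  exact: submxMl.
exists u; apply/eqP/row_matrixP => i; rewrite row_mul krow crow_mul.
case: insubP => [i' _ ei|]; first by rewrite krow ei.
rewrite -leqNgt => hi; rewrite -hu; transitivity (kvec v i.+1) => //.
suff e : i.+1 = j.+1 by rewrite [in LHS]e.
by apply/eqP; rewrite eqn_leq hi ltn_ord.
Qed.

End Krylov.

Lemma glin_gt0 r : (0 < glin r)%N.
Proof. by apply/card_gt0P; exists 1%:M; rewrite inE unitmx1. Qed.

Definition gratio r : rat := (gmat r)%:R / (glin r)%:R.

(** Counting pairs (matrix, vector) by the dimension of the cyclic subspace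
   that the vector generates. *)
Lemma cyclic_recursion r :
  (#|l| ^ r)%:R * gratio r = \sum_(j < r.+1) (gpol j)%:R * gratio (r - j).
Proof.
have gl0 n : (glin n)%:R != 0 :> rat by rewrite pnatr_eq0 -lt0n glin_gt0.
have q0 n : (#|l| ^ n)%:R != 0 :> rat.
  by rewrite pnatr_eq0 expn_eq0 -leqn0 leqNgt (ltnW (finNzRing_gt1 l)).
pose c j (M : 'M[l]_r) :=
  #|[pred v : 'rV[l]_r | row_free (kry M j v) && (kvec M v j <= kry M j v)%MS]|.
have e1 : ((#|l| ^ r) * gmat r = \sum_(j < r.+1) \sum_(M : 'M[l]_r | G (char_poly M)) c j M)%N.
  rewrite exchange_big /=.
  transitivity (\sum_(M : 'M[l]_r | G (char_poly M)) #|l| ^ r)%N.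
    by rewrite sum_nat_const mulnC.
  apply: eq_bigr => M _; rewrite -[r in (#|l| ^ r)%N]mul1n -card_mx -sum1_card.
  under eq_bigr => v _ do rewrite -(kry_index_unique M v).
  rewrite exchange_big /=; apply: eq_bigr => j _.
  rewrite /c -sum1_card [RHS]big_mkcond /=; apply: eq_bigr => v _.
  by rewrite inE; case: (_ && _).
have e2 (j : 'I_r.+1) : (\sum_(M : 'M[l]_r | G (char_poly M)) c j M)%:R =
    (glin r)%:R * (gpol j)%:R * gratio (r - j) :> rat.
  have [s hs] : exists s, r = (j + s)%N by exists (r - j)%N; rewrite subnKC // -ltnS.
  have -> : (r - j = s)%N by rewrite {1}hs addKn.
  rewrite /c; move: (nat_of_ord j) hs => {}j hs; rewrite {}hs {c e1}.
  under eq_bigr => M _ do rewrite -kry_frame.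
  apply: (mulIf (gl0 s)); apply: (mulIf (q0 (s * j)%N)).
  rewrite -!natrM mulnAC -mulnA [X in X%:R = _]big_distrl frames_count /gratio !natrM.
  rewrite -[X in _ = X * _]mulrA divfK // -!mulrA; congr (_ * (_ * _)).
  exact: mulrC.
transitivity ((\sum_(j < r.+1) \sum_(M : 'M[l]_r | G (char_poly M)) c j M)%N%:R / (glin r)%:R : rat).
  by rewrite -e1 natrM /gratio mulrA.
rewrite natr_sum mulr_suml; apply: eq_bigr => j _; rewrite e2.
by rewrite -!mulrA mulrC -!mulrA mulVf ?mulr1.
Qed.

End CyclicCount.

(** * Polynomials with roots in a given set *)

Section ZetaCount.
Variables (l : finFieldType) (W : closedFieldType) (j : {rmorphism l -> W}).
Local Notation q := #|l|.

(** [P] is the minimal polynomial of [z], the product of ['X - x] over the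
   Frobenius orbit of [z]; Frobenius permutes its factors, so that its
   coefficients are in [l]. *)
Lemma orbit_polynomial (z : W) i : (0 < i)%N -> z ^+ (q ^ i) = z ->
  exists d (P : {poly l}),
  [/\ (0 < d)%N, P \is monic, size P = d.+1,
      forall n, (z ^+ (q ^ n) == z) = (d %| n)%N &
      [/\ mup z (map_poly j P) = 1%N,
          forall p, root (map_poly j p) z -> P %| p &
          forall x, root (map_poly j P) x -> exists n, x = z ^+ (q ^ n)]].
Proof.
move=> i0 zi.
have ex : exists n, (0 < n)%N && (z ^+ (q ^ n) == z) by exists i; rewrite i0 zi eqxx.
case: (ex_minnP ex) => d /andP[d0 /eqP zd] dmin.
have hd n : (z ^+ (q ^ n) == z) = (d %| n)%N.
  apply/eqP/idP => [hn|/dvdnP[m ->]]; last by rewrite mulnC frob_iter.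
  rewrite /dvdn; apply: contraT => r0.
  have hr : z ^+ (q ^ (n %% d)) == z.
    by apply/eqP; rewrite -{2}hn {2}(divn_eq n d) expnD exprM mulnC frob_iter.
  by have := dmin (n %% d)%N; rewrite lt0n r0 hr leqNgt ltn_pmod // => /(_ isT).
pose y n := z ^+ (q ^ n).
have y0 : y 0%N = z by rewrite /y expn0 expr1.
have y_inj n n' : (n < d)%N -> (n' < d)%N -> y n = y n' -> n = n'.
  wlog lt : n n' / (n < n')%N.
    move=> hw h1 h2 e; case: (ltngtP n n') => // lt; first exact: hw.
    by apply/esym/(hw n' n) => //; exact/esym.
  move=> h1 h2 e; have : (d %| n' + (d - n))%N.
    rewrite -hd expnD exprM -[z ^+ (q ^ n')]/(y n') -e /y -exprM -expnD.
    by rewrite subnKC ?(ltnW h1) // zd.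
  have -> : (n' + (d - n) = (n' - n) + d)%N.
    by rewrite addnBA ?(ltnW h1) // addnC [RHS]addnC addnBA ?(ltnW lt) // .
  rewrite -[X in (_ %| _ + X)%N]mul1n dvdn_addl ?dvdn_mull // => /dvdn_leq.
  rewrite subn_gt0 => /(_ lt); rewrite leqNgt.
  by rewrite (leq_ltn_trans (leq_subr _ _) h2).
pose S := [seq y n | n <- iota 0 d].
have S_uniq : uniq S.
  rewrite map_inj_in_uniq ?iota_uniq // => n n'; rewrite !mem_iota !add0n /=.
  exact: y_inj.
pose PW := \prod_(x <- S) ('X - x%:P).
have [g hg] := frob_rmorphism j 1.
have y_frob n : g (y n) = y n.+1 by rewrite hg /y -exprM -expnD addn1.
have PW_fix : map_poly g PW = PW.
  rewrite /PW rmorph_prod /=.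
  transitivity (\prod_(x <- map g S) ('X - x%:P)).
    rewrite big_map; apply: eq_bigr => x _.
    by rewrite rmorphB /= map_polyX map_polyC.
  apply: perm_big; apply: uniq_perm => //.
    by rewrite (map_inj_uniq (fmorph_inj g)).
  have gS : {subset map g S <= S}.
    move=> x /mapP[x' /mapP[n]]; rewrite mem_iota add0n /= => nd -> ->.
    rewrite y_frob; case: (ltnP n.+1 d) => h; first by rewrite map_f // mem_iota.
    have -> : n.+1 = d by apply/eqP; rewrite eqn_leq h nd.
    by rewrite [y d]zd -y0; apply: map_f; rewrite mem_iota.
  have U : uniq (map g S) by rewrite (map_inj_uniq (fmorph_inj g)).
  by have [_ e] := uniq_min_size U gS (eq_leq (esym (size_map g S))).
have [P hP] : exists P : {poly l}, map_poly j P = PW.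
  have hc n : exists x, PW`_n = j x.
    apply: finField_fixed_image; have := hg PW`_n.
    by rewrite expn1 -coef_map PW_fix => <-.
  have [c hc'] := choice hc.
  exists (\poly_(n < size PW) c n); apply/polyP => n; rewrite coef_map coef_poly.
  case: ltnP => h; first by rewrite hc'.
  by rewrite nth_default //; exact: (rmorph0 j).
have PW_monic : PW \is monic by rewrite monic_prod_XsubC.
have zS : z \in S by rewrite -y0; apply: map_f; rewrite mem_iota.
exists d, P; split=> //.
- by rewrite -(map_monic j) hP.
- by rewrite -(size_map_poly j) hP size_prod_XsubC size_map size_iota.
split.
- by rewrite hP /PW mu_prod_XsubC count_uniq_mem // zS.
- move=> p hp; rewrite -(dvdp_map j) hP; apply: uniq_roots_dvdp; last by rewrite uniq_rootsE.
  apply/allP => x /mapP[n _ ->]; elim: n => [|n IH]; first by rewrite y0.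
  rewrite -y_frob; have -> : map_poly j p = map_poly g (map_poly j p).
    by apply/polyP => m; rewrite !coef_map /= hg expn1 -rmorphXn expf_card.
  by rewrite rootE horner_map (rootP IH) rmorph0.
- by move=> x; rewrite hP root_prod_XsubC => /mapP[n _ ->]; exists n.
Qed.


Variable Zs : W -> Prop.
Hypothesis Zs_frob : forall z, Zs z -> Zs (z ^+ q).

Definition rootsin : pred {poly l} :=
  fun p => `[< forall z, root (map_poly j p) z -> Zs z >].

Lemma rootsin1 : rootsin 1.
Proof. by apply/asboolP => z; rewrite rmorph1 (negbTE (root1 z)). Qed.

Lemma rootsinM p p' : rootsin (p * p') = rootsin p && rootsin p'.
Proof.
apply/asboolP/andP => [h|[/asboolP h /asboolP h'] z].
  by split; apply/asboolP => z hz; apply: h; rewrite rmorphM rootM hz ?orbT.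
by rewrite rmorphM rootM => /orP[/h|/h'].
Qed.

Lemma rootsinX p t : rootsin p -> rootsin (p ^+ t).
Proof.
move=> hp; elim: t => [|t IH]; first exact: rootsin1.
by rewrite exprS rootsinM hp.
Qed.

Lemma root_finite_orbit (p : {poly l}) (z : W) : p != 0 -> root (map_poly j p) z ->
  exists i, [/\ (0 < i)%N, (i < size p)%N & z ^+ (q ^ i) = z].
Proof.
move=> pn hz; pose y n := z ^+ (q ^ n).
have hroot n : root (map_poly j p) (y n).
  elim: n => [|n IH]; first by rewrite /y expn0 expr1.
  have [g hg] := frob_rmorphism j 1.
  have -> : y n.+1 = g (y n) by rewrite hg /y -exprM -expnD addn1.
  have -> : map_poly j p = map_poly g (map_poly j p).
    by apply/polyP => m; rewrite !coef_map /= hg expn1 -rmorphXn expf_card.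
  by rewrite rootE horner_map (rootP IH) rmorph0.
have : ~~ uniq [seq y n | n <- iota 0 (size p)].
  apply/negP => U; have pn' : map_poly j p != 0 by rewrite map_poly_eq0.
  have hall : all (root (map_poly j p)) [seq y n | n <- iota 0 (size p)].
    by apply/allP => x /mapP[n _ ->].
  by have := max_poly_roots pn' hall U; rewrite size_map size_iota size_map_poly ltnn.
case: (pselect (exists a b, [/\ (a < b)%N, (b < size p)%N & y a = y b])).
  move=> [a [b [ab bp e]]] _; exists (b - a)%N; split; first by rewrite subn_gt0.
    by rewrite (leq_ltn_trans (leq_subr _ _) bp).
  have [g hg] := frob_rmorphism j a; apply: (fmorph_inj g).
  by rewrite !hg -exprM -expnD subnK ?(ltnW ab) // -[LHS]/(y b) -e.
move=> hn /negP[]; rewrite map_inj_in_uniq ?iota_uniq // => a b.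
rewrite !mem_iota !add0n /= => ha hb e; apply/eqP; apply: contraT => nab; case: hn.
by case: (ltngtP a b) nab => // lt _; [exists a, b|exists b, a].
Qed.

Lemma dvdp_orbit (z : W) (P : {poly l}) : P \is monic ->
  mup z (map_poly j P) = 1%N ->
  (forall p, root (map_poly j p) z -> P %| p) ->
  forall p t, p != 0 -> (P ^+ t %| p) = (t <= mup z (map_poly j p))%N.
Proof.
move=> /monic_neq0 Pn P1 hP p t pn.
have mn (p' : {poly l}) : p' != 0 -> map_poly j p' != 0 by rewrite map_poly_eq0.
apply/idP/idP => [/dvdpP[p' e]|].
  have p'n : p' != 0 by apply: contraNneq pn => p'0; rewrite e p'0 mul0r.
  rewrite {}e mulrC rmorphM mupM ?mn ?expf_neq0 //.
  apply: leq_trans (leq_addr _ _); elim: t => // t IH.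
  by rewrite exprS rmorphM mupM ?mn ?expf_neq0 // P1 add1n.
elim: t p pn => [|t IH] p pn ht; first by rewrite expr0 dvd1p.
have /hP/dvdpP[p' e] : root (map_poly j p) z.
  by rewrite -dvdp_XsubCl XsubC_dvd ?mn // (leq_ltn_trans _ ht).
have p'n : p' != 0 by apply: contraNneq pn => p'0; rewrite e p'0 mul0r.
rewrite e exprSr dvdp_mul2r // IH //.
by move: ht; rewrite e rmorphM mupM ?mn // P1 addn1.
Qed.

Lemma cpolK r (p : {poly l}) : p \is monic -> size p = r.+1 ->
  cpol (poly_rV ('X^r - p) : 'rV_r) = p.
Proof.
move=> pm sp; rewrite /cpol poly_rV_K ?subKr //.
apply/leq_sizeP => i; rewrite leq_eqVlt coefB coefXn => /orP[/eqP <-|ri].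
  have := pm; rewrite monicE /lead_coef sp /= => /eqP ->; by rewrite eqxx subrr.
by rewrite gtn_eqF // nth_default ?subrr // sp.
Qed.

Lemma cpol_inj r : injective (@cpol l r).
Proof.
by move=> u v /(congr1 (fun p => poly_rV ('X^r - p) : 'rV_r)); rewrite /cpol !subKr !rVpolyK.
Qed.

Lemma multiples_count m n (Q : {poly l}) : Q \is monic -> size Q = m.+1 -> rootsin Q ->
  #|[pred u : 'rV[l]_(m + n) | rootsin (cpol u) && (Q %| cpol u)]| = gpol rootsin n.
Proof.
move=> Qm sQ hQ; have Qn := monic_neq0 Qm.
pose f (u : 'rV[l]_n) : 'rV[l]_(m + n) := poly_rV ('X^(m + n) - Q * cpol u).
pose f' (u : 'rV[l]_(m + n)) : 'rV[l]_n := poly_rV ('X^n - cpol u %/ Q).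
have fE u : cpol (f u) = Q * cpol u.
  rewrite cpolK ?monicMl ?cpol_monic //.
  by rewrite size_monicM ?monic_neq0 ?cpol_monic // sQ size_cpol addSn addnS.
rewrite /gpol -!sum1_card (reindex_onto f f') /=; last first.
  move=> u; rewrite inE => /andP[_ hd]; apply: cpol_inj.
  have qm : cpol u %/ Q \is monic.
    by have := cpol_monic u; rewrite -{1}(divpK hd) monicMr.
  rewrite fE cpolK // ?divpK 1?mulrC ?divpK //.
  by rewrite size_divp // size_cpol sQ /= subSn ?leq_addr // addKn.
apply: eq_bigl => u; rewrite !inE fE rootsinM hQ dvdp_mulr // andbT.
suff -> : f' (f u) = u by rewrite eqxx andbT.
by apply: cpol_inj; rewrite /f' fE mulKp // cpolK ?cpol_monic ?size_cpol.
Qed.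

(** Points of the set over the extension of degree [i]. *)
Definition zpts i := cardset [set z : W | Zs z /\ z ^+ (q ^ i) = z].

Lemma frob_pow_poly i : (0 < i)%N ->
  exists2 s : seq W, uniq s & forall z, (z \in s) = (z ^+ (q ^ i) == z).
Proof.
move=> i0; have q1 : (1 < q ^ i)%N.
  by rewrite -(exp1n i) ltn_exp2r ?finNzRing_gt1.
pose P : {poly W} := 'X^(q ^ i) - 'X.
have Pm : P \is monic.
  by rewrite monicE lead_coefDl ?lead_coefXn // size_polyXn size_polyN size_polyX ltnS.
have [s hs] := closed_field_poly_normal P.
exists (undup s); first exact: undup_uniq.
move=> z; rewrite mem_undup -root_prod_XsubC.
have := hs; rewrite (monicP Pm) scale1r => <-.
by rewrite rootE !hornerE subr_eq0.
Qed.

Lemma cardset_seq (T : choiceType) (s : seq T) : uniq s -> cardset [set` s] = size s.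
Proof.
move=> U; rewrite /cardset; apply: perm_size; apply: uniq_perm => //.
by move=> x; rewrite in_fset_set ?inE //; apply/idP/idP; rewrite inE.
Qed.

Lemma zpts_seq (S : seq W) i : uniq S -> (forall z, z \in S -> Zs z) ->
  (forall z, Zs z -> z ^+ (q ^ i) = z -> z \in S) ->
  zpts i = (\sum_(z <- S) (z ^+ (q ^ i) == z))%N.
Proof.
move=> U hS hi; transitivity (size [seq z <- S | z ^+ (q ^ i) == z]).
  rewrite /zpts -cardset_seq ?filter_uniq //; congr cardset.
  apply/seteqP; split => z /=; rewrite mem_filter.
    by move=> [hz e]; rewrite e eqxx hi.
  by move=> /andP[/eqP e /hS].
by rewrite size_filter -sum1_count big_mkcond; apply: eq_bigr => z _; case: eqP.
Qed.

Lemma sum_count_mem (S s : seq W) : uniq S -> {subset s <= S} ->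
  (\sum_(z <- S) count_mem z s = size s)%N.
Proof.
move=> U; elim: s => [|x s IH] hs; first by rewrite big1.
rewrite /= big_split /= IH => [|z zs]; last by apply: hs; rewrite inE zs orbT.
rewrite -add1n; congr (_ + _)%N; transitivity (count_mem x S : nat).
  rewrite -sum1_count [RHS]big_mkcond; apply: eq_bigr => z _ /=.
  by rewrite eq_sym; case: eqP.
by rewrite count_uniq_mem // hs // mem_head.
Qed.

(** Each good polynomial of degree [r] has [r] roots with multiplicities, and
   [z] has multiplicity at least [t] when the [t]-th power of its minimal
   polynomial divides. *)
Lemma zeta_recursion r :
  (r * gpol rootsin r = \sum_(i < r) zpts i.+1 * gpol rootsin (r - i.+1))%N.
Proof.
have f0 : (0 < r`!)%N := fact_gt0 r.
have [s0 U0 hs0] := frob_pow_poly f0.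
pose S := [seq z <- s0 | `[<Zs z>]].
have US : uniq S by rewrite filter_uniq.
have hS z : z \in S -> Zs z /\ z ^+ (q ^ r`!) = z.
  by rewrite mem_filter hs0 => /andP[/asboolP h /eqP].
have inS z i : (0 < i)%N -> (i <= r)%N -> Zs z -> z ^+ (q ^ i) = z -> z \in S.
  move=> i0 ir hz e; rewrite mem_filter hs0; apply/andP; split; first exact/asboolP.
  have /dvdnP[m ->] : (i %| r`!)%N by apply: dvdn_fact; rewrite i0.
  by apply/eqP; rewrite mulnC frob_iter.
have zE (i : 'I_r) : zpts i.+1 = (\sum_(z <- S) (z ^+ (q ^ i.+1) == z))%N.
  by apply: zpts_seq => // z; [case/hS|exact: inS].
have mupE (u : 'rV[l]_r) : rootsin (cpol u) ->
    (\sum_(z <- S) mup z (map_poly j (cpol u)) = r)%N.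
  move=> /asboolP hu; have cn := monic_neq0 (cpol_monic u).
  have [s hs] := closed_field_poly_normal (map_poly j (cpol u)).
  have lc : lead_coef (map_poly j (cpol u)) = 1.
    by rewrite lead_coef_map (monicP (cpol_monic u)) rmorph1.
  rewrite lc scale1r in hs.
  have ss : size s = r.
    by have := size_map_poly j (cpol u); rewrite hs size_prod_XsubC size_cpol => -[].
  rewrite -[RHS]ss -(@sum_count_mem S) //.
    by apply: eq_bigr => z _; rewrite hs mu_prod_XsubC.
  move=> z zs; have hz : root (map_poly j (cpol u)) z by rewrite hs root_prod_XsubC.
  have [i [i0 ir e]] := root_finite_orbit cn hz.
  by apply: (inS _ i) => //; [rewrite size_cpol ltnS in ir|exact: hu].
have mup_le (u : 'rV[l]_r) z : z \in S -> rootsin (cpol u) ->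
    (mup z (map_poly j (cpol u)) <= r)%N.
  move=> zS /mupE e; rewrite -[X in (_ <= X)%N]e (bigD1_seq z) //= leq_addr //.
have key z : z \in S ->
    (\sum_(u : 'rV[l]_r | rootsin (cpol u)) mup z (map_poly j (cpol u)) =
     \sum_(i < r) (z ^+ (q ^ i.+1) == z) * gpol rootsin (r - i.+1))%N.
  move=> zS; have [Zz ez] := hS z zS.
  have [d [P [d0 Pm sP hd [P1 hP hPr]]]] := orbit_polynomial f0 ez.
  have hG : rootsin P.
    apply/asboolP => x /hPr[n ->]; elim: n => [|n IH]; first by rewrite expn0 expr1.
    by rewrite expnSr exprM; exact: Zs_frob.
  have hPt t : P ^+ t \is monic by rewrite monic_exp.
  have sPt t : size (P ^+ t) = (d * t).+1 by rewrite -[LHS]prednK ?size_exp ?sP // lt0n size_poly_eq0 monic_neq0.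
  transitivity (\sum_(t < r) \sum_(u : 'rV[l]_r | rootsin (cpol u)) (P ^+ t.+1 %| cpol u)%R)%N.
    rewrite exchange_big /=; apply: eq_bigr => u hu.
    under eq_bigr => t _ do rewrite (dvdp_orbit Pm P1 hP) ?monic_neq0 ?cpol_monic //.
    have := mup_le u z zS hu; move: (mup _ _) => c cr.
    transitivity (\sum_(t < r | (t < c)%N) 1)%N.
      by rewrite (big_ord_narrow cr) sum1_card card_ord.
    by rewrite big_mkcond; apply: eq_bigr => t _; case: ltnP.
  transitivity (\sum_(t < r) \sum_(i < r) (i.+1 == d * t.+1) * gpol rootsin (r - i.+1))%N.
    apply: eq_bigr => t _.
    transitivity (#|[pred u : 'rV[l]_r | rootsin (cpol u) && (P ^+ t.+1 %| cpol u)]|).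
      rewrite -sum1_card [RHS]big_mkcond [LHS]big_mkcond /=; apply: eq_bigr => u _.
      by rewrite inE; case: (rootsin _) => //=; case: (_ %| _).
    have dt0 : (0 < d * t.+1)%N by rewrite muln_gt0 d0.
    case: (leqP (d * t.+1) r) => [le|gt].
      have lt : ((d * t.+1).-1 < r)%N by rewrite prednK.
      rewrite (bigD1 (Ordinal lt)) //= prednK // eqxx mul1n big1 ?addn0; last first.
        by move=> i; rewrite -val_eqE /= => hi; rewrite -[X in _ == X]prednK // eqSS (negbTE hi).
      have := @multiples_count (d * t.+1) (r - d * t.+1) (P ^+ t.+1) (hPt _) (sPt _)
        (rootsinX _ hG).
      by rewrite subnKC.
    rewrite big1 => [|i _]; last first.
      by rewrite [_ == _]ltn_eqF // (leq_ltn_trans (ltn_ord i)).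
    apply: eq_card0 => u; rewrite !inE; apply/negbTE; rewrite negb_and; apply/orP; right.
    apply/negP => /dvdp_leq; rewrite monic_neq0 ?cpol_monic // => /(_ isT).
    by rewrite sPt size_cpol ltnS leqNgt gt.
  rewrite exchange_big /=; apply: eq_bigr => i _; rewrite -big_distrl /=; congr (_ * _)%N.
  rewrite hd; case: (boolP (d %| i.+1)%N) => [/dvdnP[m e]|nd].
    have m0 : (0 < m)%N by case: m e.
    have mr : (m.-1 < r)%N.
      rewrite prednK //; apply: leq_trans (ltn_ord i); rewrite e leq_pmulr //.
    have E (t : nat) : (i.+1 == d * t.+1)%N = (t == m.-1).
      by rewrite e mulnC eqn_pmul2l // -{1}(prednK m0) eqSS eq_sym.
    rewrite (bigD1 (Ordinal mr)) //= E eqxx big1 // => t.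
    by rewrite -val_eqE /= E => /negbTE ->.
  rewrite big1 // => t _; apply/eqP; rewrite eqb0; apply: contraNneq nd => ->.
  exact: dvdn_mulr.
transitivity (\sum_(u : 'rV[l]_r | rootsin (cpol u)) \sum_(z <- S) mup z (map_poly j (cpol u)))%N.
  rewrite (eq_bigr (fun=> r)) => [|u hu]; last exact: mupE.
  by rewrite sum_nat_const mulnC.
rewrite exchange_big /= big_seq (eq_bigr _ key) -big_seq exchange_big /=.
by apply: eq_bigr => i _; rewrite zE big_distrl.
Qed.

End ZetaCount.

(** If [A(t) = exp (\sum_i z_i t^i / i)] and [w(Q t) = A(t) w(t)] then
   [w(t) = exp (\sum_i z_i / (Q^i - 1) t^i / i)]; both exponentials are
   expressed by the recursion that the logarithmic derivative gives. *)
Lemma log_recursion (q : nat) (a w z : nat -> rat) : (1 < q)%N ->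
  a 0%N = 1 -> z 0%N = 0 ->
  (forall r, r%:R * a r = \sum_(i < r.+1) z i * a (r - i)%N) ->
  (forall r, (q ^ r)%:R * w r = \sum_(i < r.+1) a i * w (r - i)%N) ->
  forall r, r%:R * w r = \sum_(i < r.+1) z i / ((q ^ i)%:R - 1) * w (r - i)%N.
Proof.
move=> q1 a0 z0 ha hw n; pose b i := z i / ((q ^ i)%:R - 1).
have qi i : (0 < i)%N -> (q ^ i)%:R - 1 != 0 :> rat.
  by move=> i0; rewrite subr_eq0 pnatr_eq1 -(expn0 q) eqn_exp2l // -lt0n.
have zb i : z i = (q ^ i)%:R * b i - b i.
  case: i => [|i]; first by rewrite /b z0 !mul0r mulr0 subr0.
  by rewrite -{2}[b i.+1]mul1r -mulrBl /b mulrC divfK // qi.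
pose S (f : nat -> rat) : {poly rat} := \poly_(i < n.+1) f i.
have SE f i : (i <= n)%N -> (S f)`_i = f i by move=> h; rewrite coef_poly ltnS h.
have SM f g r : (r <= n)%N -> (S f * S g)`_r = \sum_(i < r.+1) f i * g (r - i)%N.
  move=> h; rewrite coefM; apply: eq_bigr => i _.
  by rewrite !SE ?(leq_trans (leq_subr _ _) h) // (leq_trans _ h) // -ltnS.
(* The functional equation implies [q ^ r * D r = D r] once [D] vanishes below [r]. *)
pose D r := r%:R * w r - (S b * S w)`_r.
have D0 r : (r <= n)%N -> D r = 0.
  elim/ltn_ind: r => r IH rn.
  have e : (q ^ r)%:R * D r = \sum_(i < r.+1) a i * D (r - i)%N.
    have sub (i : 'I_r.+1) : (r - i <= n)%N by exact: leq_trans (leq_subr _ _) rn.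
    have ir (i : 'I_r.+1) : (i <= r)%N by rewrite -ltnS.
    have e1 : \sum_(i < r.+1) a i * (S b * S w)`_(r - i) =
        \sum_(i < r.+1) b i * ((q ^ (r - i))%:R * w (r - i)%N).
      transitivity ((S a * (S b * S w))`_r).
        by rewrite coefM; apply: eq_bigr => i _; rewrite SE // (leq_trans (ir i)).
      rewrite mulrCA coefM; apply: eq_bigr => i _.
      by rewrite SE ?SM ?hw // (leq_trans (ir i)).
    have e2 : \sum_(i < r.+1) i%:R * a i * w (r - i)%N =
        \sum_(i < r.+1) z i * ((q ^ (r - i))%:R * w (r - i)%N).
      transitivity ((S z * S a * S w)`_r).
        rewrite [RHS]coefM; apply: eq_bigr => i _.
        by rewrite ha SM ?SE // (leq_trans (ir i)).
      rewrite -mulrA coefM; apply: eq_bigr => i _.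
      by rewrite SE ?SM ?hw // (leq_trans (ir i)).
    rewrite /D mulrBr mulrCA hw mulr_sumr (SM b w) // mulr_sumr.
    under [RHS]eq_bigr => i _ do rewrite mulrBr.
    rewrite sumrB e1.
    have -> : \sum_(i < r.+1) a i * ((r - i)%:R * w (r - i)%N) =
        \sum_(i < r.+1) r%:R * (a i * w (r - i)%N) - \sum_(i < r.+1) i%:R * a i * w (r - i)%N.
      rewrite -sumrB; apply: eq_bigr => i _; rewrite natrB // mulrBl mulrBr.
      by rewrite mulrCA -mulrA [in X in _ - X]mulrCA.
    rewrite e2 -addrA -opprD -big_split /=; congr (_ - _); apply: eq_bigr => i _.
    rewrite -mulrDl zb subrK.
    have -> : (q ^ r)%:R = (q ^ i)%:R * (q ^ (r - i))%:R :> rat.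
      by rewrite -natrM -expnD subnKC.
    by rewrite mulrACA -mulrA.
  case: r IH rn e => [|r] IH rn e; first by rewrite /D mul0r SM // big_ord1 /b z0 !mul0r subr0.
  apply/eqP; move: e; rewrite big_ord_recl a0 mul1r subn0 big1 ?addr0 => [|i _]; last first.
    rewrite IH ?mulr0 //; first by rewrite /= subSS ltnS leq_subr.
    by rewrite (leq_trans _ rn) // leq_subr.
  move/eqP; rewrite -subr_eq0 -{2}[D r.+1]mul1r -mulrBl mulf_eq0.
  by rewrite (negbTE (qi _ _)).
by have /eqP := D0 n (leqnn n); rewrite /D subr_eq0 SM // => /eqP.
Qed.

(** In the functional equation [w(Q t) = a(t) w(t)] of the series of matrices, [a]
   is the zeta function of the set; solving the equation divides its [i]-th
   logarithmic coefficient by [Q^i - 1]. *)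
Lemma matrix_recursion (l : finFieldType) (W : closedFieldType) (j : {rmorphism l -> W})
    (Zs : W -> Prop) : (forall z, Zs z -> Zs (z ^+ #|l|)) ->
  forall r, r%:R * gratio (rootsin j Zs) r =
  \sum_(i < r) (zpts l Zs i.+1)%:R / ((#|l| ^ i.+1)%:R - 1) * gratio (rootsin j Zs) (r - i.+1)%N.
Proof.
move=> hZ r; pose G := rootsin j Zs.
have G1 : G 1 := rootsin1 j Zs.
have GM := rootsinM j Zs.
pose z i : rat := if i is i'.+1 then (zpts l Zs i'.+1)%:R else 0.
have e := @log_recursion #|l| (fun i => (gpol G i)%:R) (gratio G) z (finNzRing_gt1 l) _ _ _ _ r.
rewrite e ?big_ord_recl ?mul0r ?add0r //.
- rewrite /gpol; apply/eqP; rewrite (eqr_nat _ _ 1%N); apply/eqP.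
  transitivity #|'rV[l]_0|; last by rewrite card_mx mul1n expn0.
  apply: eq_card => u; rewrite inE /cpol expr0 [u]thinmx0 linear0 subr0 G1 //.
- move=> n; rewrite -natrM (zeta_recursion j hZ) natr_sum big_ord_recl mul0r add0r.
  by apply: eq_bigr => i _; rewrite natrM.
- by move=> n; rewrite cyclic_recursion.
Qed.

(** * Residue characters and weights over a finite field *)

Lemma singular_poly_eigenvalue (W : closedFieldType) n (M : 'M[W]_n) (p : {poly W}) :
  p != 0 -> \sum_(i < size p) p`_i *: M ^+ i \notin unitmx ->
  exists2 y, root p y & root (char_poly M) y.
Proof.
case: n M => [|n] M pn; first by rewrite unitmxE det_mx00 unitr1.
have [s hs] := closed_field_poly_normal p.
have -> : \sum_(i < size p) p`_i *: M ^+ i = horner_mx M p.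
  rewrite -[p in RHS]coefK poly_def rmorph_sum /=; apply: eq_bigr => i _.
  by rewrite -mul_polyC rmorphM /= horner_mx_C rmorphXn /= horner_mx_X -mulmxE mul_scalar_mx.
move=> hn; have ln : lead_coef p != 0 by rewrite lead_coef_eq0.
have [y ys hy] : exists2 y, y \in s & M - y%:M \notin unitmx.
  apply: contrapT => hall; case/negP: hn.
  rewrite hs -mul_polyC rmorphM /= horner_mx_C unitmx_mul.
  apply/andP; split; first by rewrite unitmxE det_scalar unitfE expf_neq0.
  rewrite rmorph_prod /=; elim: s hall {hs} => [|y s IH] hall.
    by rewrite big_nil unitmx1.
  rewrite big_cons unitmx_mul rmorphB /= horner_mx_X horner_mx_C; apply/andP; split.
    by apply: contraT => h; case: hall; exists y; rewrite ?mem_head.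
  by apply: IH => -[y' ys' h]; apply: hall; exists y'; rewrite // inE ys' orbT.
exists y; first by rewrite hs rootZ // root_prod_XsubC.
by rewrite -eigenvalue_root_char /eigenvalue /eigenspace kermx_eq0 row_free_unit.
Qed.

Section OverField.
Variables (k : finFieldType) (W : closedFieldType) (iota : {rmorphism k -> W}).
Variables (A : linear_stack k) (K : fieldExtType k).
Implicit Types X Y P : A (Spec K).
Local Notation q := #|k|.

Lemma hom_finite X Y : finite_set [set: hom X Y].
Proof.
have [n [b hb]] := @stack_fin_dim k A K X Y.
pose F (c : {ffun 'I_n -> finvect_type K}) : hom X Y := \sum_(i < n) Oconst (c i : K) *: b i.
apply/finite_seqP; exists [seq F c | c <- enum {ffun 'I_n -> finvect_type K}].
apply/seteqP; split => // f _ /=; have [c ->] := hb f.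
apply/mapP; exists [ffun i => c i tt : K]; first by rewrite mem_enum.
by rewrite /F; apply: eq_bigr => i _; rewrite ffunE -OconstE.
Qed.

Section Scalars.
Variable X : A (Spec K).

Definition scal (a : finvect_type K) : endr X := Oconst (a : K) *: idm X.

Let scal_zmod : zmod_morphism scal.
Proof. by move=> a b; rewrite /scal -scaleNr -scalerDl. Qed.

Let scal_monoid : monoid_morphism scal.
Proof.
split=> [|a b]; first by rewrite /scal scale1r.
by rewrite /scal endrM cmpZl cmpZr cmp1f scalerA.
Qed.

HB.instance Definition _ := GRing.isZmodMorphism.Build _ _ scal scal_zmod.
HB.instance Definition _ := GRing.isMonoidMorphism.Build _ _ scal scal_monoid.

Lemma scalE a (f : endr X) : scal a * f = (Oconst (a : K) *: (f : hom X X) : endr X).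
Proof. by rewrite endrM /scal cmpZl cmp1f. Qed.

Lemma scal_central a (f : endr X) : scal a * f = f * scal a.
Proof. by rewrite !endrM /scal cmpZl cmpZr cmp1f cmpf1. Qed.

Lemma hevalE (p : {poly K}) (x : hom X X) :
  heval p x = \sum_(i < size p) scal p`_i * (x : endr X) ^+ i.
Proof.
rewrite /heval; apply: eq_bigr => i _; rewrite scalE; congr (_ *: _).
by elim: (nat_of_ord i) => //= n ->; rewrite exprS.
Qed.

Lemma heval_wide n (p : {poly K}) (x : endr X) : (size p <= n)%N ->
  heval p (x : hom X X) = \sum_(i < n) scal p`_i * x ^+ i.
Proof.
move=> sp; rewrite hevalE (big_ord_widen n (fun i => scal p`_i * x ^+ i)) //.
rewrite big_mkcond; apply: eq_bigr => i _; case: ltnP => // h.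
by rewrite nth_default // rmorph0 mul0r.
Qed.

Lemma hevalD (u v : {poly K}) (x : endr X) : heval (u + v) (x : hom X X) =
  (heval u (x : hom X X) : endr X) + heval v (x : hom X X).
Proof.
rewrite (@heval_wide (maxn (size u) (size v))); last exact: size_polyD.
rewrite (@heval_wide (maxn (size u) (size v)) u) ?leq_maxl //.
rewrite (@heval_wide (maxn (size u) (size v)) v) ?leq_maxr // -big_split /=.
by apply: eq_bigr => i _; rewrite coefD -mulrDl -rmorphD.
Qed.

Lemma hevalMX (u : {poly K}) (x : endr X) :
  heval (u * 'X) (x : hom X X) = (heval u (x : hom X X) : endr X) * x.
Proof.
rewrite (@heval_wide (size u).+1).
  rewrite big_ord_recl coefMX /= rmorph0 mul0r add0r hevalE mulr_suml.
  by apply: eq_bigr => i _; rewrite coefMX /= -mulrA -exprSr.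
by apply: leq_trans (size_polyMleq _ _) _; rewrite size_polyX addn2.
Qed.

Lemma hevalCM a (u : {poly K}) (x : endr X) :
  heval (a%:P * u) (x : hom X X) = scal a * (heval u (x : hom X X) : endr X).
Proof.
rewrite (@heval_wide (size u)); last by rewrite mul_polyC size_scale_leq.
rewrite hevalE mulr_sumr; apply: eq_bigr => i _.
by rewrite coefCM mulrA -rmorphM.
Qed.

Lemma heval_comm (u : {poly K}) (x : endr X) :
  (heval u (x : hom X X) : endr X) * x = x * (heval u (x : hom X X) : endr X).
Proof.
rewrite hevalE mulr_suml mulr_sumr; apply: eq_bigr => i _.
by rewrite -mulrA -exprSr exprS !mulrA scal_central.
Qed.

Lemma heval0 (x : endr X) : heval (0 : {poly K}) (x : hom X X) = 0.
Proof. by rewrite hevalE size_poly0 big_ord0. Qed.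

Lemma heval1 (x : endr X) : heval (1 : {poly K}) (x : hom X X) = 1 :> endr X.
Proof. by rewrite hevalE size_poly1 big_ord1 coefC /= rmorph1 mul1r. Qed.

Lemma hevalX (x : endr X) : heval ('X : {poly K}) (x : hom X X) = x.
Proof. by rewrite -['X]mul1r hevalMX heval1 mul1r. Qed.

Lemma hevalM (p r : {poly K}) (x : endr X) :
  heval (p * r) (x : hom X X) = (heval p (x : hom X X) : endr X) * heval r (x : hom X X).
Proof.
elim/poly_ind: p => [|p c IH]; first by rewrite mul0r !heval0 mul0r.
rewrite mulrDl -mulrA ['X * r]mulrC mulrA !hevalD !hevalMX IH hevalCM mulrDl.
rewrite -!mulrA heval_comm; congr (_ + _).
by rewrite -[c%:P]mulr1 hevalCM heval1 mulr1.
Qed.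

Lemma hevalXn n (x : endr X) : heval ('X^n : {poly K}) (x : hom X X) = x ^+ n.
Proof.
elim: n => [|n IH]; first by rewrite expr0 heval1.
by rewrite exprS hevalM hevalX IH exprS.
Qed.

Lemma hevalN (u : {poly K}) (x : endr X) :
  heval (- u) (x : hom X X) = - (heval u (x : hom X X) : endr X).
Proof.
by apply: (addIr (heval u (x : hom X X) : endr X)); rewrite -hevalD !addNr heval0.
Qed.

Lemma minpoly_exists (x : hom X X) : exists p : {poly K}, is_minpoly p x.
Proof.
have [n n0 hn] := finite_idempotent_power (x : endr X) (hom_finite X X).
pose good m := `[< exists p : {poly K}, [/\ p \is monic, heval p x = 0 & size p = m] >].
have ex : exists m, good m.
  exists (n + n).+1; apply/asboolP; exists ('X^(n + n) - 'X^n).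
  have lt : (size (- 'X^n : {poly K})%R < size ('X^(n + n) : {poly K})%R)%N.
    by rewrite size_polyN !size_polyXn ltnS -{1}[n]addn0 ltn_add2l.
  split; first by rewrite monicE lead_coefDl // lead_coefXn.
    by rewrite hevalD hevalN !hevalXn exprD hn subrr.
  by rewrite size_polyDl // size_polyXn.
case: (ex_minnP ex) => m /asboolP[p [pm p0 sp]] hmin.
exists p; split=> // r rm r0; rewrite sp; apply: hmin.
by apply/asboolP; exists r.
Qed.

(** If [f] were invertible at [x], the cofactor [g] would already vanish there. *)
Lemma minpoly_factor (x : hom X X) (p f g : {poly K}) : is_minpoly p x ->
  p = f * g -> f \is monic -> (1 < size f)%N -> ~ is_iso (heval f x).
Proof.
move=> [pm p0 pmin] e fm sf fi.
have gm : g \is monic by move: pm; rewrite e monicMl.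
have g0 : heval g x = 0.
  apply: (iso_mono fi); rewrite cmpf0 -p0 e.
  by have := hevalM f g x; rewrite endrM => ->.
have := pmin g gm g0; rewrite e size_monicM ?monic_neq0 // leqNgt.
by case/negP; rewrite -[X in (X < _)%N]add0n -subn1 -addnBAC ?(ltnW sf) // ltn_add2r subn_gt0.
Qed.

End Scalars.

Variable j : {rmorphism K -> W}.
Hypothesis j_iota : forall c : k, j c%:A = iota c.

Definition character X (chi : hom X X -> W) :=
  [/\ forall f g, chi (f + g) = chi f + chi g,
      forall f g, chi (g \c f) = chi g * chi f,
      chi (idm X) = 1 &
      forall a f, chi (Oconst a *: f) = j a * chi f].

Lemma residue_exists P : indecomposable P -> exists (chi : hom P P -> W) (e : nat),
  [/\ (0 < e)%N, character chi, forall f : endr P, chi f = 0 <-> nilp f &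
      forall z, (exists f, chi f = z) <-> z ^+ (q ^ (fdim K * e)) = z].
Proof.
move=> hP.
have [rho [e [e0 [rD rM r1 rc] rn rz]]] :=
  @residue_character (endr P) (hom_finite P P) (indec_nz hP)
    (indec_local (@stack_karoubian k A K) hom_finite hP) (finvect_type K) (@scal P)
    W j.
exists rho, e; split=> //.
  split=> //; first by move=> f g; rewrite -[RHS]rM.
  move=> a f; have := rM (scal P a) (f : endr P).
  by rewrite scalE rc.
by move=> z; rewrite rz card_fext expnM.
Qed.

Section Weights.
Variable Z : subvariety k.
Local Notation Zs := (Zpoints Z iota).

Lemma Zpoints_frob z : Zs z -> Zs (z ^+ q).
Proof.
have [g hg] := frob_rmorphism iota 1; rewrite expn1 in hg.
have e (p : {poly k}) : root (map_poly iota p) (z ^+ q) = root (map_poly iota p) z.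
  have -> : map_poly iota p = map_poly g (map_poly iota p).
    by apply/polyP => m; rewrite !coef_map /= hg -rmorphXn expf_card.
  rewrite -hg [LHS]rootE horner_map fmorph_eq0 -rootE; congr (root _ _).
  by apply/polyP => m; rewrite !coef_map /= hg -rmorphXn expf_card.
by move=> [h1 [p p1 p2]]; split=> [r /h1|]; [rewrite e|exists p; rewrite ?e].
Qed.

Lemma Zpoints_frobX n z : Zs z -> Zs (z ^+ (q ^ n)).
Proof.
move=> h; elim: n => [|n IH]; first by rewrite expn0 expr1.
by rewrite expnSr exprM; exact: Zpoints_frob.
Qed.

Variables (N : nat) (E : 'I_N -> A (Spec K)).
Hypothesis E_indec : forall s, indecomposable (E s).
Hypothesis E_inj : forall s t, isomorphic (E s) (E t) -> s = t.
Variable rho : forall s, hom (E s) (E s) -> W.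
Hypothesis rho_char : forall s, character (@rho s).
Hypothesis rho0 : forall s (f : endr (E s)), rho f = 0 <-> nilp f.

Let rhoD s f g : rho (f + g) = rho (s := s) f + rho g.
Proof. by case: (rho_char s) => h *; exact: h. Qed.
Let rhoM s f g : rho (f \c g) = rho (s := s) f * rho g.
Proof. by case: (rho_char s) => _ h *; exact: h. Qed.
Let rho1 s : rho (idm (E s)) = 1.
Proof. by case: (rho_char s) => _ _ h _; exact: h. Qed.
Let rhoZ s a f : rho (Oconst a *: f) = j a * rho (s := s) f.
Proof. by case: (rho_char s) => _ _ _ h; exact: h. Qed.

Let kar := @stack_karoubian k A K.

Variables (I : finType) (lab : I -> 'I_N) (X : A (Spec K)) (D : dsum (E \o lab) X).
Local Notation B := (block rho D D).

Let BD s f g : B s (f + g) = B s f + B s g.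
Proof. exact: blockD. Qed.
Let BM s f g : B s (f \c g) = B s f *m B s g.
Proof. exact: (blockM kar hom_finite E_indec E_inj rhoD rhoM rho0). Qed.
Let B1 s : B s (idm X) = 1%:M.
Proof. exact: (block1 rhoD rho1). Qed.

Let B_scal s a : B s (scal X a) = (j a)%:M.
Proof.
apply/matrixP => y x; rewrite !mxE /phi /scal cmpZr cmpf1 cmpZl.
case: (eqVneq y x) => [->|ne].
  by rewrite dprj_inj resid_diag rhoZ rho1 mulr1.
by rewrite dprj_inj0 ?(inj_eq enum_val_inj) // scaler0 (resid0 rhoD).
Qed.

Let BX s n (x : endr X) : B s (x ^+ n) = (B s x) ^+ n.
Proof. by elim: n => [|n IH]; rewrite ?B1 // !exprS BM IH. Qed.

Let B_heval s (p : {poly K}) (x : hom X X) :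
  B s (heval p x) = \sum_(i < size p) j p`_i *: (B s x) ^+ i.
Proof.
rewrite hevalE.
have -> (n : nat) (F : 'I_n -> endr X) : B s (\sum_i F i) = \sum_i B s (F i).
  elim/big_rec2: _ => [|i y1 y2 _ <-]; last exact: BD.
  by apply: (addrI (B s 0)); rewrite -BD !addr0.
by apply: eq_bigr => i _; rewrite BM B_scal BX mul_scalar_mx.
Qed.

(** The blocks represent [End X] faithfully up to nilpotents. An eigenvalue of a
   block is a root of the minimal polynomial. Conversely, the irreducible factor
   of the minimal polynomial at a root [z] is not invertible at [x], so one of
   its roots is an eigenvalue of a block; that root is a Frobenius conjugate of
   [z], and [Z] is stable under Frobenius. *)
Lemma EndZ_blocks (x : hom X X) :
  EndZ iota Z x <-> forall s z, root (char_poly (B s x)) z -> Zs z.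
Proof.
split=> [[p [pm p0 _] hp] s z|hB].
  rewrite -eigenvalue_root_char => /eigenvalueP[v hv vn].
  apply: (hp j j_iota).
  have vX n : v *m (B s x) ^+ n = z ^+ n *: v.
    elim: n => [|n IH]; first by rewrite mulmx1 scale1r.
    by rewrite exprSr mulmxA IH -scalemxAl hv scalerA exprSr.
  have : v *m B s (heval p x) = (map_poly j p).[z] *: v.
    rewrite B_heval mulmx_sumr horner_coef size_map_poly scaler_suml.
    by apply: eq_bigr => i _; rewrite -scalemxAr vX scalerA coef_map.
  rewrite p0 (_ : B s 0 = 0) ?mulmx0; last first.
    by apply: (addrI (B s 0)); rewrite -BD !addr0.
  by move/esym/eqP; rewrite scaler_eq0 (negbTE vn) orbF.
have [p hp] := minpoly_exists x; exists p => // j' j'_iota z hz.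
have pm : p \is monic by case: hp.
have [i [i0 _ zi]] := @root_finite_orbit (finvect_type K) W j' p z (monic_neq0 pm) hz.
have [d [P [d0 Pm sP _ [_ Pdvd Porb]]]] := @orbit_polynomial (finvect_type K) W j' z i i0 zi.
have /dvdpP[g eg] := Pdvd p hz.
have Pniso : ~ is_iso (heval (P : {poly K}) x).
  by apply: (minpoly_factor (g := g) hp); rewrite ?sP // eg mulrC.
have [s hs] : exists s, B s (heval (P : {poly K}) x) \notin unitmx.
  apply: contrapT => hn; apply: Pniso.
  apply/(block_iso kar hom_finite E_indec E_inj rhoD rhoM rho1 rho0 D) => s.
  by apply: contraT => h; case: hn; exists s.
have [y hy1 hy2] : exists2 y, root (map_poly j P) y & root (char_poly (B s x)) y.
  apply: singular_poly_eigenvalue; first by rewrite map_poly_eq0 monic_neq0.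
  move: hs; rewrite B_heval size_map_poly.
  by under eq_bigr => n _ do rewrite -coef_map.
have Zy := hB s y hy2.
have [n hn] : exists n : 'I_(fdim K), forall u, j' u = j (u ^+ (q ^ (1 * n))).
  apply: embeddings_conjugate; rewrite ?fdim_gt0 ?mul1n // => u.
  rewrite expn1 => /(@finField_fixed_image k K (GRing.in_alg K))[c ->].
  by rewrite /= j_iota j'_iota.
rewrite mul1n in hn.
have [Fr hFr] := frob_rmorphism iota n.
have [m hm] : exists m, Fr y = z ^+ (#|finvect_type K| ^ m).
  apply: Porb; have -> : map_poly j' P = map_poly Fr (map_poly j P).
    by apply/polyP => t; rewrite !coef_map /= hn hFr rmorphXn.
  by rewrite rootE horner_map (rootP hy1) rmorph0.
have -> : z = (Fr y) ^+ (#|finvect_type K| ^ (i * m - m)).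
  rewrite hm -exprM -expnD subnKC ?leq_pmull //.
  by rewrite (@frob_iter (finvect_type K)).
rewrite hFr card_fext -expnM -exprM -expnD; exact: Zpoints_frobX.
Qed.

(** ** Counting endomorphisms by their residues *)

Variables (l : 'I_N -> finFieldType) (jl : forall s, {rmorphism l s -> W}).
Hypothesis l_image : forall s z, (exists f, rho (s := s) f = z) <-> exists u, z = jl s u.
Local Notation r := (fun s => #|[pred a | lab a == s]|).

Let resid_image s t (f : hom (E s) (E t)) : s = t -> exists u, resid rho f = jl s u.
Proof. by move=> e; subst t; rewrite resid_diag; apply/l_image; exists f. Qed.

Let lift_block s (x : hom X X) : exists M : 'M[l s]_(r s), map_mx (jl s) M = B s x.
Proof.
have h (y z : 'I_(r s)) : exists u, B s x y z = jl s u.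
  rewrite mxE /phi.
  have /eqP ey : lab (enum_val y) == s by have := enum_valP y.
  have /eqP ez : lab (enum_val z) == s by have := enum_valP z.
  have [u ->] := @resid_image _ _ (dprj D (enum_val y) \c x \c dinj D (enum_val z) :
     hom (E (lab (enum_val z))) (E (lab (enum_val y)))) (etrans ez (esym ey)).
  by move: u; rewrite ez => u; exists u.
have h2 y : exists f, forall z, B s x y z = jl s (f z) by have [f hf] := choice (h y); exists f.
have [M hM] := choice h2.
by exists (\matrix_(y, z) M y z); apply/matrixP => y z; rewrite hM !mxE.
Qed.

Let lifted x s := sval (cid (lift_block s x)).
Let liftedE x s : map_mx (jl s) (lifted x s) = B s x := svalP (cid (lift_block s x)).

Let lift_surj (M : forall s, 'M[l s]_(r s)) :
  exists x : hom X X, forall s, lifted x s = M s.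
Proof.
have mem a : a \in [pred a' | lab a' == lab a] by rewrite inE.
pose c b a : W := jl (lab b) (M (lab b) (enum_rank_in (mem b) b) (enum_rank_in (mem b) a)).
have hf (ba : I * I) : exists f : hom (E (lab ba.2)) (E (lab ba.1)),
    lab ba.2 = lab ba.1 -> resid rho f = c ba.1 ba.2.
  case: ba => b a /=; case: (eqVneq (lab a) (lab b)) => [e|ne]; last first.
    by exists 0 => e; rewrite e eqxx in ne.
  have [f hf] := resid_surj e ((l_image (lab b) (c b a)).2 (ex_intro _ _ erefl)).
  by exists f.
pose f b a := sval (cid (hf (b, a))).
have hf' b a : lab a = lab b -> resid rho (f b a) = c b a := svalP (cid (hf (b, a))).
pose x := \sum_b \sum_a dinj D b \c f b a \c dprj D a.
exists x => s; apply: (map_mx_inj (f := jl s)); rewrite liftedE.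
apply/matrixP => y z; rewrite !mxE /phi.
have xE b a : dprj D b \c x \c dinj D a = f b a.
  rewrite /x cmp_sumr cmp_suml (bigD1 b) //= [X in _ + X]big1 ?addr0 => [|b' bb']; last first.
    have bb : b != b' by rewrite eq_sym.
    rewrite cmp_sumr cmp_suml big1 // => a' _.
    by rewrite !cmpA dprj_inj0 // !cmp0f.
  rewrite cmp_sumr cmp_suml (bigD1 a) //= [X in _ + X]big1 ?addr0 => [|a' aa']; last first.
    by rewrite -!cmpA dprj_inj0 // !cmpf0.
  by rewrite !cmpA dprj_inj cmp1f -cmpA dprj_inj cmpf1.
have cE t b a (y' z' : 'I_(r t)) : lab b = t -> b = enum_val y' -> a = enum_val z' ->
    c b a = jl t (M t y' z').
  move=> eb; subst t => ey ez; rewrite /c; congr (jl _ (M _ _ _)); apply: enum_val_inj.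
    by rewrite enum_rankK_in.
  rewrite enum_rankK_in //; have := enum_valP z'.
  by rewrite -ez.
have /eqP eb : lab (enum_val y) == s by have := enum_valP y.
have /eqP ea : lab (enum_val z) == s by have := enum_valP z.
rewrite -(cE s (enum_val y) (enum_val z)) // -hf' ?ea //; congr resid.
exact: xE.
Qed.

Let lifted_eq (x y : hom X X) :
  (forall s, lifted x s = lifted y s) <-> (forall s, B s x = B s y).
Proof.
split=> h s; first by rewrite -!liftedE h.
by apply: (map_mx_inj (f := jl s)); rewrite !liftedE.
Qed.

Let T := finT (hom_finite X X).

Let fibre (x : hom X X) :
  #|[pred y : T | `[<forall s, lifted y s = lifted x s>]]| =
  #|[pred y : T | `[<forall s, lifted y s = lifted 0 s>]]|.
Proof.
pose f (y : T) : T := (y : hom X X) + x; pose f' (y : T) : T := (y : hom X X) - x.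
rewrite -!sum1_card (reindex f); last first.
  apply: onW_bij; exists f' => y; rewrite /f /f'.
    by rewrite [LHS]addrK.
  by rewrite [LHS]subrK.
apply: eq_bigl => y; rewrite !inE; apply: asbool_equiv_eq; rewrite !lifted_eq.
have B0 s : B s 0 = 0 by apply: (addrI (B s 0)); rewrite -BD !addr0.
split=> h s; have := h s; rewrite BD B0; last by move=> ->; rewrite add0r.
by rewrite -[RHS]add0r => /addIr.
Qed.

Let residue_count (G : forall s, pred 'M[l s]_(r s)) (S : set (hom X X)) :
  (forall x, S x <-> forall s, G s (lifted x s)) ->
  cardset S = ((\prod_s #|G s|) * #|[pred y : T | `[<forall s, lifted y s = lifted 0 s>]]|)%N.
Proof.
move=> hS; rewrite (cardsetE (hom_finite X X)) -sum1_card.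
pose p (x : T) : {dffun forall s, 'M[l s]_(r s)} := finfun (lifted x).
pose fam : simpl_pred {dffun forall s, 'M[l s]_(r s)} := family G.
rewrite (partition_big p (fun M => M \in fam)) /=; last first.
  move=> x; rewrite inE => h0; have h := (hS x).1 h0; apply/familyP => s.
  by rewrite ffunE; exact: h.
transitivity (\sum_(M in fam) #|[pred y : T | `[<forall s, lifted y s = lifted 0 s>]]|)%N.
  apply: eq_bigr => M /familyP hM.
  have [x hx] := lift_surj M.
  rewrite -(fibre x) -sum1_card; apply: eq_bigl => y; rewrite !inE.
  apply/andP/asboolP => [[_ /eqP e] s|h]; first by rewrite hx -e ffunE.
  split; first by apply/asboolP; apply: (hS y).2 => s; rewrite h hx; exact: hM.
  by apply/eqP/ffunP => s; rewrite ffunE h hx.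
rewrite sum_nat_const; congr (_ * _)%N.
by rewrite /fam card_family foldrE big_map big_enum.
Qed.

(** Up to nilpotents, [End X] is the product over the indecomposables of the
   matrix algebras over their residue fields. *)
Lemma weight_formula :
  (cardset (EndZ iota Z (X := X)))%:R / (cardset (Aut (X := X)))%:R =
  \prod_s gratio (rootsin (jl s) Zs) #|[pred a | lab a == s]|.
Proof.
pose GZ s : pred 'M[l s]_(r s) := fun M => rootsin (jl s) Zs (char_poly M).
pose GA s : pred 'M[l s]_(r s) := fun M => M \in unitmx.
have hZ (x : hom X X) : EndZ iota Z x <-> forall s, GZ s (lifted x s).
  rewrite EndZ_blocks; split=> h s; last first.
    by move=> z hz; have /asboolP := h s; apply; rewrite map_char_poly liftedE.
  by apply/asboolP => z; rewrite map_char_poly liftedE; exact: h.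
have hA (x : hom X X) : Aut x <-> forall s, GA s (lifted x s).
  rewrite /Aut /= -(block_iso kar hom_finite E_indec E_inj rhoD rhoM rho1 rho0 D).
  by split=> h s; have := h s; rewrite -liftedE map_unitmx.
rewrite (residue_count hZ) (residue_count hA) !natrM.
have k0 : (#|[pred y : T | `[<forall s, lifted y s = lifted 0 s>]]|)%:R != 0 :> rat.
  rewrite pnatr_eq0 -lt0n; apply/card_gt0P; exists (0 : hom X X).
  by rewrite inE.
rewrite -mulf_div divff // mulr1 !natr_prod -prodf_div; apply: eq_bigr => s _.
by rewrite /gratio /gmat /glin.
Qed.

End Weights.
End OverField.

(** * The logarithmic derivative of the series of objects *)

Section MultiplicityCount.
Variables (m N B : nat) (c : 'I_N -> 'rV[int]_m) (w b : 'I_N -> nat -> rat).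
Hypothesis w_rec : forall s r,
  r%:R * w s r = \sum_(i < r) b s i.+1 * w s (r - i.+1)%N.

Definition mwt (r : {ffun 'I_N -> 'I_B.+1}) : 'rV[int]_m := \sum_s c s *+ r s.

Definition mcount (d : 'rV[int]_m) : rat :=
  \sum_(r : {ffun 'I_N -> 'I_B.+1} | mwt r == d) \prod_s w s (r s).

(** If each [w s] has logarithmic derivative [b s], the product of the series
   [\sum_r w s r t^(r c_s)] has the sum of theirs; [B] is a bound on the
   exponents in degree [d]. *)
Lemma mcount_recursion (d : 'rV[int]_m) (i : 'I_m) :
  (forall r : 'I_N -> nat, \sum_s c s *+ r s = d -> forall s, (r s <= B)%N) ->
  (d 0 i)%:~R * mcount d =
  \sum_s \sum_(t < B.+1) (c s 0 i)%:~R * b s t.+1 * mcount (d - c s *+ t.+1).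
Proof.
move=> hB; rewrite /mcount mulr_sumr.
transitivity (\sum_(r : {ffun 'I_N -> 'I_B.+1} | mwt r == d)
   \sum_s \sum_(t < B.+1 | (t < r s)%N) (c s 0 i)%:~R * b s t.+1 *
     (w s (r s - t.+1)%N * \prod_(s' | s' != s) w s' (r s'))).
  apply: eq_bigr => r /eqP <-.
  have -> : (mwt r 0 i)%:~R = \sum_s (c s 0 i)%:~R * (r s)%:R :> rat.
    rewrite /mwt summxE rmorph_sum /=; apply: eq_bigr => s _.
    have -> : (c s *+ r s) 0 i = c s 0 i *+ r s by rewrite mulmxnE.
    by rewrite raddfMn /= mulr_natr.
  rewrite mulr_suml; apply: eq_bigr => s _.
  rewrite (bigD1 s) //= -mulrA [(r s)%:R * _]mulrA w_rec.
  have le : (r s <= B.+1)%N by exact: ltnW.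
  rewrite (big_ord_narrow le) mulr_suml mulr_sumr; apply: eq_bigr => t _ /=.
  by rewrite !mulrA.
rewrite exchange_big /=; apply: eq_bigr => s _.
rewrite (exchange_big_dep predT) //=; apply: eq_bigr => t _.
rewrite mulr_sumr.
pose up (r : {ffun 'I_N -> 'I_B.+1}) : {ffun 'I_N -> 'I_B.+1} :=
  [ffun s' => inord (r s' + (s' == s) * t.+1)].
pose dn (r : {ffun 'I_N -> 'I_B.+1}) : {ffun 'I_N -> 'I_B.+1} :=
  [ffun s' => inord (r s' - (s' == s) * t.+1)].
have dnE (r : {ffun 'I_N -> 'I_B.+1}) s' : dn r s' = (r s' - (s' == s) * t.+1)%N :> nat.
  by rewrite ffunE inordK // ltnS (leq_trans (leq_subr _ _)) // -ltnS.
have upE (r : {ffun 'I_N -> 'I_B.+1}) s' : (r s' + (s' == s) * t.+1 <= B)%N -> up r s' = (r s' + (s' == s) * t.+1)%N :> nat.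
  by move=> h; rewrite ffunE inordK.
have wtE (r r' : {ffun 'I_N -> 'I_B.+1}) :
    (forall s', r s' = (r' s' + (s' == s) * t.+1)%N :> nat) -> mwt r = mwt r' + c s *+ t.+1.
  move=> h; rewrite /mwt; under eq_bigr => s' _ do rewrite h mulrnDr.
  rewrite big_split /=; congr (_ + _); rewrite (bigD1 s) //= eqxx mul1n big1 ?addr0 //.
  by move=> s' /negbTE ->; rewrite mul0n mulr0n.
rewrite (reindex_onto up dn) /=; last first.
  move=> r /andP[_ tr]; apply/ffunP => s'; apply/val_inj.
  have e : (dn r s' + (s' == s) * t.+1 = r s')%N.
    rewrite dnE subnK //; case: eqP => [->|_]; last by rewrite mul0n.
    by rewrite mul1n.
  by apply: (etrans _ e); apply: upE; rewrite e -ltnS.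
apply: eq_big => [r|r /andP[/andP[_ tr] /eqP er]].
  apply/andP/eqP => [[/andP[/eqP <- tr] /eqP er]|e].
    rewrite (wtE (up r) r) ?addrK // => s'; rewrite -{2}er dnE subnK //.
    by case: eqP => [->|_]; rewrite ?mul1n ?mul0n.
  have ub s' : (r s' + (s' == s) * t.+1 <= B)%N.
    apply: (hB (fun s' => (r s' + (s' == s) * t.+1)%N)).
    under eq_bigr => s'' _ do rewrite mulrnDr.
    rewrite big_split /= -[X in X + _]/(mwt r) e (bigD1 s) //= eqxx mul1n big1 ?addr0 ?subrK //.
    by move=> s'' /negbTE ->; rewrite mul0n mulr0n.
  split; last first.
    by apply/eqP/ffunP => s'; apply/val_inj; rewrite [LHS]dnE upE // addnK.
  rewrite (wtE (up r) r) => [|s']; last exact: upE.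
  by rewrite e subrK eqxx upE // eqxx mul1n addnS ltnS leq_addl.
have ur s' : up r s' = (r s' + (s' == s) * t.+1)%N :> nat.
  rewrite -{2}er dnE subnK //.
  by case: eqP => [->|_]; rewrite ?mul1n ?mul0n.
rewrite [in RHS](bigD1 s) //= -!mulrA; congr (_ * (_ * (_ * _))).
  by rewrite ur eqxx mul1n addnK.
by apply: eq_bigr => s' /negbTE ns; rewrite ur ns mul0n addn0.
Qed.

End MultiplicityCount.

Section ClassSum.
Variables (k : finFieldType) (W : closedFieldType) (iota : {rmorphism k -> W}).
Variables (F : posn -> fieldExtType k) (degF : forall n : posn, \dim {: F n} = val n).
Variables (A : linear_stack k) (K : fieldExtType k).
Variables (j : {rmorphism K -> W}) (j_iota : forall c : k, j c%:A = iota c).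
Variables (m : nat) (cl : A (Spec K) -> 'rV[int]_m).
Hypothesis cl_add : additive_on_sums cl.
Hypothesis cl_fin : forall d, finite_set [set iso_class X | X in [set X | cl X = d]].
Variable Cn : 'rV[int]_m -> Prop.
Hypothesis Cn0 : Cn 0.
Hypothesis CnD : forall x y, Cn x -> Cn y -> Cn (x + y).
Hypothesis Cn_pointed : forall x, Cn x -> Cn (- x) -> x = 0.
Hypothesis Cn_fin : forall d, finite_set [set e | Cn e /\ Cn (d - e)].
Hypothesis cl_Cn : forall X, Cn (cl X).
Local Notation q := #|k|.
Local Notation C := (A (Spec K)).
Let kar := @stack_karoubian k A K.
Let add := @stack_additive k A K.

(** The residue field of the local ring [End P] is realized as the subfield of
   [W] of degree [e] over [K], with [chi] as reduction map. *)
Definition residue_data (P : C) (e : nat) (chi : hom P P -> W) :=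
  [/\ (0 < e)%N, character j chi, forall f : endr P, chi f = 0 <-> nilp f &
      forall z, (exists f, chi f = z) <-> z ^+ (q ^ (fdim K * e)) = z].

Lemma CnMn x n : Cn x -> Cn (x *+ n).
Proof. by move=> h; elim: n => [|n IH]; rewrite ?mulr0n // mulrS; exact: CnD. Qed.

Lemma Cn_sum (I : finType) (P : pred I) (x : I -> 'rV[int]_m) :
  (forall a, Cn (x a)) -> Cn (\sum_(a | P a) x a).
Proof. by move=> h; elim/big_ind: _ => // *; exact: CnD. Qed.

Lemma intvec_torsionfree (x : 'rV[int]_m) n : (0 < n)%N -> x *+ n = 0 -> x = 0.
Proof.
move=> n0 /rowP h; apply/rowP => i; have := h i; rewrite mulmxnE !mxE => /eqP.
by rewrite mulrn_eq0 eqn0Ngt n0 => /eqP.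
Qed.

(** Otherwise the powers of [P] would be infinitely many objects of class [0]. *)
Lemma indec_class_nz (P : C) : indecomposable P -> cl P <> 0.
Proof.
move=> hP P0; have [chi [e [_ [hD hM h1 _] hn _]]] := residue_exists j hP.
pose E (s : 'I_1) : C := P.
have hE s : indecomposable (E s) := hP.
have Einj s t : isomorphic (E s) (E t) -> s = t by rewrite !ord1.
have [X hX] := choice (fun n => @dsum_exists _ C n (fun=> P) add).
have cX n : cl (X n) = 0.
  by have [_ /(_ _ _ cl_add) ->] := hX n; rewrite P0 big1.
have Xinj : injective (fun n => iso_class (X n)).
  move=> n n' /iso_class_eq hi; have [[D] _] := hX n; have [[D'] _] := hX n'.
  have := @multiplicity_eq _ C kar (@hom_finite k A K) W 1 E hE Einj (fun=> chi)
    (fun s => hD) (fun s f g => hM g f) (fun s => h1) (fun s => hn) _ _ (fun=> ord0) (fun=> ord0)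
    _ _ D D' ord0 hi.
  have card_all n0 : #|[pred a : 'I_n0 | (fun=> ord0 : 'I_1) a == ord0]| = n0.
    by rewrite (eq_card (B := predT)) ?card_ord.
  by rewrite !card_all.
have [s hs] := (finite_seqP _).1 (cl_fin 0).
have := uniq_leq_size (s1 := [seq iso_class (X n) | n <- seq.iota 0 (size s).+1]) (s2 := s).
rewrite (map_inj_uniq Xinj) iota_uniq size_map size_iota ltnn => h.
suff : false by []; apply: h => // c /mapP[n _ ->].
have : [set iso_class X0 | X0 in [set X0 | cl X0 = 0]] (iso_class (X n)) by exists (X n) => //=.
by rewrite hs.
Qed.

Lemma indec_reps d : exists (N : nat) (E : 'I_N -> C),
  [/\ forall s, indecomposable (E s) /\ Cn (d - cl (E s)),
      forall s t, isomorphic (E s) (E t) -> s = t &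
      forall P, indecomposable P -> Cn (d - cl P) -> exists s, isomorphic P (E s)].
Proof.
pose S : set (set C) := [set iso_class P | P in [set P | indecomposable P /\ Cn (d - cl P)]].
have Sfin : finite_set S.
  apply: (@sub_finite_set _ _ (\bigcup_(e in [set e | Cn e /\ Cn (d - e)])
      [set iso_class X | X in [set X | cl X = e]])); last first.
    by apply: bigcup_finite.
  by move=> c [P [hP hc] <-]; exists (cl P) => //=; exists P.
have [s0 hs0] := (finite_seqP _).1 Sfin.
pose s := undup s0; have sU : uniq s := undup_uniq s0.
have hs c : c \in s <-> S c by rewrite mem_undup hs0.
have rep c : exists P, c \in s -> [/\ indecomposable P, Cn (d - cl P) & iso_class P = c].
  case: (pselect (c \in s)) => [/hs[P [h1 h2] h3]|h]; first by exists P.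
  by have [[X _] _] := add; exists X.
have [R hR] := choice rep.
pose E (i : 'I_(size s)) := R (nth set0 s i).
have hE i : [/\ indecomposable (E i), Cn (d - cl (E i)) & iso_class (E i) = nth set0 s i].
  by apply: hR; rewrite mem_nth.
exists (size s), E; split.
- by move=> i; have [] := hE i.
- move=> i i' /iso_class_eq; have [_ _ ->] := hE i; have [_ _ ->] := hE i'.
  by move/eqP; rewrite nth_uniq // => /eqP/val_inj.
- move=> P hP hd; have hc : iso_class P \in s by apply/hs; exists P.
  have hi : (index (iso_class P) s < size s)%N by rewrite index_mem.
  exists (Ordinal hi); apply/iso_class_eq; have [_ _ ->] := hE (Ordinal hi).
  by rewrite /= nth_index.
Qed.

Section WithReps.
Variables (Z : subvariety k) (d : 'rV[int]_m) (N : nat) (E : 'I_N -> C).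
Hypothesis E_indec : forall s, indecomposable (E s).
Hypothesis E_inj : forall s t, isomorphic (E s) (E t) -> s = t.
Hypothesis E_compl : forall P, indecomposable P -> Cn (d - cl P) -> exists s, isomorphic P (E s).
Variables (rho : forall s, hom (E s) (E s) -> W) (e : 'I_N -> nat).
Hypothesis rhoP : forall s, residue_data (e s) (@rho s).
Local Notation Zs := (Zpoints Z iota).
Local Notation H d' := (Hcoef iota cl d' Z).

(** Points of [Z] over the extension of [k] of degree [n]. *)
Definition zfix n := cardset [set z : W | Zs z /\ z ^+ (q ^ n) = z].

Let rho_char s : character j (@rho s). Proof. by case: (rhoP s). Qed.
Let rho0 s (f : endr (E s)) : rho f = 0 <-> nilp f. Proof. by case: (rhoP s) => _ _ h _; exact: h. Qed.
Let rhoD s f g : rho (f + g) = rho (s := s) f + rho g.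
Proof. by case: (rho_char s) => h *; exact: h. Qed.
Let rhoM s f g : rho (f \c g) = rho (s := s) f * rho g.
Proof. by case: (rho_char s) => _ h *; exact: h. Qed.
Let rho1 s : rho (idm (E s)) = 1.
Proof. by case: (rho_char s) => _ _ h _; exact: h. Qed.

Let deg_pos s : (0 < fdim K * e s)%N.
Proof. by rewrite muln_gt0 fdim_gt0; case: (rhoP s). Qed.

Let Fs s := F (exist _ (fdim K * e s)%N (deg_pos s)).
Let l s : finFieldType := finvect_type (Fs s).
Let jl s : {rmorphism l s -> W} := sval (cid (@embed_closed k (Fs s) W iota)).

Let fdimF s : fdim (Fs s) = (fdim K * e s)%N. Proof. exact: degF. Qed.
Let card_l s : #|l s| = (q ^ (fdim K * e s))%N. Proof. by rewrite card_fext fdimF. Qed.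

Let l_image s z : (exists f, rho (s := s) f = z) <-> exists u, z = jl s u.
Proof.
have [_ _ _ ->] := rhoP s; split => [hz|[u ->]].
  by apply: finField_fixed_image; rewrite card_l.
by rewrite -card_l -rmorphXn expf_card.
Qed.

Local Notation w := (fun s => gratio (rootsin (jl s) Zs)).

Let obj_of (r : 'I_N -> nat) : exists X : C,
  inhabited (dsum (E \o (fun x : {s : 'I_N & 'I_(r s)} => tag x)) X) /\
  cl X = \sum_s cl (E s) *+ r s.
Proof.
have [X [D hX]] := dsum_exists_fin (E \o (fun x : {s : 'I_N & 'I_(r s)} => tag x)) add.
exists X; split=> //; rewrite (hX _ _ cl_add).
rewrite -(sig_big_dep (fun=> true) (fun _ _ => true) (fun s _ => cl (E s))) /=.
by apply: eq_bigr => s _; rewrite sumr_const card_ord.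
Qed.

Let tag_card (r : 'I_N -> nat) s :
  #|[pred x : {s : 'I_N & 'I_(r s)} | tag x == s]| = r s.
Proof.
rewrite -sum1_card.
transitivity (\sum_(s' | s' == s) \sum_(x : 'I_(r s')) 1)%N.
  rewrite (sig_big_dep (fun s' => s' == s) (fun _ _ => true) (fun _ _ => 1%N)) /=.
  by apply: eq_bigl => x; rewrite andbT.
by rewrite big_pred1_eq sum1_card card_ord.
Qed.

Let decompose (X : C) : Cn (d - cl X) -> exists (I : finType) (lab : I -> 'I_N),
  inhabited (dsum (E \o lab) X).
Proof.
move=> hX; have [I [P [hP [D]]]] := decomposition (@hom_finite k A K) X.
have clX := additive_dsum add cl_add D.
have hs a : exists s, isomorphic (P a) (E s).
  apply: E_compl => //.
  have -> : d - cl (P a) = (d - cl X) + \sum_(b | b != a) cl (P b).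
    by rewrite clX [in RHS](bigD1 a) //= opprD addrA subrK.
  by apply: CnD => //; apply: Cn_sum.
have [lab hlab] := choice hs; exists I, lab.
have [Y [[D'] _]] := dsum_exists_fin (E \o lab) add.
have := dsum_iso hlab D D' => /isomorphic_sym h.
exact: dsum_transport h D'.
Qed.

Let weight_class (I : finType) (lab : I -> 'I_N) X (D : dsum (E \o lab) X) :
  class_weight iota Z (iso_class X) = \prod_s w s #|[pred a | lab a == s]|.
Proof.
rewrite /class_weight.
have -> : [set r0 | exists2 Y, iso_class X Y &
    r0 = (cardset (EndZ iota Z (X := Y)))%:R / (cardset (Aut (X := Y)))%:R] =
    [set \prod_s w s #|[pred a | lab a == s]|].
  apply/seteqP; split => [r0 [Y hY ->]|_ ->] /=.
    have [D'] := dsum_transport hY D.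
    exact: (weight_formula j_iota Z E_indec E_inj rho_char rho0 D' l_image).
  exists X; first exact: isomorphic_refl.
  exact: esym (weight_formula j_iota Z E_indec E_inj rho_char rho0 D l_image).
exact: (@xgetI _ 0 [set \prod_s w s #|[pred a | lab a == s]|] _ erefl).
Qed.

Variable B : nat.
Hypothesis hB : forall r : 'I_N -> nat, Cn (d - \sum_s cl (E s) *+ r s) -> forall s, (r s <= B)%N.

(** By Krull-Schmidt, objects of class [d'] correspond to the multiplicity
   functions of weight [d']; all exponents are at most [B]. *)
Lemma Hcoef_mcount d' : Cn (d - d') -> H d' = mcount B (fun s => cl (E s)) w d'.
Proof.
move=> hd'.
pose R := {ffun 'I_N -> 'I_B.+1}.
pose X (r : R) := sval (cid (obj_of (fun s => r s))).
have XP (r : R) : inhabited (dsum (E \o (fun x : {s : 'I_N & 'I_(r s)} => tag x)) (X r)) /\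
    cl (X r) = \sum_s cl (E s) *+ r s := svalP (cid (obj_of (fun s => r s))).
pose rs := [seq r <- index_enum R | mwt (fun s => cl (E s)) r == d'].
pose cs := [seq iso_class (X r) | r <- rs].
have Xinj r r' : iso_class (X r) = iso_class (X r') -> r = r'.
  move=> /iso_class_eq hi; have [[D] _] := XP r; have [[D'] _] := XP r'.
  apply/ffunP => s; apply/val_inj; rewrite /= -(tag_card (fun s => r s)) -(tag_card (fun s => r' s)).
  exact: (multiplicity_eq kar (@hom_finite k A K) E_indec E_inj rhoD rhoM rho1 rho0 D D').
have csU : uniq cs.
  rewrite map_inj_in_uniq; first by apply: filter_uniq; exact: index_enum_uniq.
  by move=> r r' _ _; exact: Xinj.
have set_cs : [set iso_class Y | Y in [set Y | cl Y = d']] = [set` cs].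
  apply/seteqP; split => [_ [Y /= hY <-]|c /= /mapP[r hr ->]]; last first.
    exists (X r) => //=; have [_ ->] := XP r.
    by move: hr; rewrite mem_filter => /andP[/eqP <-].
  have [I [lab [D]]] : exists (I : finType) (lab : I -> 'I_N), inhabited (dsum (E \o lab) Y).
    by apply: decompose; rewrite hY.
  pose n s := #|[pred a | lab a == s]|.
  have clY : cl Y = \sum_s cl (E s) *+ n s.
    rewrite (additive_dsum add cl_add D) (partition_big lab predT) //=.
    apply: eq_bigr => s _; rewrite (eq_bigr (fun=> cl (E s))) => [|a /eqP <-//].
    by rewrite sumr_const.
  have nB s : (n s <= B)%N by apply: hB; rewrite -clY hY.
  pose r : R := [ffun s => inord (n s)].
  have rE s : r s = n s :> nat by rewrite ffunE inordK // ltnS.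
  apply/mapP; exists r.
    rewrite mem_filter mem_index_enum andbT /mwt; apply/eqP; rewrite -hY clY.
    by apply: eq_bigr => s _; rewrite rE.
  apply/iso_class_eq; have [[D'] _] := XP r.
  apply: (dsum_iso_of_multiplicity D D') => s.
  by rewrite (tag_card (fun s => r s)) rE.
rewrite /Hcoef set_cs -fsbig_seq //= /cs big_map /rs big_filter.
apply: eq_bigr => r _; have [[D] _] := XP r; rewrite (weight_class D).
by apply: eq_bigr => s _; rewrite (tag_card (fun s => r s)).
Qed.

Lemma Hcoef_recursion_reps i :
  (d 0 i)%:~R * H d =
  \sum_s \sum_(t < B.+1) (cl (E s) 0 i)%:~R *
    ((zfix (fdim K * e s * t.+1))%:R / ((q ^ (fdim K * e s * t.+1))%:R - 1)) *
    H (d - cl (E s) *+ t.+1).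
Proof.
rewrite Hcoef_mcount ?subrr //.
pose b s n : rat := (zpts (l s) Zs n)%:R / ((#|l s| ^ n)%:R - 1).
have w_rec s r : r%:R * w s r = \sum_(i < r) b s i.+1 * w s (r - i.+1)%N.
  apply: matrix_recursion => z; rewrite card_l; exact: Zpoints_frobX.
rewrite (mcount_recursion w_rec) => [|r hr]; last by apply: hB; rewrite hr subrr.
apply: eq_bigr => s _; apply: eq_bigr => t _; rewrite Hcoef_mcount; last first.
  by rewrite subKr; apply: CnMn.
by rewrite /b /zpts /zfix card_l -expnM.
Qed.

End WithReps.
End ClassSum.

(** * Base change of indecomposable objects *)

Section IndecIso.
Variables (R : comPzRingType) (C : lincat R).
Implicit Types X Y : C.

Lemma indecomposable_iso X Y : isomorphic X Y -> indecomposable X -> indecomposable Y.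
Proof.
move=> [f [g gf fg]] [X0 hX]; split=> [Y0|Y1 Y2 [i [j [p [r [h1 h2 h3 h4 h5]]]]]].
  by apply: X0; rewrite /is_zero -gf -(cmp1f f) Y0 cmp0f cmpf0.
apply: hX; exists (g \c i), (g \c j), (p \c f), (r \c f); split.
- by rewrite cmpA -(cmpA p) fg cmpf1.
- by rewrite cmpA -(cmpA r) fg cmpf1.
- by rewrite cmpA -(cmpA p) fg cmpf1.
- by rewrite cmpA -(cmpA r) fg cmpf1.
- transitivity (g \c (i \c p + j \c r) \c f); last by rewrite h5 cmpf1 gf.
  by rewrite cmpDr cmpDl !cmpA.
Qed.

Lemma dsum_one (I : finType) (P : I -> C) X (D : dsum P X) : #|I| = 1%N ->
  exists a, isomorphic (P a) X.
Proof.
move=> /eqP/fintype1P[a ha]; exists a, (dinj D a), (dprj D a); first exact: dprj_inj.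
by rewrite -(dsumE D) (big_pred1 a) // => b; apply/esym/eqP; exact: ha.
Qed.

End IndecIso.

Lemma dsum_res (k : finFieldType) (A : linpfun k) (V U : etsch k) (f : etmor V U)
    (I : finType) (P : I -> A U) (X : A U) :
  dsum P X -> dsum (fun a => res f (P a)) (res f X).
Proof.
move=> [i p e1 e0 es].
refine (@Dsum _ (A V) I _ _ (fun a => resm f (i a)) (fun a => resm f (p a)) _ _ _).
- by move=> a; rewrite -resmM e1 resm1.
- by move=> a b ab; rewrite -resmM e0 // resm0.
- by rewrite -resm1 -es resm_sum; apply: eq_bigr => a _; rewrite resmM.
Qed.

Lemma retract_res (k : finFieldType) (A : linpfun k) (V U : etsch k) (f : etmor V U)
    (X Y : A U) : retract X Y -> retract (res f X) (res f Y).
Proof.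
by move=> [r [s rs]]; exists (resm f r), (resm f s); rewrite -resmM rs resm1.
Qed.

Section BaseChange.
Variables (k : finFieldType) (W : closedFieldType) (iota : {rmorphism k -> W}).
Variables (F : posn -> fieldExtType k) (degF : forall n : posn, \dim {: F n} = val n).
Variable A : linear_stack k.
Local Notation q := #|k|.

Lemma field_of_degree n : (0 < n)%N -> exists L : fieldExtType k, fdim L = n.
Proof. by move=> n0; exists (F (exist _ n n0)); exact: degF. Qed.

Lemma embed_fixed (K : fieldExtType k) (j : {rmorphism K -> W}) z :
  z ^+ (q ^ fdim K) = z <-> exists x, j x = z.
Proof.
split=> [h|[x <-]]; last by rewrite -rmorphXn expf_fdim.
have [|x ->] := @finField_fixed_image (finvect_type K) W j z; last by exists x.
by rewrite card_fext.
Qed.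

(** On the extension [L] of degree [n], embedded into [W], the power [n'] of
   Frobenius is the identity. *)
Lemma fixed_field_dvd n n' : (0 < n)%N -> (0 < n')%N ->
  (forall z : W, z ^+ (q ^ n) = z -> z ^+ (q ^ n') = z) -> (n %| n')%N.
Proof.
move=> n0 n0' h; have [L dL] := field_of_degree n0.
have [j _] := embed_closed L iota.
rewrite -dL /dvdn -(mod0n (fdim L)); apply/eqP; apply: frob_eq_mod => x.
apply: (fmorph_inj j); rewrite !rmorphXn h ?expr1 //.
by rewrite -dL; apply/embed_fixed; exists x.
Qed.

(** Two embeddings of [K] differ by a power of Frobenius, which extends to [W]. *)
Lemma embed_extend (K L : fieldExtType k) (s : 'AHom(K, L)) (jK : {rmorphism K -> W}) :
  (forall c : k, jK c%:A = iota c) ->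
  exists jL : {rmorphism L -> W}, (forall c : k, jL c%:A = iota c) /\ forall x, jL (s x) = jK x.
Proof.
move=> hK; have [j0 h0] := embed_closed L iota.
pose p : {rmorphism K -> W} := j0 \o s.
have [i hi] : exists i : 'I_(fdim K), forall x, jK x = p (x ^+ (q ^ (1 * i))).
  apply: embeddings_conjugate; rewrite ?fdim_gt0 ?mul1n // => x.
  rewrite expn1 => /(@finField_fixed_image k K (GRing.in_alg K))[c ->].
  by rewrite /= hK rmorph_alg h0.
have [g hg] := frob_rmorphism iota i; exists (g \o j0); split=> [c|x] /=.
  rewrite h0 hg -rmorphXn; congr (iota _).
  by have := @frob_iter k k 1 i c; rewrite mul1n expn1 expf_card; apply.
by rewrite hg hi /p /= mul1n !rmorphXn.
Qed.

Section Characters.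
Variables (K : fieldExtType k) (j : {rmorphism K -> W}).

Lemma character0 (X : A (Spec K)) chi : character (X := X) j chi -> chi 0 = 0.
Proof. by move=> [h _ _ _]; apply: (addrI (chi 0)); rewrite -h !addr0. Qed.

Lemma character_sum (X : A (Spec K)) chi I (r : seq I) (P : pred I) f :
  character (X := X) j chi -> chi (\sum_(a <- r | P a) f a) = \sum_(a <- r | P a) chi (f a).
Proof.
move=> h; elim/big_rec2: _ => [|a y1 y2 _ <-]; first exact: character0 h.
by case: h => ->.
Qed.

Lemma characterX (X : A (Spec K)) chi (f : endr X) n :
  character (X := X) j chi -> chi (f ^+ n) = chi f ^+ n.
Proof.
by move=> [_ hM h1 _]; elim: n => // n IH; rewrite !exprS -IH; exact: hM.
Qed.

Lemma character_nilp (P : A (Spec K)) chi : character (X := P) j chi -> indecomposable P ->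
  forall f : endr P, chi f = 0 <-> nilp f.
Proof.
move=> h hP f; split=> [f0|[n hn]]; last first.
  by apply/eqP; have := characterX f n h; rewrite hn (character0 h) => /esym/eqP; rewrite expf_eq0 => /andP[].
have [_ hM h1 _] := h.
case: (indec_local (@stack_karoubian k A K) (@hom_finite k A K) hP f) => // -[g [hg _]].
have : chi (g \c f) = 1 by rewrite [_ \c _]hg.
by rewrite hM f0 mulr0 => /esym/eqP; rewrite oner_eq0.
Qed.

(** If [chi f] is the image of a scalar [x], then [f - x] is nilpotent, and every
   other character also takes the value of [x] at [f]. *)
Lemma character_unique (P : A (Spec K)) chi chi' : indecomposable P ->
  character (X := P) j chi -> character (X := P) j chi' ->
  (forall f, chi f ^+ (q ^ fdim K) = chi f) -> chi' =1 chi.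
Proof.
move=> hP h h' hv f; have [x hx] := (embed_fixed j _).1 (hv f).
have [hD _ h1 hZ] := h; have [hD' _ h1' hZ'] := h'.
pose g : endr P := f + Oconst (- x) *: idm P.
have fE : f = g + Oconst x *: idm P.
  by rewrite /g -addrA -scalerDl -OconstD addNr Oconst0 scale0r addr0.
have : chi g = 0 by rewrite hD hZ h1 mulr1 rmorphN hx subrr.
move/(character_nilp h hP)/(character_nilp h' hP) => g0.
by rewrite -hx fE hD' g0 hZ' h1' mulr1 add0r.
Qed.

Lemma residue_data1 (P : A (Spec K)) chi : character (X := P) j chi -> indecomposable P ->
  (forall f, chi f ^+ (q ^ fdim K) = chi f) -> residue_data j 1 chi.
Proof.
move=> h hP hv; split=> //; first exact: character_nilp.
move=> z; rewrite muln1; split=> [[f <-]//|/(embed_fixed j)[x <-]].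
by exists (Oconst x *: idm P); case: h => _ _ h1 ->; rewrite h1 mulr1.
Qed.

End Characters.

Section Extension.
Variables (K L : fieldExtType k) (s : 'AHom(K, L)).
Variables (jK : {rmorphism K -> W}) (jL : {rmorphism L -> W}).
Hypothesis jE : forall x, jL (s x) = jK x.
Local Notation S := (Spec_map s).
Local Notation bc X := (res S X).
Local Notation Q := (q ^ fdim K)%N.
Implicit Types X Y P : A (Spec K).
Let hA := @stackP k A.

(** [Hom(X_L, Y_L)] is spanned over [L] by the image of [Hom(X, Y)]. *)
Lemma ext_ind X Y (G : hom (bc X) (bc Y) -> Prop) :
  G 0 -> (forall u v, G u -> G v -> G (u + v)) ->
  (forall l f, G (Oconst l *: resm S f)) -> forall u, G u.
Proof.
move=> G0 GD GZ u; have [m [N [c [d [tr [desc [h _ _ _ _]]]]]]] := descent_basis hA s.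
by rewrite (h _ _ u); elim/big_ind: _.
Qed.

(** The extension is the [L]-linear one on [Hom(X_L, X_L) = L (x) Hom(X, X)]. It
   is defined through the components of descent, which makes it independent of
   the way an endomorphism is written as a combination. *)
Lemma character_extend X chi : character (X := X) jK chi ->
  exists chiL : hom (bc X) (bc X) -> W,
    character jL chiL /\ forall l f, chiL (Oconst l *: resm S f) = jL l * chi f.
Proof.
move=> hc; have [hD hM h1 hZ] := hc.
have [m [N [c [d [tr [desc [h dD dZ _ hl]]]]]]] := descent_basis hA s.
pose chiL u := \sum_a jL (c a) * chi (desc X X a u).
have cD u v : chiL (u + v) = chiL u + chiL v.
  rewrite /chiL -big_split; apply: eq_bigr => a _ /=.
  by rewrite dD hD mulrDr.
have c0 : chiL 0 = 0 by apply: (addrI (chiL 0)); rewrite -cD !addr0.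
have cR l f : chiL (Oconst l *: resm S f) = jL l * chi f.
  rewrite [in RHS](hl l) rmorph_sum mulr_suml; apply: eq_bigr => a _ /=.
  by rewrite dZ hZ -jE rmorphM mulrA.
exists chiL; split=> //; split=> //.
- move=> f; elim/ext_ind: f => [|u v IHu IHv|l f] g; first by rewrite cmpf0 c0 mulr0.
    by rewrite cmpDr !cD IHu IHv mulrDr.
  elim/ext_ind: g => [|u v IHu IHv|l' g]; first by rewrite cmp0f c0 mul0r.
    by rewrite cmpDl !cD IHu IHv mulrDl.
  rewrite cmpZl cmpZr scalerA -OconstM -resmM !cR rmorphM hM.
  by rewrite -!mulrA; congr (_ * _); rewrite mulrCA.
- by have := cR 1 (idm X); rewrite Oconst1 scale1r resm1 rmorph1 mul1r h1.
- move=> a f; elim/ext_ind: f => [|u v IHu IHv|l f]; first by rewrite scaler0 c0 mulr0.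
    by rewrite scalerDr !cD IHu IHv mulrDr.
  by rewrite scalerA -OconstM !cR rmorphM mulrA.
Qed.

(** The [n]-th power of a combination [u] of elements of the radical of [End P]
   is a combination of [n]-fold products of such elements, which vanish for
   large [n]. *)
Lemma radical_ext_nilp P (u : endr (bc P)) : indecomposable P ->
  (forall G : endr (bc P) -> Prop, G 0 -> (forall u v, G u -> G v -> G (u + v)) ->
    (forall l (f : endr P), nilp f -> G (Oconst l *: resm S f)) -> G u) ->
  nilp u.
Proof.
move=> hP hu; have Pfin := @hom_finite k A K P P.
have Ploc := indec_local (@stack_karoubian k A K) (@hom_finite k A K) hP.
have [N hN] : exists N, forall f : nat -> endr P, (forall i, nilp (f i)) -> \prod_(i < N) f i = 0.
  by apply: nil_products => // x y; apply: nilp_mull => //; exact: indec_nz.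
exists N.
suff key n (G : endr (bc P) -> Prop) : G 0 -> (forall u v, G u -> G v -> G (u + v)) ->
    (forall l (h : nat -> endr P), (forall i, nilp (h i)) ->
      G (Oconst l *: resm S (\prod_(i < n) h i : endr P))) -> G (u ^+ n).
  by apply: (key N (fun v => v = 0)) => [//|v w -> ->|l h hh]; rewrite ?addr0 // hN // resm0 scaler0.
elim: n G => [|n IH] G G0 GD GZ.
  have := GZ 1 (fun=> 0) (fun=> ex_intro _ 1%N (expr1 _)).
  by rewrite big_ord0 Oconst1 scale1r endr1 resm1.
rewrite exprSr; apply: (IH (fun v => G (v * u))); first by rewrite mul0r.
  by move=> v w; rewrite mulrDl; exact: GD.
move=> l h hh.
apply: (hu (fun v => G ((Oconst l *: resm S (\prod_(i < n) h i : endr P) : endr (bc P)) * v))).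
- by rewrite mulr0.
- by move=> v w; rewrite mulrDr; exact: GD.
move=> l' f hf; rewrite endrM cmpZl cmpZr scalerA -OconstM -resmM.
pose h' i := if (i < n)%N then h i else f.
have := GZ (l * l') h'; rewrite big_ord_recr /= /h' ltnn endrM.
rewrite (eq_bigr (fun i : 'I_n => h i)) => [|i _]; last by rewrite ltn_ord.
by apply => i; case: ifP.
Qed.

Section Split.
Variables (P : A (Spec K)) (e : nat) (rho : hom P P -> W).
Hypothesis P_indec : indecomposable P.
Hypothesis rhoP : residue_data jK e rho.

Let e0 : (0 < e)%N. Proof. by case: rhoP. Qed.
Let rhoC : character jK rho. Proof. by case: rhoP. Qed.
Let rho_fix f : rho f ^+ (Q ^ e) = rho f.
Proof. by have [_ _ _ h] := rhoP; rewrite -expnM; apply/h; exists f. Qed.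

Let rho_fixM n f : rho f ^+ (Q ^ (e * n)) = rho f.
Proof. by rewrite -expnM mulnA frob_iter // expnM rho_fix. Qed.

(** The conjugates of [rho] extend to the characters of [End(P_L)]: these are
   the embeddings of the residue field of [P] into [W] over [K], tensored with
   [L]. They correspond to the indecomposable summands of [P_L]. *)
Lemma character_conj i : character jK (fun f => rho f ^+ (Q ^ i)).
Proof.
have [hD hM h1 hZ] := rhoC; split=> [f g|f g||a f].
- by rewrite hD -!expnM (frobD iota).
- by rewrite hM exprMn.
- by rewrite h1 expr1n.
- rewrite hZ exprMn; congr (_ * _).
  by rewrite -rmorphXn -expnM frob_iter // expf_fdim.
Qed.

Let chi_ex i : exists chiL : hom (bc P) (bc P) -> W, character jL chiL /\
  forall l f, chiL (Oconst l *: resm S f) = jL l * rho f ^+ (Q ^ i).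
Proof. by have := character_extend (character_conj i). Qed.

Let chi i := sval (cid (chi_ex i)).
Let chiC i : character jL (chi i). Proof. by case: (svalP (cid (chi_ex i))). Qed.
Let chiR i l f : chi i (Oconst l *: resm S f) = jL l * rho f ^+ (Q ^ i).
Proof. by case: (svalP (cid (chi_ex i))) => _; exact. Qed.

Let chiD i u v : chi i (u + v) = chi i u + chi i v. Proof. by case: (chiC i) => h *; exact: h. Qed.
Let chiM i u v : chi i (u \c v) = chi i u * chi i v. Proof. by case: (chiC i) => _ h *; exact: h. Qed.
Let chi1 i : chi i (idm _) = 1. Proof. by case: (chiC i). Qed.
Let chiZ i a u : chi i (Oconst a *: u) = jL a * chi i u. Proof. by case: (chiC i) => _ _ _ h; exact: h. Qed.
Let chi0 i : chi i 0 = 0. Proof. exact: character0 (chiC i). Qed.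

Let chi_period i u : chi (i %% e) u = chi i u.
Proof.
elim/ext_ind: u => [|u v IHu IHv|l f]; first by rewrite !chi0.
  by rewrite !chiD IHu IHv.
rewrite !chiR; congr (_ * _); rewrite [in RHS](divn_eq i e) expnD exprM.
by rewrite [(_ * e)%N]mulnC rho_fixM.
Qed.

(** The trace formula, written in terms of the [chi i]: the index [e * m - i]
   stands for [- i] modulo the period [e]. *)
Let desc_residue m N (d : 'I_N -> L) (tr : 'I_N -> L -> K)
    (desc : 'I_N -> hom (bc P) (bc P) -> hom P P) a u :
  (forall a u v, desc a (u + v) = desc a u + desc a v) ->
  (forall a l f, desc a (Oconst l *: resm S f) = Oconst (tr a l) *: f) ->
  (forall a l, s (tr a l) = \sum_(i < m) (d a * l) ^+ (q ^ (fdim K * i))) ->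
  rho (desc a u) = \sum_(i < m) (jL (d a) * chi (e * m - i) u) ^+ (Q ^ i).
Proof.
move=> dD dZ htr; have [hD _ _ hZ] := rhoC.
elim/ext_ind: u => [|u v IHu IHv|l f].
- have -> : desc a 0 = 0 by apply: (addrI (desc a 0)); rewrite -dD !addr0.
  rewrite (character0 rhoC) big1 // => i _; rewrite chi0 mulr0 expr0n.
  by rewrite !expn_eq0 -leqn0 leqNgt (ltnW (card_gt1 k)).
- rewrite dD hD IHu IHv -big_split; apply: eq_bigr => i _ /=.
  by rewrite chiD mulrDr -!expnM (frobD iota).
rewrite dZ hZ -jE htr rmorph_sum mulr_suml; apply: eq_bigr => i _ /=.
rewrite chiR mulrA [RHS]exprMn -rmorphM [in LHS]rmorphXn expnM; congr (_ * _).
rewrite -exprM -expnD subnK; last first.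
  by rewrite (leq_trans (ltnW (ltn_ord i))) // leq_pmull.
by rewrite rho_fixM.
Qed.

(** The residue of the descended components of [u] is computed by the trace
   formula from the characters of [u]; if these vanish, [u] is a combination
   of elements of the radical. *)
Let chi_kernel (u : endr (bc P)) : (forall i : 'I_e, chi i u = 0) -> nilp u.
Proof.
move=> h0; have h i : chi i u = 0.
  by rewrite -chi_period; exact: (h0 (Ordinal (ltn_pmod i e0))).
have [m [N [c [d [tr [desc [hu dD dZ htr _]]]]]]] := descent_basis hA s.
apply: radical_ext_nilp => // G G0 GD GZ; rewrite (hu P P u).
elim/big_ind: _ => // a _; apply: GZ.
have [_ _ hn _] := rhoP; apply/hn.
rewrite (desc_residue a u (dD P P) (dZ P P) htr) big1 // => i _; rewrite h mulr0 expr0n.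
by rewrite !expn_eq0 -leqn0 leqNgt (ltnW (card_gt1 k)).
Qed.

Variables (I : finType) (Y : I -> A (Spec L)).
Hypothesis Y_indec : forall a, indecomposable (Y a).
Variable D : dsum Y (bc P).
Let eps a : endr (bc P) := dinj D a \c dprj D a.

Let chi_eps01 i a : chi i (eps a) = 0 \/ chi i (eps a) = 1.
Proof.
have h : chi i (eps a) * chi i (eps a) = chi i (eps a).
  by rewrite -chiM /eps cmpA -(cmpA (dinj D a)) dprj_inj cmpf1.
case: (eqVneq (chi i (eps a)) 0) => [|n0]; [by left|right].
by apply: (mulfI n0); rewrite h mulr1.
Qed.

Let chi_eps_ex i : exists a, chi i (eps a) = 1.
Proof.
apply: contrapT => hn; have : chi i (idm _) = 0.
  rewrite -(dsumE D) (character_sum _ _ _ (chiC i)) big1 // => a _.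
  by case: (chi_eps01 i a) => // h; case: hn; exists a.
by rewrite chi1 => /eqP; rewrite oner_eq0.
Qed.

Let chi_eps_off i a b : chi i (eps a) = 1 -> b != a -> chi i (eps b) = 0.
Proof.
move=> h ba; have : chi i (eps a \c eps b) = 0.
  have ab : a != b by rewrite eq_sym.
  by rewrite /eps cmpA -(cmpA (dinj D a)) dprj_inj0 // cmpf0 cmp0f chi0.
by rewrite chiM h mul1r.
Qed.

Let chi_eps_surj a : exists i : 'I_e, chi i (eps a) = 1.
Proof.
apply: contrapT => hn; have [n hn'] : nilp (eps a).
  apply: chi_kernel => i; case: (chi_eps01 i a) => // h; by case: hn; exists i.
have ee : eps a * eps a = eps a.
  by rewrite endrM /eps cmpA -(cmpA (dinj D a)) dprj_inj cmpf1.
have en t : eps a ^+ t.+1 = eps a by elim: t => // t IH; rewrite exprS IH ee.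
have z : eps a = 0 by rewrite -(en n) exprS hn' mulr0.
have [Y0 _] := Y_indec a; apply: Y0.
rewrite /is_zero -[idm _]cmp1f -(dprj_inj D a) cmpA -(cmpA (dprj D a)).
by rewrite [dinj D a \c _]z cmpf0 cmp0f.
Qed.

Let part i a (f : hom (Y a) (Y a)) := chi i (dinj D a \c f \c dprj D a).

Let partC i a : chi i (eps a) = 1 -> character jL (part i (a := a)).
Proof.
move=> h; split=> [f g|g f||l f]; rewrite /part.
- by rewrite cmpDr cmpDl chiD.
- by rewrite -chiM !cmpA -(cmpA _ (dprj D a)) dprj_inj cmpf1.
- by rewrite cmpf1.
- by rewrite cmpZr cmpZl chiZ.
Qed.

Let part_res i a u : chi i (eps a) = 1 -> part i (dprj D a \c u \c dinj D a) = chi i u.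
Proof.
move=> h; rewrite /part !cmpA -(cmpA _ (dinj D a)) -(mulr1 (chi i u)) -{1}h -(mul1r (_ * _)) -{1}h.
by rewrite -!chiM !cmpA.
Qed.

(** The character of the summand [Y a] restricts to a conjugate of [rho] on
   [End P], and its values are in [L]. *)
Lemma split_degree_dvd a chi' : residue_data (P := Y a) jL 1 chi' -> (fdim K * e %| fdim L)%N.
Proof.
move=> [_ hC _ hv]; have [i hi] := chi_eps_surj a.
have v f : chi' f ^+ (q ^ fdim L) = chi' f.
  by have := (hv (chi' f)).1 (ex_intro _ f erefl); rewrite muln1.
have hu := character_unique (Y_indec a) hC (partC hi) v.
apply: fixed_field_dvd; rewrite ?muln_gt0 ?fdim_gt0 ?e0 // => z hz.
have [f hf] : exists f, rho f = z ^+ (Q ^ (e - i)).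
  have [_ _ _ h] := rhoP; apply/h.
  by rewrite -exprM mulnC exprM hz.
have -> : z = part i (dprj D a \c resm S f \c dinj D a).
  rewrite part_res //; have := chiR i 1 f; rewrite Oconst1 scale1r rmorph1 mul1r => ->.
  by rewrite hf -exprM -expnD subnK ?(ltnW (ltn_ord i)) // -expnM hz.
by rewrite hu v.
Qed.

Hypothesis e_dvd : (fdim K * e %| fdim L)%N.

Let chi_fix i u : chi i u ^+ (q ^ fdim L) = chi i u.
Proof.
have [m dm] := dvdnP e_dvd.
elim/ext_ind: u => [|u v IHu IHv|l f].
- by rewrite chi0 expr0n expn_eq0 -leqn0 leqNgt (ltnW (card_gt1 k)).
- by rewrite chiD (frobD iota) IHu IHv.
rewrite chiR exprMn -rmorphXn expf_fdim; congr (_ * _).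
rewrite -exprM mulnC exprM; congr (_ ^+ _); rewrite dm mulnC frob_iter //.
by rewrite expnM rho_fix.
Qed.

Lemma split_residue_data a : exists chi', residue_data (P := Y a) jL 1 chi'.
Proof.
have [i hi] := chi_eps_surj a; exists (part i (a := a)).
by apply: residue_data1 (partC hi) (Y_indec a) _ => f; exact: chi_fix.
Qed.

Let chi_eps_inj (i i' : 'I_e) a : chi i (eps a) = 1 -> chi i' (eps a) = 1 -> i = i'.
Proof.
move=> h h'.
have hu : part i' (a := a) =1 part i (a := a).
  by apply: character_unique (partC h) (partC h') _ => // f; exact: chi_fix.
have hr f : rho f ^+ (Q ^ i') = rho f ^+ (Q ^ i).
  have := hu (dprj D a \c resm S f \c dinj D a); rewrite !part_res //.
  by have := chiR i 1 f; have := chiR i' 1 f; rewrite Oconst1 scale1r rmorph1 !mul1r => -> ->.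
have dpos : (0 < fdim K * e)%N by rewrite muln_gt0 fdim_gt0.
have [M dM] := field_of_degree dpos; have [jM _] := embed_closed M iota.
have : fdim K * i' = fdim K * i %[mod fdim M].
  apply: frob_eq_mod => x; apply: (fmorph_inj jM); rewrite !rmorphXn !expnM.
  have [f <-] : exists f, rho f = jM x; last exact: hr.
  by have [_ _ _ hz] := rhoP; apply/hz; rewrite -dM; apply/(embed_fixed jM); exists x.
rewrite dM -!muln_modr !modn_small // => /eqP.
by rewrite eqn_pmul2l ?fdim_gt0 // => /eqP/val_inj.
Qed.

(** Each character [chi i] is [1] on the idempotent of exactly one summand. Each
   summand arises since the characters detect non-nilpotent elements, and from
   a single [i] since a summand with residue field [L] has only one character,
   while the conjugates of [rho] are distinct. *)
Lemma split_card : #|I| = e.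
Proof.
have [f hf] := choice chi_eps_surj; have [g hg] := choice (fun i : 'I_e => chi_eps_ex i).
have fg : cancel g f by move=> i; apply: (chi_eps_inj (hf (g i))).
have gf : cancel f g.
  move=> a; apply/eqP; apply: contraT => ne.
  have := chi_eps_off (hf a) ne; rewrite hg => /eqP; by rewrite oner_eq0.
by rewrite (bij_eq_card (Bijective gf fg)) card_ord.
Qed.

(** An isomorphism from [Y a] to [Y b] would factor the idempotent of [Y a]
   through that of [Y b], on which the character of [Y a] vanishes. *)
Lemma split_inj a b : isomorphic (Y a) (Y b) -> a = b.
Proof.
move=> [u [v vu uv]]; apply/eqP; apply: contraT => ab.
have [i hi] := chi_eps_surj a; have hb : chi i (eps b) = 0.
  by apply: chi_eps_off hi _; rewrite eq_sym.
have : chi i ((dinj D a \c v \c dprj D b) \c eps b \c (dinj D b \c u \c dprj D a)) = 1.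
  rewrite -hi; congr (chi i _); rewrite /eps.
  rewrite !cmpA -(cmpA _ (dprj D b) (dinj D b)) dprj_inj cmpf1.
  rewrite -(cmpA _ (dprj D b) (dinj D b)) dprj_inj cmpf1.
  by rewrite -(cmpA _ v u) vu cmpf1.
by rewrite !chiM hb mulr0 mul0r => /esym/eqP; rewrite oner_eq0.
Qed.

End Split.

(** A common retract of the base changes of [P] and [P'] would factor through
   morphisms [P -> P' -> P], all of which are in the radical if [P] and [P']
   are not isomorphic. *)
Lemma base_change_disjoint P P' (T : A (Spec L)) : indecomposable P -> indecomposable P' ->
  indecomposable T -> retract T (bc P) -> retract T (bc P') -> isomorphic P P'.
Proof.
move=> hP hP' [T0 _] [r [t rt]] [r' [t' rt']]; apply: contrapT => hn.
have Ploc := indec_local (@stack_karoubian k A K) (@hom_finite k A K) hP.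
have rad (f : hom P P') (g : hom P' P) : nilp (g \c f : endr P).
  case: (Ploc (g \c f)) => // -[h [h1 _]]; case: hn.
  have hgf : (h \c g) \c f = idm P by rewrite -cmpA; exact: h1.
  have [|_ hi] := indec_summand (@stack_karoubian k A K) (@hom_finite k A K)
    (dsum_single P') _ hP hgf; last exact: hi.
  by move=> _.
pose u : endr (bc P) := (t \c r') \c (t' \c r).
have uu : u * u = u.
  rewrite endrM /u !cmpA -(cmpA _ r' t') rt' cmpf1 -(cmpA _ r t) rt cmpf1.
  by rewrite -(cmpA _ r' t') rt' cmpf1.
have [n hu] : nilp u.
  apply: radical_ext_nilp => // G G0 GD GZ; rewrite /u.
  elim/ext_ind: (t \c r') => [|v w Iv Iw|l g]; first by rewrite cmp0f.
    by rewrite cmpDl; exact: GD.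
  elim/ext_ind: (t' \c r) => [|v w Iv Iw|l' f]; first by rewrite cmpf0.
    by rewrite cmpDr; exact: GD.
  by rewrite cmpZl cmpZr scalerA -OconstM -resmM; exact: GZ.
have un a : u ^+ a.+1 = u by elim: a => // a IH; rewrite exprS IH uu.
have u0 : u = 0 by rewrite -(un n) exprS hu mulr0.
apply: T0; rewrite /is_zero -[idm T]cmp1f -rt -{1}[t]cmpf1 -rt'.
have -> : r \c (t \c (r' \c t')) \c (r \c t) = r \c u \c t by rewrite /u !cmpA.
by rewrite u0 cmpf0 cmp0f.
Qed.

(** The direct image of [T] restricts to the sum of the conjugates of [T], among
   which is [T]. *)
Lemma direct_image_retract (T : A (Spec L)) :
  exists (m : nat) (g : 'I_m -> 'AHom(L, L)) (X : A (Spec K)),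
    inhabited (dsum (fun i => res (Spec_map (g i)) T) (bc X)) /\ retract T (bc X).
Proof.
have [m [g [X [[D] [i hi]]]]] := direct_image hA s T (stack_additive A L).
exists m, g, X; split=> //.
apply: retract_trans (retract_dsum D i); apply: retract_iso.
have ei : Spec_map (g i) = etid (Spec L) by rewrite hi.
by apply: isomorphic_sym; exists (resI ei T); exact: resI_iso.
Qed.

Lemma retract_base_change_summand (T : A (Spec L)) X : indecomposable T -> retract T (bc X) ->
  exists P, [/\ indecomposable P, retract P X & retract T (bc P)].
Proof.
move=> hT hTX; have [I [P [hP [DP]]]] := decomposition (@hom_finite k A K) X.
have [a ha] := retract_component (@stack_karoubian k A L) (@hom_finite k A L) (dsum_res S DP) hT hTX.
by exists (P a); split=> //; exact: (retract_dsum DP a).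
Qed.

End Extension.

(** * Absolutely indecomposable objects *)

Lemma fdim_dvd (K L : fieldExtType k) (s : 'AHom(K, L)) : (fdim K %| fdim L)%N.
Proof. by have [m [g [-> _ _ _ _]]] := galois_family s; exact: dvdn_mulr. Qed.

Section Absolute.
Variables (K : fieldExtType k) (j : {rmorphism K -> W}).
Hypothesis j_iota : forall c : k, j c%:A = iota c.
Implicit Types P : A (Spec K).

(** With residue degree [1], every base change has a single indecomposable summand. *)
Lemma abs_indecomposable_degree1 P chi :
  indecomposable P -> residue_data (P := P) j 1 chi -> abs_indecomposable P.
Proof.
move=> hP hchi L s; have [jL [_ jE]] := embed_extend s j_iota.
have [I [Y [hY [D]]]] := decomposition (@hom_finite k A L) (res (Spec_map s) P).
have h1 : #|I| = 1%N by apply: (split_card jE hP hchi hY D); rewrite muln1 (fdim_dvd s).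
by have [a ha] := dsum_one D h1; exact: indecomposable_iso ha (hY a).
Qed.

Lemma abs_indecomposable_indec P : abs_indecomposable P -> indecomposable P.
Proof.
move=> /(_ K (id_ahom K)); apply: indecomposable_iso.
have e : Spec_map (id_ahom K) = etid (Spec K) by [].
by exists (resI e P); exact: resI_iso.
Qed.

(** [P] becomes a sum of [e] indecomposables over the extension of degree [e],
   if [e] is its residue degree. *)
Lemma degree1_abs_indecomposable P : abs_indecomposable P ->
  exists chi, residue_data (P := P) j 1 chi.
Proof.
move=> hA; have hP := abs_indecomposable_indec hA.
have [chi [e hchi]] := residue_exists j hP.
have hr : residue_data j e chi := hchi.
have e0 : (0 < e)%N by case: hr.
have [M dM] : exists M : fieldExtType k, fdim M = (fdim K * e)%N.
  by apply: field_of_degree; rewrite muln_gt0 fdim_gt0.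
have [s _] : exists s : 'AHom(K, M), True by apply: embed_dvd; rewrite dM dvdn_mulr.
have [jM [_ jE]] := embed_extend s j_iota.
exists chi; have := split_card jE hP hr (fun=> hA M s) (dsum_single (res (Spec_map s) P)).
by rewrite dM card_unit => ->.
Qed.

End Absolute.

Section Classes.
Variables (R : realType) (m : nat) (C : set 'rV[R]_m).
Variable cl : forall K : fieldExtType k, A (Spec K) -> 'rV[int]_m.
Hypothesis clP : class_map C cl.
Variables (K L : fieldExtType k) (s : 'AHom(K, L)).
Variables (jK : {rmorphism K -> W}) (jL : {rmorphism L -> W}).
Hypothesis jK_iota : forall c : k, jK c%:A = iota c.
Hypothesis jL_iota : forall c : k, jL c%:A = iota c.
Hypothesis jE : forall x, jL (s x) = jK x.
Local Notation bc X := (res (Spec_map s) X).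

Lemma class_additive (M : fieldExtType k) : additive_on_sums (cl (K := M)).
Proof. by move=> X Y Z; exact: (cl_sum clP). Qed.

(** The summands of [bc P] are Galois conjugates of each other. *)
Lemma split_class P e rho (I : finType) (Y : I -> A (Spec L)) (D : dsum Y (bc P)) a :
  indecomposable P -> residue_data (P := P) jK e rho -> (forall a, indecomposable (Y a)) ->
  (fdim K * e %| fdim L)%N -> cl P = cl (Y a) *+ e.
Proof.
move=> hP hrho hY ed.
have cls b : cl (Y b) = cl (Y a).
  have [n [g [X [[DX] hX]]]] := direct_image_retract s (Y a).
  have [P' [hP' rP' rY]] := retract_base_change_summand (hY a) hX.
  have PP' := base_change_disjoint hP hP' (hY a) (retract_dsum D a) rY.
  have rb : retract (Y b) (bc X).
    apply: retract_trans (retract_dsum D b) _; apply: retract_res.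
    exact: retract_trans (retract_iso PP') rP'.
  have [r [t rt]] := rb.
  have [chi hchi] := split_residue_data jE hP hrho hY D ed a.
  have hg i : indecomposable (res (Spec_map (g i)) (Y a)).
    exact: (abs_indecomposable_degree1 jL_iota (hY a) hchi).
  have [i hi] := indec_summand (@stack_karoubian k A L) (@hom_finite k A L) DX hg (hY b) rt.
  by rewrite (additive_iso (stack_additive A L) (@class_additive L) hi) (cl_res clP).
rewrite -(cl_res clP s) (additive_dsum (stack_additive A L) (@class_additive L) D).
rewrite (eq_bigr (fun=> cl (Y a))) => [|b _]; last exact: cls.
by rewrite sumr_const (split_card jE hP hrho hY D ed).
Qed.

Lemma absolute_retract P e rho (X : A (Spec L)) :
  indecomposable P -> residue_data (P := P) jK e rho -> abs_indecomposable X ->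
  retract X (bc P) -> (fdim K * e %| fdim L)%N /\ cl P = cl X *+ e.
Proof.
move=> hP hrho hX [r [t rt]]; have X_indec := abs_indecomposable_indec hX.
have [I [Q [hQ [D]]]] := decomposition (@hom_finite k A L) (bc P).
have [a ha] := indec_summand (@stack_karoubian k A L) (@hom_finite k A L) D hQ X_indec rt.
have habs : abs_indecomposable (Q a).
  by move=> M u; apply: indecomposable_iso (hX M u); exact: res_isomorphic.
have [chi hchi] := degree1_abs_indecomposable jL_iota habs.
have ed := split_degree_dvd jE hP hrho hQ D hchi.
split=> //; rewrite (split_class D a hP hrho hQ ed).
by rewrite (additive_iso (stack_additive A L) (@class_additive L) ha).
Qed.

Variables (n N : nat) (E : 'I_N -> A (Spec K)) (e : 'I_N -> nat).
Variable rho : forall t, hom (E t) (E t) -> W.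
Hypothesis dL : fdim L = (fdim K * n)%N.
Hypothesis E_indec : forall t, indecomposable (E t).
Hypothesis E_inj : forall t u, isomorphic (E t) (E u) -> t = u.
Hypothesis rhoP : forall t, residue_data jK (e t) (@rho t).

(** The absolutely indecomposable objects over [L] are the summands of the
   base changes of the indecomposables over [K] whose residue field embeds
   into [L]. *)
Lemma Acoef_residue_degrees d :
  (forall P r, indecomposable P -> (r <= n)%N -> cl P = d *+ r ->
    (exists X : A (Spec L), cl X = d) -> exists t, isomorphic P (E t)) ->
  Acoef (cl (K := L)) d = (\sum_(t | (e t %| n)%N && (cl (E t) == d *+ e t)) e t)%:R.
Proof.
move=> E_compl.
have e_pos t : (0 < e t)%N by case: (rhoP t).
have n0 : (0 < n)%N by case: n dL (fdim_gt0 L) => //; rewrite muln0 => ->.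
have edE t : (fdim K * e t %| fdim L)%N = (e t %| n)%N.
  by rewrite dL dvdn_pmul2l ?fdim_gt0.
pose good t := (e t %| n)%N && (cl (E t) == d *+ e t).
have split t : exists Y : 'I_(e t) -> A (Spec L), good t ->
    (forall i, indecomposable (Y i)) /\ inhabited (dsum Y (bc (E t))).
  case: (boolP (good t)) => [/andP[et _]|_]; last first.
    by have [[X0 _] _] := stack_additive A L; exists (fun=> X0).
  have [I [Y [hY [D]]]] := decomposition (@hom_finite k A L) (bc (E t)).
  have hI : #|I| = e t by apply: (split_card jE (E_indec t) (rhoP t) hY D); rewrite edE.
  pose h (i : 'I_(e t)) : I := enum_val (cast_ord (esym hI) i).
  have hb : bijective h.
    exists (fun a => cast_ord hI (enum_rank a)) => [i|a]; rewrite /h.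
      by rewrite enum_valK cast_ordKV.
    by rewrite cast_ordK enum_rankK.
  exists (Y \o h) => _; split=> [i|]; first exact: hY.
  by constructor; exact: dsum_reindex hb D.
have [Y hY] : exists Y : forall t, 'I_(e t) -> A (Spec L), forall t, good t ->
    (forall i, indecomposable (Y t i)) /\ inhabited (dsum (Y t) (bc (E t))).
  by exists (fun t => sval (cid (split t))) => t; exact: svalP (cid (split t)).
pose T : finType := {t : 'I_N & 'I_(e t)}.
pose cls := [seq iso_class (Y (tag p) (tagged p)) | p <- enum T & good (tag p)].
have clsU : uniq cls.
  rewrite map_inj_in_uniq; first by apply: filter_uniq; exact: enum_uniq.
  move=> [t i] [u i'].
  rewrite !mem_filter /= => /andP[gt _] /andP[gu _] /iso_class_eq hi.
  have [hYt [Dt]] := hY t gt; have [hYu [Du]] := hY u gu.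
  have etu : t = u.
    apply: E_inj; apply: (base_change_disjoint (s := s) (E_indec t) (E_indec u) (hYt i)).
      exact: retract_dsum Dt i.
    by apply: retract_trans (retract_iso hi) _; exact: retract_dsum Du i'.
  subst u; congr Tagged.
  exact: (split_inj jE (E_indec t) (rhoP t) hYt Dt hi).
have -> : Acoef (cl (K := L)) d = (cardset [set` cls])%:R.
  rewrite /Acoef; congr (cardset _)%:R; apply/seteqP; split=> [_ [X [hX cX] <-]|c /mapP[[t i]]] /=.
    have X_indec := abs_indecomposable_indec hX.
    have [n' [g [X0 [_ hX0]]]] := direct_image_retract s X.
    have [P [hP _ rXP]] := retract_base_change_summand X_indec hX0.
    have [rP [eP hrP]] := residue_exists jK hP.
    have [ed cP] := absolute_retract hP hrP hX rXP; rewrite cX in cP.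
    have ePn : (eP <= n)%N.
      by move: ed; rewrite dL dvdn_pmul2l ?fdim_gt0 // => /(dvdn_leq n0).
    have [u hu] := E_compl P eP hP ePn cP (ex_intro _ X cX).
    have rXE : retract X (bc (E u)).
      by apply: retract_trans rXP _; apply: retract_iso; exact: res_isomorphic.
    have [ed' cE] := absolute_retract (E_indec u) (rhoP u) hX rXE.
    have gu : good u by rewrite /good -edE ed' cE cX eqxx.
    have [hYu [Du]] := hY u gu; have [r [t rt]] := rXE.
    have [i hi] := indec_summand (@stack_karoubian k A L) (@hom_finite k A L) Du hYu X_indec rt.
    apply/mapP; exists (Tagged (fun t => 'I_(e t)) i); first by rewrite mem_filter /= gu mem_enum.
    exact/iso_class_eq.
  rewrite mem_filter /= => /andP[gt _] ->; have [hYt [Dt]] := hY t gt.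
  have et : (fdim K * e t %| fdim L)%N by rewrite edE; case/andP: gt.
  exists (Y t i) => //=; split.
    have [chi hchi] := split_residue_data jE (E_indec t) (rhoP t) hYt Dt et i.
    exact: (abs_indecomposable_degree1 jL_iota (hYt i) hchi).
  have := split_class Dt i (E_indec t) (rhoP t) hYt et.
  case/andP: gt => _ /eqP -> /eqP; rewrite eq_sym -subr_eq0 -mulrnBl => /eqP.
  by move/(intvec_torsionfree (e_pos t))/subr0_eq.
rewrite cardset_seq // /cls size_map size_filter -sum1_count big_enum_cond /=.
congr (_%:R); transitivity (\sum_(t | good t) \sum_(x : 'I_(e t)) 1)%N.
  rewrite (sig_big_dep good (fun _ _ => true) (fun _ _ => 1%N)) /=.
  by apply: eq_bigl => p; rewrite andbT.
by apply: eq_bigr => t _; rewrite sum1_card card_ord.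
Qed.

End Classes.

End BaseChange.

(** * Series supported in a pointed cone *)

Section Cone.
Variables (R : realType) (m : nat) (C : set 'rV[R]_m).
Hypothesis hC : closed_pointed_cone C.
Local Notation Cn e := (C (toreal R e)).
Implicit Types d e : 'rV[int]_m.

Lemma torealD d e : toreal R (d + e) = toreal R d + toreal R e.
Proof. by apply/matrixP => i j; rewrite !mxE rmorphD. Qed.

Lemma torealN e : toreal R (- e) = - toreal R e.
Proof. by apply/matrixP => i j; rewrite !mxE rmorphN. Qed.

Lemma toreal0 : toreal R (0 : 'rV[int]_m) = 0.
Proof. by apply/matrixP => i j; rewrite !mxE. Qed.

Lemma lattice_cone0 : Cn 0.
Proof. by rewrite toreal0; exact: (cone0 hC). Qed.

Lemma lattice_coneD d e : Cn d -> Cn e -> Cn (d + e).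
Proof. by rewrite torealD; exact: (coneD hC). Qed.

Lemma lattice_cone_pointed e : Cn e -> Cn (- e) -> e = 0.
Proof.
rewrite torealN => h1 h2; have /matrixP h := cone_pointed hC h1 h2.
apply/matrixP => i j; have := h i j; rewrite !mxE => /eqP.
by rewrite intr_eq0 => /eqP.
Qed.

(** The unit vectors of [C] form a compact set disjoint from [- C], so that
   [x + y] is bounded away from [0] for [x] in it and [y] in [C]. *)
Lemma cone_sum_bounded_below :
  exists2 c : R, 0 < c & forall x y, C x -> C y -> c * `|x| <= `|x + y|.
Proof.
pose K : set 'rV[R]_m := C `&` [set x | `|x| = 1].
have Kc : compact K.
  apply: bounded_closed_compact.
    exists 1; split=> // M M1 x [_ /= ->]; exact: ltW.
  apply: closedI; first exact: (cone_closed hC).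
  have -> : [set x : 'rV[R]_m | `|x| = 1] = (fun x => `|x|) @^-1` [set 1] by [].
  apply: preimage_closed; last exact: closed_eq.
  by move=> x _; exact: norm_continuous.
have /compact_near_coveringP ncK := Kc.
have [c [c0 hc]] : exists c : R, 0 < c /\ forall x, K x -> forall y, C y -> c <= `|x + y|.
  have H : \forall c \near (0 : R)^'+, K `<=` (fun x => forall y, C y -> c <= `|x + y|).
    apply: (ncK R (0 : R)^'+ (fun c x => forall y, C y -> c <= `|x + y|)).
    move=> x [Cx /= x1].
    have nC : ~ C (- x).
      by move=> h; have x0 := cone_pointed hC Cx h; move: x1; rewrite x0 normr0 => /esym/eqP; rewrite oner_eq0.
    have [eps /= e0 he] : nbhs_ball (- x) (~` C).
      by apply/nbhs_ballP/open_nbhs_nbhs; split=> //; apply: closed_openC; exact: (cone_closed hC).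
    have hy y : C y -> eps <= `|x + y|.
      move=> Cy; rewrite leNgt; apply/negP => lt; apply: (he y) => //.
      by rewrite -ball_normE /ball_ /= -opprD normrN.
    have e2 : 0 < eps / 2 by rewrite divr_gt0.
    have nb : \forall x' \near x, `|x - x'| < eps / 2.
      by have := nbhsx_ballx x (eps / 2) e2; rewrite -ball_normE.
    near=> x' c => y Cy.
    have h1 : `|x - x'| < eps / 2 by near: x'; exact: nb.
    have h2 : c < eps / 2 by near: c; apply: nbhs_right_lt; rewrite divr_gt0.
    rewrite -(lerD2l `|x - x'|); apply: (@le_trans _ _ `|x + y|).
      by apply: le_trans (hy y Cy); rewrite [leRHS]splitr lerD // ltW.
    have -> : x + y = (x - x') + (x' + y) by rewrite addrA subrK.
    exact: ler_normD.
  have [c [c0 h]] := filter_ex (filterI (nbhs_right_gt (0 : R)) H).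
  by exists c.
exists c => // x y Cx Cy; have [->|x0] := eqVneq x 0; first by rewrite normr0 mulr0.
have nx : 0 < `|x| by rewrite normr_gt0.
have := hc (`|x|^-1 *: x) _ (`|x|^-1 *: y) _; rewrite -scalerDr normrZ normrV ?unitfE ?gt_eqF // normr_id.
rewrite ler_pdivlMl // mulrC; apply.
  split; first by apply: (coneZ hC) => //; rewrite invr_ge0 ltW.
  by rewrite /= normrZ normrV ?unitfE ?gt_eqF // normr_id mulVf ?gt_eqF.
by apply: (coneZ hC) => //; rewrite invr_ge0 ltW.
Unshelve. all: by end_near.
Qed.

Lemma lattice_interval_finite d : finite_set [set e | Cn e /\ Cn (d - e)].
Proof.
have [c c0 hc] := cone_sum_bounded_below.
set M := `|toreal R d| / c; have M0 : 0 <= M by rewrite divr_ge0 // ltW.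
pose N := Num.bound M.
pose G (f : {ffun 'I_m -> 'I_(N + N).+1}) : 'rV[int]_m := \row_i ((f i)%:Z - N%:Z).
apply: (@sub_finite_set _ _ (G @` [set: {ffun 'I_m -> 'I_(N + N).+1}])); last first.
  by apply: finite_image; exact: finite_finset.
move=> e [Ce Cde].
have he i : (absz (e ord0 i) <= N)%N.
  have : c * `|toreal R e| <= `|toreal R d|.
    have := hc _ _ Ce Cde; rewrite -torealD; congr (_ <= `|toreal R _|).
    by rewrite addrC subrK.
  rewrite mulrC -ler_pdivlMr // -/M => h1.
  have h2 : `|toreal R e 0 i| <= `|toreal R e|.
    rewrite [X in _ <= X]mx_normrE.
    exact: (le_bigmax _ (fun i : 'I_1 * 'I_m => `|toreal R e i.1 i.2|) (0, i)).
  have := le_lt_trans (le_trans h2 h1) (archi_boundP M0).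
  rewrite mxE -intr_norm pmulrn ltr_int.
  by rewrite -abszE ltz_nat => /ltnW.
exists [ffun i => inord (absz (e 0 i + N%:Z)%R)] => //.
apply/rowP => i; have hi := he i; rewrite -[ord0]/(0 : 'I_1) in hi.
rewrite !mxE ffunE; move: (e 0 i) hi => z hz.
by rewrite inordK; lia.
Qed.

End Cone.

(** * Exponentials and logarithmic derivatives *)

Section Exponential.
Variables (R : realType) (m : nat) (C : set 'rV[R]_m).
Hypothesis hC : closed_pointed_cone C.
Local Notation Cn e := (C (toreal R e)).
Implicit Types (d e : 'rV[int]_m) (f g h : 'rV[int]_m -> rat).

Definition interval d : seq 'rV[int]_m := fset_set [set e | Cn e /\ Cn (d - e)].

Lemma mem_interval d e : reflect (Cn e /\ Cn (d - e)) (e \in interval d).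
Proof.
have -> : (e \in interval d) = (e \in [set e | Cn e /\ Cn (d - e)]).
  exact: (in_fset_set (lattice_interval_finite hC d)).
by apply: (iffP idP); rewrite in_setE.
Qed.

Lemma interval_uniq d : uniq (interval d).
Proof. exact: fset_uniq. Qed.

(** [interval (d - e)] is part of [interval d], where it misses [d] itself since
   [- e] is not in the cone. *)
Lemma size_interval_sub d e : e \in interval d -> e != 0 ->
  (size (interval (d - e)) < size (interval d))%N.
Proof.
move=> /mem_interval[Ce Cde] e0.
have sub : {subset d :: interval (d - e) <= interval d}.
  move=> x; rewrite inE => /orP[/eqP ->|/mem_interval[Cx Cy]]; apply/mem_interval.
    split; last by rewrite subrr; exact: lattice_cone0.
    by rewrite -(subrK e d); apply: lattice_coneD.
  split=> //; have -> : d - x = (d - e - x) + e by rewrite addrAC subrK.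
  exact: lattice_coneD.
apply: (uniq_leq_size _ sub); rewrite /= interval_uniq andbT; apply/mem_interval => -[_].
rewrite addrAC subrr add0r => h; case/eqP: e0; exact: lattice_cone_pointed h.
Qed.

(** The multiples of [e] up to [e *+ r] are distinct members of [interval d]. *)
Lemma interval_multiples d e r : Cn e -> e <> 0 -> Cn (d - e *+ r) ->
  (r <= size (interval d))%N.
Proof.
move=> Ce e0 Cd; have CM n : Cn (e *+ n).
  elim: n => [|n IH]; first by rewrite mulr0n; exact: lattice_cone0.
  by rewrite mulrS; exact: lattice_coneD.
rewrite -(size_iota 1 r) -(size_map (fun n => e *+ n)); apply: uniq_leq_size.
  rewrite map_inj_uniq ?iota_uniq // => n n'.
  wlog le : n n' / (n <= n')%N.
    by move=> hw h; case: (leqP n n') => [|/ltnW] le; [|symmetry]; apply: hw.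
  move=> h; apply/eqP; rewrite eqn_leq le /= -subn_eq0 -leqn0 leqNgt; apply/negP => lt.
  apply: e0; apply: (intvec_torsionfree lt).
  by rewrite mulrnBr // h subrr.
move=> _ /mapP[n + ->]; rewrite mem_iota add1n ltnS => /andP[_ nr].
apply/mem_interval; split=> //.
have -> : d - e *+ n = (d - e *+ r) + e *+ (r - n) by rewrite mulrnBr // addrA subrK.
exact: lattice_coneD.
Qed.

Definition conv f g d : rat := \sum_(e <- interval d) f e * g (d - e).

Lemma eq_conv f f' g g' d : {in interval d, forall e, f e * g (d - e) = f' e * g' (d - e)} ->
  conv f g d = conv f' g' d.
Proof. by move=> h; rewrite /conv; apply: eq_big_seq. Qed.

Lemma conv_interval f g d e : e \in interval d ->
  conv f g (d - e) = \sum_(x <- interval d | d - e - x \in interval d) f x * g (d - e - x).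
Proof.
move=> /mem_interval[Ce Cde]; rewrite /conv -[RHS]big_filter; apply: perm_big.
apply: uniq_perm; rewrite ?filter_uniq ?interval_uniq // => x.
rewrite mem_filter; apply/mem_interval/andP => [[Cx Cy]|[/mem_interval[h _] /mem_interval[Cx _]]//].
split; apply/mem_interval; split=> //.
  by rewrite -[d - e - x]addrA -opprD subKr; exact: lattice_coneD.
by have -> : d - x = (d - e - x) + e by [rewrite addrAC subrK]; exact: lattice_coneD.
Qed.

Lemma conv_left_comm f g h d : conv f (conv g h) d = conv g (conv f h) d.
Proof.
have E f' g' : conv f' (conv g' h) d = \sum_(e <- interval d) \sum_(x <- interval d)
    (if d - e - x \in interval d then f' e * g' x * h (d - e - x) else 0).
  apply: eq_big_seq => e ed; rewrite conv_interval // mulr_sumr -big_mkcond.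
  by apply: eq_bigr => x _; rewrite mulrA.
rewrite !E exchange_big; apply: eq_bigr => x _; apply: eq_bigr => e _.
by rewrite [d - e - x]addrAC [f e * _]mulrC.
Qed.

Definition unit_series d : rat := (d == 0)%:R.

Definition conv_pow f n := iter n (conv f) unit_series.

(** The derivation [t_i d/dt_i] of series. *)
Definition euler (i : 'I_m) f d : rat := (d 0 i)%:~R * f d.

Lemma euler_conv i f g d : euler i (conv f g) d = conv (euler i f) g d + conv f (euler i g) d.
Proof.
rewrite /euler /conv mulr_sumr -big_split; apply: eq_bigr => e _ /=.
have -> : (d 0 i)%:~R = (e 0 i)%:~R + ((d - e) 0 i)%:~R :> rat.
  by rewrite -rmorphD /= !mxE addrCA subrr addr0.
by rewrite mulrDl !mulrA [f e * _]mulrC.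
Qed.

Lemma euler_conv_pow i f n d :
  euler i (conv_pow f n.+1) d = n.+1%:R * conv (euler i f) (conv_pow f n) d.
Proof.
elim: n d => [|n IH] d; rewrite /conv_pow iterS euler_conv.
  rewrite mul1r [X in _ + X]big1 ?addr0 // => e _.
  rewrite /euler /= /unit_series.
  by case: (eqVneq (d - e) 0) => [->|_]; rewrite ?mxE ?mul0r !mulr0.
rewrite -/(conv_pow f n.+1) -[X in _ + X]/(conv f (euler i (conv_pow f n.+1)) d).
have -> : conv f (euler i (conv_pow f n.+1)) d =
    n.+1%:R * conv f (conv (euler i f) (conv_pow f n)) d.
  rewrite /conv mulr_sumr; apply: eq_bigr => e _; rewrite IH.
  by rewrite mulrCA.
rewrite conv_left_comm -[X in _ + _ * X]/(conv (euler i f) (conv_pow f n.+1) d).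
by rewrite [in RHS]mulrS mulrDl mul1r.
Qed.

Section Vanishing.
Variable f : 'rV[int]_m -> rat.
Hypothesis f0 : f 0 = 0.

(** Each of the [n] factors has nonzero degree, and subtracting it shrinks the
   interval strictly. *)
Lemma conv_pow_vanish n d : (size (interval d) < n)%N -> conv_pow f n d = 0.
Proof.
elim: n d => // n IH d; rewrite ltnS => hn; rewrite /conv_pow iterS /conv big_seq big1 // => e ed.
have [->|e0] := eqVneq e 0; first by rewrite f0 mul0r.
rewrite -/(conv_pow f n) IH ?mulr0 //.
exact: leq_trans (size_interval_sub ed e0) hn.
Qed.

Definition conv_exp d : rat := \sum_(n < (size (interval d)).+1) n`!%:R^-1 * conv_pow f n d.

Lemma conv_expE N d : (size (interval d) < N)%N ->
  conv_exp d = \sum_(n < N) n`!%:R^-1 * conv_pow f n d.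
Proof.
move=> h; rewrite /conv_exp (big_ord_widen N (fun n => n`!%:R^-1 * conv_pow f n d)) //.
rewrite big_mkcond; apply: eq_bigr => n _; case: ltnP => // hn.
by rewrite conv_pow_vanish ?mulr0.
Qed.

Lemma euler_conv_exp i d : euler i conv_exp d = conv (euler i f) conv_exp d.
Proof.
rewrite [LHS]/euler (@conv_expE (size (interval d)).+2) // mulr_sumr big_ord_recl /=.
have -> : (d 0 i)%:~R * (1^-1 * conv_pow f 0 d) = 0 :> rat.
  rewrite /conv_pow /unit_series /=; case: eqP => [->|_]; last by rewrite !mulr0.
  by rewrite mxE mul0r.
rewrite add0r.
transitivity (\sum_(n < (size (interval d)).+1) n`!%:R^-1 * conv (euler i f) (conv_pow f n) d).
  apply: eq_bigr => n _; rewrite /bump /= add1n mulrCA.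
  rewrite -/(euler i (conv_pow f n.+1) d) euler_conv_pow mulrA; congr (_ * _).
  by rewrite factS natrM invfM -mulrA mulrCA mulVf ?mulr1 // pnatr_eq0.
under eq_bigr => n _ do rewrite /conv mulr_sumr.
rewrite exchange_big; apply: eq_big_seq => e ed /=.
have [->|e0] := eqVneq e 0.
  have z : euler i f 0 = 0 by rewrite /euler f0 mulr0.
  by rewrite z mul0r big1 // => n _; rewrite mul0r mulr0.
rewrite (@conv_expE (size (interval d)).+1); last exact: ltnW (size_interval_sub ed e0).
by rewrite mulr_sumr; apply: eq_bigr => n _; rewrite mulrCA.
Qed.

(** The equation [t_i dg/dt_i = (t_i df/dt_i) g] expresses the coefficient of [g]
   at [d], up to the [i]-th coordinate of [d], by those at the [d - e] with
   smaller intervals. *)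
Lemma conv_exp_unique g : g 0 = 1 -> (forall d, ~ Cn d -> g d = 0) ->
  (forall d i, euler i g d = conv (euler i f) g d) -> g =1 conv_exp.
Proof.
move=> g0 gC hg d; have [n] := ubnP (size (interval d)); elim: n d => // n IH d.
rewrite ltnS => hn.
have [->|d0] := eqVneq d 0.
  rewrite g0 /conv_exp big_ord_recl big1 => [|a _].
    by rewrite /= /conv_pow /unit_series /= eqxx invr1 mulr1 addr0.
  rewrite lift0 /conv_pow iterS /conv big_seq big1 ?mulr0 // => e /mem_interval[h].
  by rewrite sub0r => /(lattice_cone_pointed hC h) ->; rewrite f0 mul0r.
have [i hi] : exists i, d 0 i != 0.
  apply: contrapT => hn'; case/eqP: d0; apply/rowP => i; rewrite mxE.
  by apply/eqP; apply: contraT => h; case: hn'; exists i.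
have : euler i g d = euler i conv_exp d.
  rewrite hg euler_conv_exp; apply: eq_conv => e ed.
  have [->|e0] := eqVneq e 0; first by rewrite /euler mxE !mul0r.
  by rewrite IH //; exact: leq_trans (size_interval_sub ed e0) hn.
by apply: mulfI; rewrite intr_eq0.
Qed.

End Vanishing.

Lemma sum_vring (I : Type) (r : seq I) (P : pred I) (G : I -> vring) p :
  (\sum_(a <- r | P a) G a) p = \sum_(a <- r | P a) G a p.
Proof. by elim/big_rec2: _ => // a y1 y2 _ <-. Qed.

Lemma spow_eval (G : series m) n d p : spow C G n d p = conv_pow (fun e => G e p) n d.
Proof.
elim: n d => [|n IH] d; first by rewrite /spow /= /sone /conv_pow /unit_series /=; case: eqP.
rewrite /spow iterS /smul fsbig_finite; last exact: lattice_interval_finite.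
rewrite sum_vring /conv_pow iterS /conv; apply: eq_bigr => e _.
by rewrite -[LHS]/(G e p * spow C G n (d - e) p) IH.
Qed.

Lemma sexp_eval (G : series m) d p : (forall p, G 0 p = 0) ->
  sexp C G d p = conv_exp (fun e => G e p) d.
Proof.
move=> G0; rewrite /sexp /conv_exp.
pose T (n : nat) : vring := cst (n`!%:R)^-1 * spow C G n d.
have -> : \sum_(n \in [set: nat]) cst (n`!%:R)^-1 * spow C G n d =
    \sum_(n < (size (interval d)).+1) T n.
  transitivity (\sum_(n \in `I_(size (interval d)).+1) T n); last exact/esym/fsbig_ord.
  apply/esym/fsbig_widen => // n [_ /= hn].
  apply/funext => p'.
  rewrite -[LHS]/((n`!%:R)^-1 * spow C G n d p') spow_eval conv_pow_vanish ?mulr0 //.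
  by rewrite ltnNge; apply/negP => h; case: hn.
rewrite sum_vring; apply: eq_bigr => n _.
by rewrite -[LHS]/((n`!%:R)^-1 * spow C G n d p) spow_eval.
Qed.

End Exponential.

(** * The exponential formula *)

Lemma sum_multiples (e T : nat) (phi : nat -> rat) : (0 < e)%N ->
  \sum_(0 <= n < e * T | (e %| n.+1)%N) phi n.+1 = \sum_(0 <= t < T) phi (e * t.+1)%N.
Proof.
case: e => // e _; elim: T => [|T IH]; first by rewrite muln0 !big_geq.
rewrite big_nat_recr //= -IH mulnS addnC (big_cat_nat (n := (e.+1 * T)%N)) ?leq_addr //=.
congr (_ + _); rewrite addnS big_mkcond big_nat_recr ?leq_addr //= big_nat_cond big1 ?add0r.
  by rewrite -addnS -mulnSr dvdn_mulr // dvdnn.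
move=> n /andP[/andP[n1 n2] _]; case: ifP => // /dvdnP[x hx].
have h1 : (T < x)%N by rewrite -(ltn_pmul2l (m := e.+1)) // [(e.+1 * x)%N]mulnC -hx ltnS.
have : (n.+1 < e.+1 * T.+1)%N by rewrite mulnSr addnS ltnS.
by rewrite hx [(x * _)%N]mulnC ltn_pmul2l // ltnS leqNgt h1.
Qed.

Lemma cardset_image (T U : choiceType) (f : T -> U) (S : set T) :
  injective f -> finite_set S -> cardset (f @` S) = cardset S.
Proof.
move=> fI /finite_seqP[s0 e0]; pose s := undup s0.
have es : S = [set` s] by rewrite e0; apply/seteqP; split=> x /=; rewrite mem_undup.
have us : uniq s := undup_uniq s0.
have -> : f @` S = [set` map f s].
  rewrite es; apply/seteqP; split=> [_ [x hx <-]|_ /mapP[x hx ->]] /=.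
    by rewrite (mem_map fI).
  by exists x.
by rewrite es !cardset_seq ?size_map // map_inj_uniq.
Qed.

Lemma mulrn_div_cancel (z : int) (a n : nat) (w : rat) :
  (z *+ a)%:~R * w = (z *+ n.+1)%:~R * ((n.+1)%:R^-1 * (w * a%:R)).
Proof.
have E b : (z *+ b)%:~R = z%:~R * b%:R :> rat by rewrite rmorphMn /= mulr_natr.
rewrite !E -!mulrA; congr (_ * _).
by rewrite mulVKf ?pnatr_eq0 // mulrC.
Qed.

Section Formula.
Variables (k : finFieldType) (W : closedFieldType) (iota : {rmorphism k -> W}).
Variables (F : posn -> fieldExtType k) (degF : forall n : posn, \dim {: F n} = val n).
Variables (A : linear_stack k) (R : realType) (m : nat) (C : set 'rV[R]_m).
Variable cl : forall K : fieldExtType k, A (Spec K) -> 'rV[int]_m.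
Hypothesis clP : class_map C cl.
Variable Z : subvariety k.
Local Notation q := #|k|.
Local Notation Cn e := (C (toreal R e)).
Let hC := cl_coneP clP.

Lemma Zcount_zfix (L : fieldExtType k) : Zcount Z L = (zfix iota Z (fdim L))%:R.
Proof.
have [j hj] := embed_closed L iota.
rewrite /Zcount /zfix; congr (_%:R); rewrite -(cardset_image (fmorph_inj j)); last first.
  exact: (@finite_finset (finvect_type L)).
congr cardset.
have e (p : {poly k}) x : root (map_poly iota p) (j x) = root (map_poly (GRing.in_alg L) p) x.
  have -> : map_poly iota p = map_poly j (map_poly (GRing.in_alg L) p).
    by apply/polyP => n; rewrite !coef_map /= hj.
  by rewrite fmorph_root.
apply/seteqP; split=> [_ [x [h1 [r r1 r2]] <-]|z [[h1 [r r1 r2]] /(embed_fixed j)[x hx]]] /=.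
  split; last by apply/embed_fixed; exists x.
  by split=> [p /h1|]; [rewrite e|exists r; rewrite ?e].
by exists x => //; subst z; split=> [p /h1|]; [rewrite e|exists r; rewrite -?e].
Qed.

Lemma Acoef0 (K : fieldExtType k) : Acoef (cl (K := K)) 0 = 0.
Proof.
have [j hj] := embed_closed K iota.
rewrite /Acoef; have -> : [set iso_class X | X in [set X : A (Spec K) | abs_indecomposable X /\ cl X = 0]] = set0.
  apply/seteqP; split=> // c [X [hX hcl] _].
  have := indec_class_nz j (class_additive clP (M := K)) (cl_finite clP K)
    (abs_indecomposable_indec hX).
  exact.
by rewrite /cardset fset_set0 cardfs0.
Qed.

Lemma Hcoef_out (K : fieldExtType k) d : ~ Cn d -> Hcoef iota (cl (K := K)) d Z = 0.
Proof.
move=> hd; rewrite /Hcoef; have -> : [set iso_class X | X in [set X : A (Spec K) | cl X = d]] = set0.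
  by apply/seteqP; split=> // c [X hX _]; case: hd; rewrite -hX; exact: (cl_cone clP).
by rewrite fsbig_set0.
Qed.

(** Over the extension of degree [e], [P] becomes a sum of [e] objects of the
   same class. *)
Lemma class_divisible (K : fieldExtType k) (j : {rmorphism K -> W}) P e rho :
  (forall c : k, j c%:A = iota c) -> indecomposable P -> residue_data (P := P) j e rho ->
  exists2 c, Cn c & cl P = c *+ e.
Proof.
move=> hj hP hr; have e0 : (0 < e)%N by case: hr.
have [L dL] : exists L : fieldExtType k, fdim L = (fdim K * e)%N.
  by apply: (field_of_degree degF); rewrite muln_gt0 fdim_gt0.
have [s _] : exists s : 'AHom(K, L), True by apply: embed_dvd; rewrite dL dvdn_mulr.
have [jL [hjL jE]] := embed_extend s hj.
have [I [Y [hY [D]]]] := decomposition (@hom_finite k A L) (res (Spec_map s) P).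
have ed : (fdim K * e %| fdim L)%N by rewrite dL.
have cI := split_card iota degF jE hP hr hY D ed.
have /card_gt0P[a _] : (0 < #|I|)%N by rewrite cI.
exists (cl (Y a)); first exact: (cl_cone clP).
exact: (split_class degF clP hjL jE D a hP hr hY ed).
Qed.

Let f : series m := fun d => vol F (Zcount Z) * (fun n => (qvol k n - 1)^-1) * Aseries F cl d.

Let G : series m := fun d => \sum_(n \in [set: posn]) cst ((val n)%:R)^-1 * spsi n f d.

Lemma spsi_mul n (g : series m) x : spsi n g (x *+ val n) = vpsi n (g x).
Proof.
rewrite /spsi; have -> : [set e : 'rV[int]_m | e *+ val n = x *+ val n] = [set x].
  apply/seteqP; split=> [e /= h|e /= -> //].
  apply/eqP; rewrite -subr_eq0; apply/eqP; apply: (intvec_torsionfree (valP n)).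
  by rewrite mulrnBl h subrr.
by rewrite fsbig_set1.
Qed.

Lemma spsi_nondvd n (g : series m) x : ~ (exists y, y *+ val n = x) -> spsi n g x = 0.
Proof.
move=> h; rewrite /spsi; have -> : [set e : 'rV[int]_m | e *+ val n = x] = set0.
  by apply/seteqP; split=> // e he; case: h; exists e.
by rewrite fsbig_set0.
Qed.

Let f0 n : f 0 n = 0.
Proof. by rewrite /f -[LHS]/(_ * Acoef (cl (K := F n)) 0) Acoef0 mulr0. Qed.

Let mkposn i : posn := exist _ i.+1 (ltn0Sn i).

(** The [n]-th summand at [x] vanishes unless [n] divides [x]. When [x = 0] all
   of them vanish, no indecomposable having class [0]. *)
Let G_bounded x : exists M0, forall M, (M0 <= M)%N -> forall p,
  G x p = \sum_(i < M) (i.+1)%:R^-1 * spsi (mkposn i) f x p.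
Proof.
have [M0 hM0] : exists M0, forall n : posn, (M0 < val n)%N -> spsi n f x = 0.
  have [->|x0] := eqVneq x 0.
    exists 0%N => n _; rewrite -(mul0rn _ (val n)) spsi_mul; apply/funext => p; exact: f0.
  have [i hi] : exists i, x ord0 i != 0.
    apply: contrapT => hn; case/eqP: x0; apply/rowP => i; rewrite mxE.
    by apply/eqP; apply: contraT => h; case: hn; exists i.
  exists (absz (x ord0 i)) => n hn; apply: spsi_nondvd => -[y hy].
  move: hi hn; rewrite -hy mulmxnE -mulr_natr abszM mulf_eq0 negb_or => /andP[hi _].
  by rewrite ltnNge natz leq_pmull // absz_gt0.
exists M0 => M hM p.
pose T (n : posn) : vring := cst ((val n)%:R)^-1 * spsi n f x.
pose r := [seq mkposn i | i <- seq.iota 0 M].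
have rU : uniq r by rewrite map_inj_uniq ?iota_uniq // => a b /(congr1 val)[].
have -> : G x = \sum_(n <- r) T n.
  transitivity (\sum_(n \in [set` r]) T n); last exact/esym/fsbig_seq.
  apply/esym/fsbig_widen => // n [_ /= hn]; rewrite /T hM0 ?mulr0 //.
  rewrite ltnNge; apply/negP => le; apply: hn; apply/mapP.
  have n0 := valP n; exists (val n).-1; last by apply/val_inj; rewrite /= prednK.
  by rewrite mem_iota /= add0n prednK // (leq_trans le).
have -> : r = map mkposn (index_iota 0 M) by rewrite /index_iota subn0.
rewrite sum_vring big_map big_mkord.
by apply: eq_bigr.
Qed.

Section Degree.
Variable p : posn.
Local Notation K := (F p).
Variables (j : {rmorphism K -> W}) (j_iota : forall c : k, j c%:A = iota c).
Local Notation H d := (Hcoef iota (cl (K := K)) d Z).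

Let weight n : rat := (zfix iota Z (val p * n))%:R / ((q ^ (val p * n))%:R - 1).

Section WithReps.
Variables (d : 'rV[int]_m) (N : nat) (E : 'I_N -> A (Spec K)).
Hypothesis E_indec : forall s, indecomposable (E s).
Hypothesis E_inj : forall s t, isomorphic (E s) (E t) -> s = t.
Hypothesis E_compl : forall P, indecomposable P -> Cn (d - cl P) -> exists s, isomorphic P (E s).
Variables (rho : forall s, hom (E s) (E s) -> W) (e : 'I_N -> nat).
Hypothesis rhoP : forall s, residue_data j (e s) (@rho s).
Variable c : 'I_N -> 'rV[int]_m.
Hypothesis c_cone : forall s, Cn (c s).
Hypothesis cE : forall s, cl (E s) = c s *+ e s.

Let e0 s : (0 < e s)%N. Proof. by case: (rhoP s). Qed.

(** The absolutely indecomposable objects of class [y = x / (i + 1)] over the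
   extension of degree [i + 1] come from the indecomposables [E s] over [K]
   whose residue degree divides [i + 1] and whose class is [e s] times [y]. *)
Lemma psi_term x i : x \in interval C d -> spsi (mkposn i) f x p =
  weight i.+1 * \sum_(s | (e s %| i.+1)%N && (c s *+ i.+1 == x)) (e s)%:R.
Proof.
move=> /(mem_interval hC)[Cx Cdx].
case: (pselect (exists y, y *+ i.+1 = x)) => [[y yx]|hn]; last first.
  rewrite (spsi_nondvd (n := mkposn i)) // big_pred0 ?mulr0 // => s.
  by apply/negP => /andP[_ /eqP h]; apply: hn; exists (c s).
rewrite -yx (spsi_mul (mkposn i)).
set pn := pmul (mkposn i) p.
have dF : fdim (F pn) = (fdim K * i.+1)%N by rewrite /fdim !degF /= mulnC.
rewrite -[LHS]/(Zcount Z (F pn) * (qvol k pn - 1)^-1 * Acoef (cl (K := F pn)) y).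
have -> : Zcount Z (F pn) * (qvol k pn - 1)^-1 = weight i.+1.
  rewrite Zcount_zfix dF /weight /qvol /= [fdim K]degF [(i.+1 * _)%N]mulnC.
  by rewrite -[LHS]/(_ / ((q ^ (val p * i.+1))%:R - 1)).
congr (_ * _); have [s0 _] : exists s : 'AHom(K, F pn), True.
  by apply: embed_dvd; rewrite dF dvdn_mulr.
have [jL [hjL jE]] := embed_extend s0 j_iota.
rewrite (Acoef_residue_degrees degF clP hjL jE dF E_indec E_inj rhoP); last first.
  move=> P r hP rn cP [X cX]; apply: E_compl => //.
  have Cy : Cn y by rewrite -cX; exact: (cl_cone clP).
  have -> : d - cl P = (d - x) + y *+ (i.+1 - r) by rewrite cP -yx mulrnBr // addrA subrK.
  by apply: lattice_coneD => //; exact: (CnMn (lattice_cone0 hC) (lattice_coneD hC)).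
rewrite natr_sum; apply: eq_bigl => s; congr (_ && _); rewrite cE.
have tf n (u v : 'rV[int]_m) : (0 < n)%N -> (u *+ n == v *+ n) = (u == v).
  move=> n0; apply/eqP/eqP => [h|->//]; apply/eqP; rewrite -subr_eq0; apply/eqP.
  by apply: (intvec_torsionfree n0); rewrite mulrnBl h subrr.
by rewrite !tf.
Qed.

Let B := size (interval C d).

Let c_bound s n : (e s %| n)%N -> Cn (d - c s *+ n) -> (n <= e s * B)%N.
Proof.
move=> /dvdnP[t ->]; rewrite mulnC mulrnA -cE => h.
rewrite leq_pmul2l //; apply: (interval_multiples hC) h; first exact: (cl_cone clP).
by apply: (indec_class_nz j (class_additive clP (M := K)) (cl_finite clP K) (E_indec s)).
Qed.

Lemma log_series_term x M : x \in interval C d -> (forall s, e s * B <= M)%N ->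
  G x p = \sum_(i < M) (i.+1)%:R^-1 * (weight i.+1 *
    \sum_(s | (e s %| i.+1)%N && (c s *+ i.+1 == x)) (e s)%:R).
Proof.
move=> xd hM; have [M0 hM0] := G_bounded x.
rewrite (hM0 (M0 + M)%N) ?leq_addr //.
rewrite [RHS](big_ord_widen (M0 + M) (fun i => (i.+1)%:R^-1 * (weight i.+1 *
    \sum_(s | (e s %| i.+1)%N && (c s *+ i.+1 == x)) (e s)%:R))) ?leq_addl //.
rewrite [RHS]big_mkcond; apply: eq_bigr => i _; rewrite psi_term //; case: ltnP => // Mi.
rewrite big_pred0 ?mulr0 // => s; apply/negP => /andP[h1 /eqP h2].
have /(mem_interval hC)[_] := xd; rewrite -h2 => /(c_bound h1).
by rewrite leqNgt ltnS (leq_trans (hM s)).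
Qed.

(** An indecomposable [E s] of class [c s *+ e s] contributes to both sides in
   the degrees [cl (E s) *+ t.+1 = c s *+ (e s * t.+1)]. On the left these come
   from the matrices over its residue field, on the right from the extensions
   of degree [e s * t.+1], over which it splits into [e s] absolutely
   indecomposable objects; the factor [e s] and the division by the degree
   combine with the coordinate of [c s *+ (e s * t.+1)] to that of [cl (E s)]. *)
Lemma Hcoef_log_derivative_reps i : euler i (fun x => H x) d =
  conv C (euler i (fun x => G x p)) (fun x => H x) d.
Proof.
have hB r : Cn (d - \sum_s cl (E s) *+ r s) -> forall s, (r s <= B)%N.
  move=> h s; apply: (interval_multiples hC (e := cl (E s))); first exact: (cl_cone clP).
    exact: (indec_class_nz j (class_additive clP (M := K)) (cl_finite clP K) (E_indec s)).
  have -> : d - cl (E s) *+ r s = (d - \sum_s cl (E s) *+ r s) + \sum_(t | t != s) cl (E t) *+ r t.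
    by rewrite (bigD1 s) //= opprD addrA subrK.
  apply: lattice_coneD => //; apply: (Cn_sum (lattice_cone0 hC) (lattice_coneD hC)) => t.
  by apply: (CnMn (lattice_cone0 hC) (lattice_coneD hC)); exact: (cl_cone clP).
rewrite /euler (Hcoef_recursion_reps (Cn := fun x => Cn x) degF j_iota (class_additive clP (M := K))
  (lattice_cone0 hC) (lattice_coneD hC) (fun X => cl_cone clP X) Z E_indec E_inj E_compl rhoP hB).
(* Extensions of degree larger than [M] do not contribute in degree [d]. *)
pose M := (\sum_s e s * B.+1)%N.
have hM s : (e s * B.+1 <= M)%N by rewrite /M (bigD1 s) //= leq_addr.
pose phi s n := (cl (E s) 0 i)%:~R * weight n * H (d - c s *+ n).
transitivity (\sum_s \sum_(n < M | (e s %| n.+1)%N) phi s n.+1).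
  apply: eq_bigr => s _; transitivity (\sum_(0 <= t < B.+1) phi s (e s * t.+1)%N).
    rewrite big_mkord; apply: eq_bigr => t _.
    by rewrite /phi /weight mulrnA -cE mulnA [fdim K]degF.
  rewrite -sum_multiples // -(big_mkord (fun n => (e s %| n.+1)%N) (fun n => phi s n.+1)).
  rewrite [RHS](big_cat_nat (n := (e s * B.+1)%N)) //= [X in _ = _ + X]big_nat_cond.
  rewrite [X in _ = _ + X]big1 ?addr0 // => n /andP[/andP[le _] dv]; rewrite /phi Hcoef_out ?mulr0 // => /(c_bound dv).
  by rewrite leqNgt ltnS (leq_trans _ le) // leq_mul2l leqnSn orbT.
rewrite /conv; transitivity (\sum_(x <- interval C d) \sum_s \sum_(n < M | (e s %| n.+1)%N)
    (if c s *+ n.+1 == x then (x 0 i)%:~R * ((n.+1)%:R^-1 * (weight n.+1 * (e s)%:R)) * H (d - x)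
     else 0)); last first.
  apply: eq_big_seq => x xd; rewrite (log_series_term xd (M := M)); last first.
    by move=> s; apply: leq_trans (hM s); rewrite leq_mul2l leqnSn orbT.
  under [LHS]eq_bigr => s _ do rewrite big_mkcond.
  move: (H (d - x)) => Hx; rewrite exchange_big /= mulr_sumr mulr_suml; apply: eq_bigr => n _ /=.
  rewrite [in RHS]big_mkcond !mulr_sumr mulr_suml; apply: eq_bigr => s _.
  case: (e s %| n.+1)%N => /=; last by rewrite !(mulr0, mul0r).
  by case: (c s *+ n.+1 == x) => //; rewrite !(mulr0, mul0r).
rewrite [RHS]exchange_big; apply: eq_bigr => s _; rewrite [RHS]exchange_big; apply: eq_bigr => n dv /=.
rewrite -big_mkcond; case: (boolP (c s *+ n.+1 \in interval C d)) => h; last first.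
  rewrite big_seq_cond big_pred0 => [|x]; last first.
    by apply/negP => /andP[xd /eqP hx]; rewrite hx xd in h.
  rewrite /phi Hcoef_out ?mulr0 // => h'; move/negP: h; apply; apply/(mem_interval hC).
  by split=> //; exact: (CnMn (lattice_cone0 hC) (lattice_coneD hC)).
rewrite (big_rem (c s *+ n.+1)) //= eqxx big_seq_cond big_pred0 ?addr0 => [|x]; last first.
  apply/negP => /andP[+ /eqP hx]; rewrite -hx mem_rem_uniq ?interval_uniq //.
  by rewrite inE eqxx.
rewrite /phi cE !mulmxnE; congr (_ * _); exact: mulrn_div_cancel.
Qed.

End WithReps.

Lemma reps_exist d : exists (N : nat) (E : 'I_N -> A (Spec K))
    (rho : forall s, hom (E s) (E s) -> W) (e : 'I_N -> nat),
  [/\ forall s, indecomposable (E s) /\ Cn (d - cl (E s)),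
      forall s t, isomorphic (E s) (E t) -> s = t,
      forall P, indecomposable P -> Cn (d - cl P) -> exists s, isomorphic P (E s) &
      forall s, residue_data j (e s) (@rho s)].
Proof.
have [N [E [hE E_inj E_compl]]] := indec_reps (cl_finite clP K)
  (Cn := fun x => Cn x) (lattice_interval_finite hC) (fun X => cl_cone clP X) d.
have h s : {rho : hom (E s) (E s) -> W & {e : nat | residue_data j e rho}}.
  have [rho he] := cid (residue_exists j (hE s).1).
  by exists rho; have [e h] := cid he; exists e.
by exists N, E, (fun s => projT1 (h s)), (fun s => sval (projT2 (h s))); split=> // s;
  exact: svalP (projT2 (h s)).
Qed.

Lemma Hcoef_log_derivative d i : euler i (fun x => H x) d =
  conv C (euler i (fun x => G x p)) (fun x => H x) d.
Proof.
have [N [E [rho [e [hE E_inj E_compl rhoP]]]]] := reps_exist d.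
have E_indec s : indecomposable (E s) by case: (hE s).
have hc s : exists c, Cn c /\ cl (E s) = c *+ e s.
  by have [c h1 h2] := class_divisible j_iota (E_indec s) (rhoP s); exists c.
have [c cP] := choice hc.
exact: (Hcoef_log_derivative_reps E_indec E_inj E_compl rhoP (fun s => (cP s).1)
  (fun s => (cP s).2)).
Qed.

Lemma Hcoef_zero : H 0 = 1.
Proof.
have [N [E [rho [e [hE E_inj E_compl rhoP]]]]] := reps_exist 0.
have E_indec s : indecomposable (E s) by case: (hE s).
have none (s : 'I_N) : False.
  apply: (indec_class_nz j (class_additive clP (M := K)) (cl_finite clP K) (E_indec s)).
  apply: (lattice_cone_pointed hC); first exact: (cl_cone clP).
  by have [_] := hE s; rewrite sub0r.
have hB (r : 'I_N -> nat) : Cn (0 - \sum_s cl (E s) *+ r s) -> forall s, (r s <= 0)%N.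
  by move=> _ s; case: (none s).
rewrite (Hcoef_mcount (Cn := fun x => Cn x) degF j_iota (class_additive clP (M := K))
  (lattice_cone0 hC) (lattice_coneD hC) (fun X => cl_cone clP X) Z E_indec E_inj E_compl rhoP hB);
  last by rewrite subrr; exact: (lattice_cone0 hC).
rewrite /mcount (big_pred1 [ffun=> ord0]) => [|r].
  by rewrite big1 // => s; case: (none s).
have -> : r = [ffun=> ord0] by apply/ffunP => s; case: (none s).
by rewrite /= eqxx /mwt big1 ?eqxx // => s; case: (none s).
Qed.

End Degree.

Lemma Hseries_Exp : Hseries iota F cl Z = Exp C f.
Proof.
apply/funext => d; apply/funext => p.
have [j j_iota] := embed_closed (F p) iota.
have G0 p' : G 0 p' = 0.
  have [M hM] := G_bounded 0; rewrite (hM M) // big1 // => i _.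
  by rewrite -(mul0rn _ i.+1) (spsi_mul (mkposn i)) /vpsi f0 mulr0.
rewrite -[RHS]/(sexp C G d p) (sexp_eval hC d p G0).
apply: (conv_exp_unique hC (G0 p) (g := fun x => Hcoef iota (cl (K := F p)) x Z)).
- exact: Hcoef_zero j_iota.
- by move=> x; exact: Hcoef_out.
- by move=> x i; exact: Hcoef_log_derivative j_iota x i.
Qed.

End Formula.

Theorem theorem1p4
  (k : finFieldType)
  (kbar : closedFieldType) (iota : {rmorphism k -> kbar})
  (kbar_algebraic : integralRange iota)
  (F : posn -> fieldExtType k)
  (degF : forall n : posn, \dim {: F n} = val n)
  (A : linear_stack k)
  (R : realType) (m : nat) (C : set 'rV[R]_m)
  (cl : forall K : fieldExtType k, A (Spec K) -> 'rV[int]_m)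
  (clP : class_map C cl)
  (Z : subvariety k) :
  Hseries iota F cl Z =
  Exp C (fun d => vol F (Zcount Z) * (fun n => (qvol k n - 1)^-1)
                  * Aseries F cl d).
Proof. exact: (Hseries_Exp iota degF clP Z). Qed.
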